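(* Let either $\tau\in(0,1)$ and $d=1$, or $\tau=1$ and $d\ge1$ arbitrary. Then the chained clasp configuration $L=\alpha\cup\beta\cup\gamma$ with parameters $(\tau,d)$ defined in the context (a closed component $\alpha$ clasped at its bottom with an arc $\beta$ attached to the floor and at its top with an arc $\gamma$ attached to the ceiling) is strongly critical for minimizing length (all weights equal to $1$) when constrained by Gehring thickness.
   Context: GENERALIZED LINKS AND CRITICALITY. A generalized link $L$ is a curve in $\mathbb{R}^3$ with finitely many, mutually disjoint components $L_i$ (arcs or closed curves), where each endpoint $x\in\partial L$ is constrained to stay on a given affine subspace $M_x\subset\mathbb{R}^3$, together with finitely many obstacles $\{p\in\mathbb{R}^3: g_j(p)<0\}$, with $g_j$ of class $C^1$ having $0$ as a regular value; $L$ must lie in $\{\min_j g_j\ge 0\}$. The Gehring thickness $\mathrm{GThi}(L)$ is the minimal distance between points on different components of $L$. The Gehring ropelength problem is to minimize length subject to $\mathrm{GThi}\ge1$. A Gehring strut is an unordered pair $\{x,y\}$ of points on different components with $|x-y|=\mathrm{GThi}(L)$; a wall strut is a pair $(j,x)$ with $x\in L$, $g_j(x)=0$. A compatible vectorfield is a continuous $\xi:L\to\mathbb{R}^3$ (continuous along the parametrized curve) with $\xi_x$ tangent to $M_x$ at each endpoint $x$. The first variation of length of a component with unit tangent $T$ (of bounded variation) is $\delta_\xi\mathrm{Len}=[T\cdot\xi]_{\mathrm{start}}^{\mathrm{end}}-\int\xi\cdot dT$ (no boundary term for closed components), and $\delta_\xi\mathrm{Len}(L)=\sum_i \delta_\xi\mathrm{Len}(L_i)$.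 Put $\delta^+_\xi\mathrm{GThi}(L)=\min (\xi_x-\xi_y)\cdot\frac{x-y}{|x-y|}$ over all Gehring struts $\{x,y\}$, and $\delta^+_\xi O(L)=\min \xi_x\cdot\nabla g_j(x)$ over all wall struts $(j,x)$; these are the one-sided first variations of $\mathrm{GThi}$ and of $O(L)=\min_j\min_{x\in L}g_j(x)$. $L$ is strongly critical for minimizing length when constrained by $\mathrm{GThi}$ if there is $\varepsilon>0$ such that for all compatible $\xi$ with $\delta_\xi\mathrm{Len}(L)=-1$ we have $\min(\delta^+_\xi\mathrm{GThi}(L),\delta^+_\xi O(L))\le-\varepsilon$. $\tau$-CLASP ARCS. Use coordinates $(x_1,x_2,z)$ on $\mathbb{R}^3$ with $z$ vertical. For $\tau\in(0,1]$ and $u\in[0,\tau]$ set $v=\tau-u$ and $$X(u)=\sqrt{\frac{u^2(1-v^2)}{1-u^2v^2}},\qquad Z(u)=\int_0^u\frac{s}{\sqrt{1-s^2}}\,X'(s)\,ds,$$ extended to $[-\tau,\tau]$ by $X(-u)=-X(u)$, $Z(-u)=Z(u)$. Let $h=Z(\tau)+\sqrt{1-\tau^2}$. CONFIGURATION with parameters $(\tau,d)$. The arc $\gamma$ lies in the plane $x_1=0$: its curved part is $\{(0,X(u),\tfrac d2+Z(u)):|u|\le\tau\}$, with tip $t_\gamma=(0,0,\tfrac d2)$, extended at its ends $u=\pm\tau$ by straight segments in directions $m_\pm=(0,\pm\sqrt{1-\tau^2},\tau)$ until they meet the planes $m_\pm\cdot p=c$. The arc $\beta$ is the mirror image of $\gamma$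 under $z\mapsto-z$, with tip $t_\beta=(0,0,-\tfrac d2)$ and ends on the planes $m'_\pm\cdot p=c$, $m'_\pm=(0,\pm\sqrt{1-\tau^2},-\tau)$. The closed curve $\alpha$ lies in the plane $x_2=0$, is symmetric under $z\mapsto-z$, and consists of: the arc $\{(X(u),0,\tfrac d2+h-Z(u)):|u|\le\tau\}$; the arcs of the unit circle about $t_\gamma$ in the plane $x_2=0$ from its endpoints $(\pm\tau,0,\tfrac d2+\sqrt{1-\tau^2})$ to $(\pm1,0,\tfrac d2)$ (degenerate to points when $\tau=1$); the mirror images of these arcs under $z\mapsto -z$; and the two vertical segments of length $d$ from $(\pm1,0,\tfrac d2)$ to $(\pm1,0,-\tfrac d2)$. Thus for $\tau<1$ (where $d=1$) the tips of $\beta$ and $\gamma$ are at distance exactly $1$, while for $\tau=1$ one has a one-parameter family indexed by the distance $d\ge1$ between the tips, with horizontal floor and ceiling. Each endpoint is constrained to the plane just named on which it lies. The obstacles are given by $g=c-m_\pm\cdot p$ and $g=c-m'_\pm\cdot p$; the constant $c$ is fixed and large enough that the whole configuration lies in $\{m_\pm\cdot p\le c,\ m'_\pm\cdot p\le c\}$. *)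

(* Defs.v *)
From HB Require Import structures.
From mathcomp Require Import all_boot all_order all_algebra.
From mathcomp Require Import all_classical all_reals all_analysis.

Set Implicit Arguments.
Unset Strict Implicit.
Unset Printing Implicit Defensive.

Import Order.TTheory GRing.Theory Num.Theory.
Import numFieldNormedType.Exports.
Local Open Scope classical_set_scope.
Local Open Scope ring_scope.

Section EuclideanSpace.
Context {R : realType}.
Local Notation V := 'rV[R]_3.

(* The coordinates are (x_1, x_2, z). *)
Definition vec3 (x y z : R) : V := \row_(i < 3) [:: x; y; z]`_i.

Definition dot (v w : V) : R := \sum_i v 0 i * w 0 i.

(* The norm `|v| that MathComp puts on row vectors is the sup norm. *)
Definition enorm (v : V) : R := Num.sqrt (dot v v).

Definition grad (g : V -> R) (p : V) : V := \row_i 'D_(delta_mx 0 i) g p.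

Definition affine_subspace (M : set V) :=
  exists (p : V) (W : 'M[R]_3), M = [set q | (q - p <= W)%MS].

(* For x in the affine subspace M. *)
Definition tangent_to (M : set V) (x w : V) := M (x + w).

End EuclideanSpace.

Section StieltjesIntegral.
Context {R : realType}.
Local Notation V := 'rV[R]_3.

(* I is the limit, as the mesh tends to 0, of the Riemann-Stieltjes sums
   over tagged partitions a = t_0 <= ... <= t_n = b, c_k in [t_k, t_k+1]. *)
Definition is_stieltjes (f g : R -> V) (a b I : R) :=
  forall e : R, 0 < e -> exists2 del : R, 0 < del &
    forall (n : nat) (t c : nat -> R), t 0%N = a -> t n = b ->
      (forall k, (k < n)%N -> t k <= c k <= t k.+1 /\ t k.+1 - t k < del) ->
      `|\sum_(k < n) dot (f (c k)) (g (t k.+1) - g (t k)) - I| < e.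

(* The integral of f . dg over [a, b]; it exists for f continuous and g of
   bounded variation, and is 0 by convention where it does not exist. *)
Definition stieltjes (f g : R -> V) (a b : R) : R :=
  xget 0 [set I | is_stieltjes f g a b I].

End StieltjesIntegral.

Section GeneralizedLinks.
Context {R : realType}.
Local Notation V := 'rV[R]_3.

Record curve := Curve { lo : R; hi : R; pos : R -> V }.

(* Arc c A B has its start constrained to A and its end constrained to B. *)
Inductive component :=
| Arc of curve & set V & set V
| Loop of curve.

Definition curve_of (K : component) : curve :=
  match K with Arc c _ _ => c | Loop c => c end.

Definition dom (K : component) : set R := `[lo (curve_of K), hi (curve_of K)].

Definition at_par (K : component) : R -> V := pos (curve_of K).

Definition secant (c : curve) (s t : R) : V :=
  (enorm (pos c t - pos c s))^-1 *: (pos c t - pos c s).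

(* The oriented unit tangent as a limit of secant directions, which does not
   depend on the parametrization.  At an interior jump of T the value chosen
   does not affect the integral of a continuous field against dT. *)
Definition rtangent (c : curve) (t : R) : V := lim (secant c t s @[s --> t^'+]).
Definition ltangent (c : curve) (t : R) : V := lim (secant c s t @[s --> t^'-]).

(* On a loop the value at hi is the one at lo, so that an integral against dT
   over [lo, hi] is the integral over the whole closed curve, including a
   possible corner at the base point. *)
Definition unit_tangent (K : component) (t : R) : V :=
  match K with
  | Arc c _ _ => if t < hi c then rtangent c t else ltangent c (hi c)
  | Loop c => if t < hi c then rtangent c t else rtangent c (lo c)
  end.

Definition component_wf (K : component) :=
  let c := curve_of K in
  [/\ lo c < hi c,
      {within dom K, continuous (pos c)},
      forall t, lo c <= t < hi c -> cvg (secant c t s @[s --> t^'+]),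
      cvg (secant c s (hi c) @[s --> (hi c)^'-]) &
      forall i, bounded_variation (lo c) (hi c)
                  (fun t => unit_tangent K t 0 i)] /\
  match K with
  | Arc c A B =>
      [/\ affine_subspace A, affine_subspace B, A (pos c (lo c)) &
          B (pos c (hi c))]
  | Loop c => pos c (lo c) = pos c (hi c)
  end.

(* The j-th obstacle is {p | obs j p < 0}. *)
Record link := Link {
  ncomp : nat;
  comp : 'I_ncomp -> component;
  nobs : nat;
  obs : 'I_nobs -> V -> R }.

Definition avoids_obstacles (L : link) :=
  forall (i : 'I_(ncomp L)) (t : R), dom (comp i) t ->
  forall j : 'I_(nobs L), 0 <= obs j (at_par (comp i) t).

Definition obstacle_wf (g : V -> R) :=
  [/\ forall p, differentiable g p,
      continuous (grad g) &
      forall p, g p = 0 -> grad g p != 0].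

Definition generalized_link (L : link) :=
  [/\ forall i : 'I_(ncomp L), component_wf (comp i),
      forall i j : 'I_(ncomp L), i != j -> forall s t,
        dom (comp i) s -> dom (comp j) t ->
        at_par (comp i) s != at_par (comp j) t,
      forall j : 'I_(nobs L), obstacle_wf (obs j) &
      avoids_obstacles L].

Definition GThi (L : link) : \bar R :=
  ereal_inf [set r | exists (i j : 'I_(ncomp L)) (s t : R),
    [/\ i != j, dom (comp i) s, dom (comp j) t &
        r = (enorm (at_par (comp i) s - at_par (comp j) t))%:E]].

(* A vectorfield along L assigns a vector to each component index and
   parameter. *)
Definition vectorfield (L : link) := 'I_(ncomp L) -> R -> V.

Definition compatible (L : link) (xi : vectorfield L) :=
  forall i : 'I_(ncomp L),
    {within dom (comp i), continuous (xi i)} /\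
    match comp i with
    | Arc c A B =>
        tangent_to A (pos c (lo c)) (xi i (lo c)) /\
        tangent_to B (pos c (hi c)) (xi i (hi c))
    | Loop c => xi i (lo c) = xi i (hi c)
    end.

Definition dlen_comp (K : component) (xi : R -> V) : R :=
  let T := unit_tangent K in
  match K with
  | Arc c _ _ =>
      dot (T (hi c)) (xi (hi c)) - dot (T (lo c)) (xi (lo c))
      - stieltjes xi T (lo c) (hi c)
  | Loop c => - stieltjes xi T (lo c) (hi c)
  end.

Definition dlen (L : link) (xi : vectorfield L) : R :=
  \sum_(i < ncomp L) dlen_comp (comp i) (xi i).

Definition gehring_strut (L : link) (i j : 'I_(ncomp L)) (s t : R) :=
  [/\ i != j, dom (comp i) s, dom (comp j) t &
      (enorm (at_par (comp i) s - at_par (comp j) t))%:E = GThi L].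

Definition wall_strut (L : link) (j : 'I_(nobs L)) (i : 'I_(ncomp L)) (t : R) :=
  dom (comp i) t /\ obs j (at_par (comp i) t) = 0.

(* The minima over struts are infima in the extended reals, so that a minimum
   over no strut is +oo.  A strut counted in both orders gives the same value
   twice. *)
Definition dGThi (L : link) (xi : vectorfield L) : \bar R :=
  ereal_inf [set r | exists (i j : 'I_(ncomp L)) (s t : R),
    gehring_strut i j s t /\
    let w := at_par (comp i) s - at_par (comp j) t in
    r = (dot (xi i s - xi j t) ((enorm w)^-1 *: w))%:E].

Definition dO (L : link) (xi : vectorfield L) : \bar R :=
  ereal_inf [set r | exists (j : 'I_(nobs L)) (i : 'I_(ncomp L)) (t : R),
    wall_strut j i t /\
    r = (dot (xi i t) (grad (obs j) (at_par (comp i) t)))%:E].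

Definition strongly_critical (L : link) :=
  exists2 eps : R, 0 < eps &
    forall xi : vectorfield L, compatible xi -> dlen xi = -1 ->
      (Order.min (dGThi xi) (dO xi) <= (- eps)%:E)%E.

End GeneralizedLinks.

Arguments component R : clear implicits.
Arguments link R : clear implicits.

Section ChainedClasp.
Context {R : realType}.
Local Notation V := 'rV[R]_3.
Variables (tau d c : R).

Definition claspX_pos (u : R) : R :=
  let v := tau - u in
  Num.sqrt (u ^+ 2 * (1 - v ^+ 2) / (1 - u ^+ 2 * v ^+ 2)).

Definition claspX (u : R) : R :=
  if 0 <= u then claspX_pos u else - claspX_pos (- u).

(* A Lebesgue integral: for tau = 1 the integrand is unbounded near s = 1. *)
Definition claspZ (u : R) : R :=
  \int[lebesgue_measure]_(s in `[0, `|u|])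
    (s / Num.sqrt (1 - s ^+ 2) * derive1 claspX s).

Definition clasp_height : R := claspZ tau + Num.sqrt (1 - tau ^+ 2).

Definition mirror (p : V) : V := vec3 (p 0 0) (p 0 1) (- p 0 2).

Definition m_plus : V := vec3 0 (Num.sqrt (1 - tau ^+ 2)) tau.
Definition m_minus : V := vec3 0 (- Num.sqrt (1 - tau ^+ 2)) tau.
Definition m'_plus : V := vec3 0 (Num.sqrt (1 - tau ^+ 2)) (- tau).
Definition m'_minus : V := vec3 0 (- Num.sqrt (1 - tau ^+ 2)) (- tau).

Definition plane (m : V) : set V := [set p | dot m p = c].

Definition gamma_curved (u : R) : V := vec3 0 (claspX u) (d / 2 + claspZ u).

Definition gamma_pos (t : R) : V :=
  if t < - tau then gamma_curved (- tau) + (- tau - t) *: m_minus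
  else if t <= tau then gamma_curved t
  else gamma_curved tau + (t - tau) *: m_plus.

(* As m_minus and m_plus are unit vectors, the straight segments meet their
   planes at length c - m . p, p being the end of the curved part.  These
   lengths are nonnegative as soon as the top point (0, 0, d/2 + h) of alpha
   satisfies m_plus . p <= c. *)
Definition gamma_lo : R := - tau - (c - dot m_minus (gamma_curved (- tau))).
Definition gamma_hi : R := tau + (c - dot m_plus (gamma_curved tau)).

Definition gamma : component R :=
  Arc (Curve gamma_lo gamma_hi gamma_pos) (plane m_minus) (plane m_plus).

Definition beta : component R :=
  Arc (Curve gamma_lo gamma_hi (mirror \o gamma_pos))
      (plane m'_minus) (plane m'_plus).

(* The part of alpha with z >= d/2.  The point of the unit circle about the
   tip (0, 0, d/2) of gamma is parametrized by its first coordinate. *)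
Definition alpha_top (u : R) : V :=
  if `|u| <= tau then vec3 (claspX u) 0 (d / 2 + clasp_height - claspZ u)
  else vec3 u 0 (d / 2 + Num.sqrt (1 - u ^+ 2)).

Definition alpha_pos (t : R) : V :=
  if t <= 1 then alpha_top t
  else if t <= 1 + d then vec3 1 0 (d / 2 - (t - 1))
  else if t <= 3 + d then mirror (alpha_top (2 + d - t))
  else vec3 (- 1) 0 (- (d / 2) + (t - (3 + d))).

Definition alpha : component R := Loop (Curve (- 1) (3 + 2 * d) alpha_pos).

Definition chained_clasp : link R :=
  @Link R
    3 (fun i => tnth [tuple alpha; beta; gamma] i)
    4 (fun j p => c - dot (tnth [tuple m_plus; m_minus; m'_plus; m'_minus] j) p).

End ChainedClasp.

(* Main.v *)
Require Import Defs.
From mathcomp Require Import all_boot all_order all_algebra.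
From mathcomp Require Import all_classical all_reals all_analysis.
From mathcomp Require Import measurable_realfun ring lra.

Set Implicit Arguments.
Unset Strict Implicit.
Unset Printing Implicit Defensive.

Import Order.TTheory GRing.Theory Num.Theory.
Import numFieldNormedType.Exports.
Local Open Scope classical_set_scope.
Local Open Scope ring_scope.

(** The link is critical because its struts carry a balanced system of forces.
Write sigma(u) = u / sqrt (1 - u^2).  The oriented tangent of gamma at
parameter u is (0, sqrt (1 - u^2), u), that of the upper part of alpha is
(sqrt (1 - u^2), 0, - u), so the curvature force of a piece of curve, the
measure - dT, has density (0, sigma u, -1) on gamma and (sigma u, 0, 1) on
alpha.  Three families of struts have length exactly 1.

- For |s| + |t| = tau the points gamma(s) and alpha(t) are at distance 1, and
  their difference is (- X t, X s, - Y) with X u = sigma u * Y for u = |s| and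
  for u = |t|.  Here Y = sqrt ((1-u^2)(1-v^2)/(1-u^2v^2)), v = tau - u.  That
  the third coordinate is - Y is the identity Z u + Z (tau - u) + Y u = h, whose
  two sides agree at u = 0 and have equal derivatives (strut_height).  Of the
  four struts with |s| = u and |t| = tau - u, those that meet at one point have
  for resultant a multiple of the curvature force there; with weight
  du / (2 Y) the two balance exactly.
- Each point of the circular arcs of alpha is joined to the tip of gamma; the
  weight dt / sqrt (1 - t^2) balances the arcs, and leaves on the tip a vertical
  force of size 2 (1 - tau).
- The strut between the two tips carries the weight 2 (1 - tau).  It is there
  when d = 1, and for tau = 1 no force is left on the tips.

On the straight segments T is constant, and at the ends of beta and gamma the
tangent is normal to the constraint plane, so no force is left over.  Hence the
first variation of length is the integral of the first variations of strut
lengths against a positive measure.  Its mass is at most 22, because the three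
coordinates of a strut are at most 1 and their squares add up to 1, so that
1 / Y <= sigma u + sigma v + 1, an integrable bound.  If every strut variation
is above - 1/23, the variation of length is at least - 22/23, and is not -1.

The pairs above are struts only if no two components come closer than 1
(components_far).  The one point that is not elementary is clasp_distance: for
fixed u the squared distance from gamma(u) to alpha(v) has a derivative in v
proportional to Y v - (h - Z u - Z v), and strut_height together with the
monotonicity of Z shows that this is at most 0 up to v = tau - u, and at least 0
afterwards.

Integrals against dT are handled through primitives.  A primitive F of f dg is
recognized by an estimate on its increments (rs_integral) that is additive over
intervals and over integrators, and that bounds the error of every
Riemann-Stieltjes sum.  Inequalities between integrals then follow from the
sign of a derivative, as in clasp_pair_balance and tip_arc_balance.  The tangent
of a curve, a limit of secant directions, is found from the mean value theorem
applied to the scalar products of the curve with fixed vectors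
(cvg_direction, moves_along_dot). *)

(** * Continuity on a segment, clamping, and primitives *)

Section Calculus.
Context {R : realType}.
Implicit Types (a b c d s t x y w I : R) (f g h F G : R -> R).
Local Notation mu := (@lebesgue_measure R).

Lemma within_itvW f a b c d : a <= c -> d <= b ->
  {within `[a, b], continuous f} -> {within `[c, d], continuous f}.
Proof.
move=> ac db; apply: continuous_subspaceW => z /=.
by rewrite !in_itv/= => /andP[cz zd]; rewrite (le_trans ac cz) (le_trans zd db).
Qed.

(** Continuity on a segment in terms of epsilon and delta, which suits the
composition of functions that are continuous only on segments. *)
Lemma within_itvP f a b : {within `[a, b], continuous f} <->
  forall x, a <= x <= b -> forall e, 0 < e -> exists2 del, 0 < del &
    forall y, a <= y <= b -> `|x - y| < del -> `|f x - f y| < e.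
Proof.
split=> [/subspace_continuousP cf x xab e e0|H].
  have /cf /cvgrPdist_lt /(_ e e0) : [set` `[a, b]] x by rewrite /= in_itv.
  rewrite near_withinE => /nbhs_ballP[del /= d0 D]; exists del => // y yab xy.
  by apply: D => //=; rewrite in_itv.
apply/subspace_continuousP => x /=; rewrite in_itv/= => xab.
apply/cvgrPdist_lt => e e0; rewrite near_withinE.
have [del d0 D] := H x xab e e0.
apply/nbhs_ballP; exists del => //= y xy; rewrite in_itv/= => yab.
exact: D.
Qed.

Lemma within_itv_eq f g a b : (forall x, a <= x <= b -> f x = g x) ->
  {within `[a, b], continuous f} -> {within `[a, b], continuous g}.
Proof.
move=> fg /within_itvP cf; apply/within_itvP => x xab e e0.
have [del d0 D] := cf x xab e e0; exists del => // y yab xy.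
by rewrite -!fg//; exact: D.
Qed.

Lemma within_itv_comp f h a b c d : (forall x, a <= x <= b -> c <= h x <= d) ->
  {within `[a, b], continuous h} -> {within `[c, d], continuous f} ->
  {within `[a, b], continuous (f \o h)}.
Proof.
move=> hab /within_itvP ch /within_itvP cf; apply/within_itvP => x xab e e0.
have [d1 d10 D1] := cf _ (hab x xab) e e0.
have [d2 d20 D2] := ch x xab d1 d10.
exists d2 => // y yab xy /=; apply: D1; [exact: hab|exact: D2].
Qed.

Lemma within_itv_cont f a b : continuous f -> {within `[a, b], continuous f}.
Proof. exact: continuous_subspaceT. Qed.

Lemma within_itv_cst a b k : {within `[a, b], continuous (fun=> k : R)}.
Proof. by move=> x; exact: cvg_cst. Qed.

Lemma within_itvD f g a b : {within `[a, b], continuous f} ->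
  {within `[a, b], continuous g} -> {within `[a, b], continuous (fun x => f x + g x)}.
Proof. by move=> cf cg x; apply: cvgD; [exact: cf|exact: cg]. Qed.

Lemma within_itvN f a b : {within `[a, b], continuous f} ->
  {within `[a, b], continuous (fun x => - f x)}.
Proof. by move=> cf x; apply: cvgN; exact: cf. Qed.

Lemma within_itvB f g a b : {within `[a, b], continuous f} ->
  {within `[a, b], continuous g} -> {within `[a, b], continuous (fun x => f x - g x)}.
Proof. by move=> cf cg; apply: within_itvD => //; exact: within_itvN. Qed.

Lemma within_itvM f g a b : {within `[a, b], continuous f} ->
  {within `[a, b], continuous g} -> {within `[a, b], continuous (fun x => f x * g x)}.
Proof. by move=> cf cg x; apply: cvgM; [exact: cf|exact: cg]. Qed.

Lemma within_itvZ f a b k : {within `[a, b], continuous f} ->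
  {within `[a, b], continuous (fun x => k * f x)}.
Proof. by move=> cf; apply: within_itvM => //; exact: within_itv_cst. Qed.

Lemma within_itv_id a b : {within `[a, b], continuous (fun x : R => x)}.
Proof. by apply: continuous_subspaceT => x; exact: cvg_id. Qed.

Lemma within_itv_sqrt f a b : {within `[a, b], continuous f} ->
  {within `[a, b], continuous (fun x => Num.sqrt (f x))}.
Proof.
by move=> cf x; apply: continuous_cvg; [exact: sqrt_continuous|exact: cf].
Qed.

Lemma within_itv_cat f a b c : a <= b -> b <= c ->
  {within `[a, b], continuous f} -> {within `[b, c], continuous f} ->
  {within `[a, c], continuous f}.
Proof.
move=> ab bc c1 c2.
have -> : `[a, c]%classic = `[a, b]%classic `|` `[b, c]%classic.
  apply/seteqP; split=> z /=; rewrite !in_itv/=; lra.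
by apply: withinU_continuous => //; exact: itv_closed.
Qed.

Definition clamp k t : R := Num.max (- k) (Num.min t k).

Lemma clamp_id k t : - k <= t <= k -> clamp k t = t.
Proof. by move=> /andP[kt tk]; rewrite /clamp min_l// max_r. Qed.

Lemma clamp_ge k t : 0 <= k -> k <= t -> clamp k t = k.
Proof. move=> k0 kt; rewrite /clamp min_r// max_r//; lra. Qed.

Lemma clamp_le k t : 0 <= k -> t <= - k -> clamp k t = - k.
Proof. move=> k0 kt; rewrite /clamp min_l ?max_l//; lra. Qed.

Lemma clamp_itv k t : 0 <= k -> - k <= clamp k t <= k.
Proof.
by move=> k0; rewrite /clamp le_max lexx/= ge_max ge_min lexx orbT andbT; lra.
Qed.

Lemma clamp_homo k : {homo clamp k : x y / x <= y}.
Proof. by move=> x y xy; apply: le_max2 => //; apply: le_min2. Qed.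

Lemma clamp_lip k x y : `|clamp k x - clamp k y| <= `|x - y|.
Proof.
wlog xy : x y / x <= y.
  by move=> H; have [/H//|/ltW/H] := leP x y; rewrite (distrC _ x) (distrC _ (_ x)).
rewrite (distrC (clamp k x)) (distrC x) !ger0_norm ?subr_ge0 ?clamp_homo//.
by rewrite /clamp !minEle !maxEle; case: (leP y k) => ?; case: (leP x k) => ?; repeat (case: (leP (- k) _) => ?); lra.
Qed.

Lemma clamp_continuous k : continuous (clamp k).
Proof.
move=> x; apply/cvgrPdist_lt => e e0; apply/nbhs_ballP; exists e => //= y.
exact: le_lt_trans (clamp_lip _ _ _).
Qed.

(** Freezing a function outside a segment makes it continuous everywhere; the
piecewise definitions of the curves are put in this form to see that they are
continuous. *)
Lemma continuous_clamp f k : 0 <= k ->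
  {within `[- k, k], continuous f} -> continuous (f \o clamp k).
Proof.
move=> k0 /within_itvP cf x; apply/cvgrPdist_lt => e e0.
have [del d0 D] := cf _ (clamp_itv x k0) e e0.
have /cvgrPdist_lt/(_ _ d0) := @clamp_continuous k x.
by apply: filterS => y; apply: D; exact: clamp_itv.
Qed.

Lemma deriv_ge0_le F (dF : R -> R) a b : a <= b ->
  {within `[a, b], continuous F} ->
  (forall x, a < x < b -> is_derive x 1 F (dF x)) ->
  (forall x, a < x < b -> 0 <= dF x) -> F a <= F b.
Proof.
rewrite le_eqVlt => /predU1P[->//|ab] cF dvF dF0.
have dv x : x \in `]a, b[ -> is_derive x 1 F (dF x) by rewrite in_itv/=; exact: dvF.
have [x] := MVT ab dv cF; rewrite in_itv/= => xab; rewrite -subr_ge0 => ->.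
by apply: mulr_ge0; [exact: dF0|rewrite subr_ge0 ltW].
Qed.

Lemma deriv_eq0_cst F a b : a <= b -> {within `[a, b], continuous F} ->
  (forall x, a < x < b -> is_derive x 1 F 0) -> F a = F b.
Proof.
rewrite le_eqVlt => /predU1P[->//|ab] cF dvF.
have dv x : x \in `]a, b[ -> is_derive x 1 F (cst 0 x).
  by rewrite in_itv/=; exact: dvF.
have [x _] := MVT ab dv cF; by rewrite mul0r => /eqP; rewrite subr_eq0 => /eqP.
Qed.

(** Monotone convergence: over a compact subinterval the integral of f is an
increment of F, hence at most F b - F a.  The function f may be
unbounded near the ends, as sigma is near 1. *)
Lemma deriv_integrable f F a b : a < b -> {within `[a, b], continuous F} ->
  (forall x, a < x < b -> is_derive x 1 F (f x)) ->
  (forall x, a < x < b -> {for x, continuous f}) ->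
  (forall x, a < x < b -> 0 <= f x) ->
  mu.-integrable `]a, b[ (EFin \o f).
Proof.
move=> ab cF dF cf f0.
have mf : measurable_fun `]a, b[ f.
  apply: open_continuous_measurable_fun => //.
  by move=> x; rewrite inE/= in_itv/=; exact: cf.
apply/integrableP; split; first exact/measurable_EFinP.
(* The 3 keeps the two ends of the compact subinterval apart for every n. *)
pose d n : R := (b - a) / n.+3%:R.
have d0 n : 0 < d n by rewrite divr_gt0// subr_gt0.
have dle n : d n <= (b - a) / 3.
  rewrite ler_pM2l ?subr_gt0// lef_pV2 ?posrE// ler_nat//.
pose D n : set R := `[a + d n, b - d n]%classic.
have DE : `]a, b[%classic = \bigcup_n D n.
  apply/seteqP; split=> x /=; rewrite in_itv/=; last first.
    by move=> [n _]; rewrite /D/= in_itv/=; have := d0 n; lra.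
  move=> /andP[ax xb].
  (* The distance from x to the ends. *)
  pose m := Num.min (x - a) (b - x).
  have m0 : 0 < m by rewrite lt_min; lra.
  exists (Num.truncn ((b - a) / m)) => //.
  have dm : d (Num.truncn ((b - a) / m)) <= m.
    rewrite /d ler_pdivrMr// -ler_pdivrMl// mulrC.
    by apply: (le_trans (ltW (truncnS_gt _))); rewrite ler_nat; exact: leqW (leqW (leqnn _)).
  rewrite /D/= in_itv/=.
  have : m <= x - a by rewrite /m ge_min lexx.
  have : m <= b - x by rewrite /m ge_min lexx orbT.
  lra.
have Dsub n : D n `<=` `]a, b[.
  by move=> x; rewrite DE => ?; exists n.
have fE : (\int[mu]_(x in `]a, b[) `|(EFin \o f) x|)%E =
          (\int[mu]_(x in `]a, b[) (f x)%:E)%E.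
  apply: eq_integral => x; rewrite inE/= in_itv/= => xab.
  by rewrite ger0_norm// f0.
rewrite fE.
apply: (@le_lt_trans _ _ ((F b - F a)%:E)); last by rewrite ltry.
have ndD : nondecreasing_seq D.
  move=> m n mn; apply/subsetPset => x; rewrite /D/= !in_itv/=.
  have : d n <= d m by rewrite ler_pM2l ?subr_gt0// lef_pV2 ?posrE// ler_nat.
  lra.
have mD n : measurable (D n) by exact: measurable_itv.
have cvgD : (\int[mu]_(x in D i) (EFin \o f) x)%E @[i --> \oo]
    --> (\int[mu]_(x in `]a, b[) (EFin \o f) x)%E.
  rewrite DE; apply: ge0_nondecreasing_set_cvg_integral => // [n|n x /Dsub/=].
    by apply/measurable_EFinP; apply: measurable_funS mf.
  by rewrite in_itv/= lee_fin; exact: f0.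
rewrite -(cvg_lim _ cvgD)//; apply: lime_le; first by apply/cvg_ex; eexists; exact: cvgD.
apply: nearW => n.
have dn : a + d n < b - d n by have := dle n; have := d0 n; lra.
have := d0 n => dn0.
rewrite (@continuous_FTC2 R f F)//.
- rewrite -EFinB lee_fin lerB//.
    apply: (@deriv_ge0_le F f); [by have := d0 n; lra| | |].
    + by apply: within_itvW cF; lra.
    + by move=> x ?; apply: dF; lra.
    + by move=> x ?; apply: f0; lra.
  apply: (@deriv_ge0_le F f); [by have := d0 n; lra| | |].
  + by apply: within_itvW cF; lra.
  + by move=> x ?; apply: dF; lra.
  + by move=> x ?; apply: f0; lra.
- apply/continuous_in_subspaceT => x; rewrite inE/= in_itv/= => ?; apply: cf; lra.
- have dc x : a < x < b -> {for x, continuous F}.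
    move=> /dF Fx; apply/differentiable_continuous/derivable1_diffP.
    exact: ex_derive.
  split.
  + move=> x; rewrite in_itv/= => ?; have Fx : is_derive x 1 F (f x) by apply: dF; lra.
    exact: ex_derive.
  + by apply: cvg_at_right_filter; apply: dc; lra.
  + by apply: cvg_at_left_filter; apply: dc; lra.
- move=> x; rewrite in_itv/= => ?; have Fx : is_derive x 1 F (f x) by apply: dF; lra.
  by rewrite derive1E derive_val.
Qed.

(** The integrand is allowed to blow up at the ends of the segment, as long as it
is dominated by the derivative phi of a function continuous up to the ends.
This gives the height Z of a clasp arc for tau = 1, and the integrals of a
continuous field against dT. *)
Lemma dominated_primitive f (phi : R -> R) G M a b : a < b ->
  {within `[a, b], continuous G} ->
  (forall x, a < x < b -> is_derive x 1 G (phi x)) ->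
  (forall x, a < x < b -> {for x, continuous phi}) ->
  (forall x, a < x < b -> {for x, continuous f}) ->
  (forall x, a < x < b -> `|f x| <= M * phi x) ->
  let F x := \int[mu]_(t in `[a, x]) f t in
  {within `[a, b], continuous F} /\
  forall x, a < x < b -> is_derive x 1 F (f x).
Proof.
move=> ab cG dG cphi cf fphi F.
have intf : mu.-integrable `[a, b] (EFin \o f).
  have mf : measurable_fun `]a, b[ f.
    apply: open_continuous_measurable_fun => //.
    by move=> x; rewrite inE/= in_itv/=; exact: cf.
  suff : mu.-integrable `]a, b[ (EFin \o f).
    have mfc : measurable_fun `[a, b] f by exact: measurable_fun_itv_cc mf.
    move=> /integrableP[_ fi]; apply/integrableP; split; first exact/measurable_EFinP.
    rewrite (@integral_itv_bndoo _ _ _ _ true false)//.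
    by apply/measurable_EFinP; apply: measurableT_comp.
  have iphi : mu.-integrable `]a, b[ (EFin \o (fun x => M * phi x)).
    apply: (@deriv_integrable _ (fun x => M * G x)) => //.
    - by move=> x; apply: continuousM; [exact: cvg_cst|exact: cG].
    - move=> x xab; have ? := dG x xab.
      by have := is_deriveZ M (dG x xab).
    - by move=> x xab; apply: continuousM; [exact: cvg_cst|exact: cphi].
    - by move=> x xab; apply: le_trans (fphi x xab).
  apply: le_integrable iphi => //; first exact/measurable_EFinP.
  move=> x/=; rewrite in_itv/= => xab; rewrite lee_fin.
  by apply: le_trans (fphi x xab) _; exact: ler_norm.
split; first by apply: parameterized_integral_continuous => //; exact: ltW.
move=> x xab; have [ax xb] := andP xab.
have [|dF F'] := @continuous_FTC1 R f (BLeft a) x b xb intf _ (cf x xab).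
  by [].
by apply: DeriveDef; [exact: dF|rewrite -derive1E F'].
Qed.

End Calculus.

(** * Differentiation rules for explicit functions *)

Section DeriveRules.
Context {R : realType}.
Implicit Types (f g : R -> R) (x df dg k : R).

Lemma is_deriv_add f g x df dg : is_derive x 1 f df -> is_derive x 1 g dg ->
  is_derive x 1 (fun t => f t + g t) (df + dg).
Proof. exact: is_deriveD. Qed.

Lemma is_deriv_sub f g x df dg : is_derive x 1 f df -> is_derive x 1 g dg ->
  is_derive x 1 (fun t => f t - g t) (df - dg).
Proof. exact: is_deriveB. Qed.

Lemma is_deriv_opp f x df : is_derive x 1 f df ->
  is_derive x 1 (fun t => - f t) (- df).
Proof. exact: is_deriveN. Qed.

Lemma is_deriv_scale f x df k : is_derive x 1 f df ->
  is_derive x 1 (fun t => k * f t) (k * df).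
Proof. exact: is_deriveZ. Qed.

Lemma is_deriv_mul f g x df dg : is_derive x 1 f df -> is_derive x 1 g dg ->
  is_derive x 1 (fun t => f t * g t) (f x * dg + df * g x).
Proof.
move=> Df Dg; apply: (is_derive_eq (is_deriveM Df Dg)).
by rewrite [df * _]mulrC.
Qed.

Lemma is_deriv_cst x k : is_derive x 1 (fun=> k) 0.
Proof. exact: is_derive_cst. Qed.

Lemma is_deriv_id x : is_derive x 1 (fun t => t) 1.
Proof. exact: is_derive_id. Qed.

Lemma is_deriv_comp f g x df dg : is_derive x 1 g dg -> is_derive (g x) 1 f df ->
  is_derive x 1 (fun t => f (g t)) (df * dg).
Proof. by move=> Dg Df; apply: is_derive1_comp. Qed.

Lemma is_deriv_reflect f (m : R) x df : is_derive (m - x) 1 f df ->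
  is_derive x 1 (fun t => f (m - t)) (- df).
Proof.
move=> Df; rewrite -[- df]mulrN1; apply: (is_deriv_comp (g := fun t => m - t)) Df.
rewrite -[-1](add0r (- 1)); exact: is_deriv_sub.
Qed.

Lemma is_deriv_sqrt f x df : 0 < f x -> is_derive x 1 f df ->
  is_derive x 1 (fun t => Num.sqrt (f t)) (df / (2 * Num.sqrt (f x))).
Proof.
move=> fx Df; rewrite mulrC.
exact: is_deriv_comp Df (is_derive1_sqrt fx).
Qed.

Lemma is_deriv_continuous f x df : is_derive x 1 f df -> {for x, continuous f}.
Proof.
move=> Df; apply/differentiable_continuous/derivable1_diffP; exact: ex_derive.
Qed.

Lemma is_deriv_near f g (p q x df : R) : p < x < q ->
  (forall t, p < t < q -> f t = g t) -> is_derive x 1 f df -> is_derive x 1 g df.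
Proof.
move=> pxq fg; apply: near_eq_is_derive.
have : x \in `]p, q[ by rewrite in_itv.
move=> /near_in_itvoo; apply: filterS => t; rewrite in_itv/=; exact: fg.
Qed.

End DeriveRules.

(** * Riemann-Stieltjes integrals through primitives *)

Section StieltjesPrimitive.
Context {R : realType}.
Implicit Types (a b c d s t x y w I J m : R) (f g h F G : R -> R).

(** F is a primitive of f dg: over [s, t] the increment of F is x (g t - g s) up to
the oscillation w of f around x, times the increment of G, which plays the
part of the total variation of g.  Unlike a limit of sums, this can be cut, glued, reflected and
added term by term. *)
Definition rs_integral f g a b I := exists G F,
  (forall s t x w, a <= s -> s <= t -> t <= b ->
    (forall r, s <= r <= t -> `|f r - x| <= w) ->
    `|F t - F s - x * (g t - g s)| <= w * (G t - G s)) /\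
  F b - F a = I.

Lemma rs_integral_eq f f' g g' a b I :
  (forall x, a <= x <= b -> f x = f' x) -> (forall x, a <= x <= b -> g x = g' x) ->
  rs_integral f g a b I -> rs_integral f' g' a b I.
Proof.
move=> ff gg [G [F [H FI]]]; exists G, F; split=> // s t x w as' st tb fx.
rewrite -!gg ?as' ?tb ?(le_trans as' st) ?(le_trans st tb)//.
apply: H => // r /andP[sr rt]; rewrite ff ?fx ?sr//.
by rewrite (le_trans as' sr) (le_trans rt tb).
Qed.

Lemma rs_integral_cat f g a b c I J : a <= b -> b <= c ->
  rs_integral f g a b I -> rs_integral f g b c J -> rs_integral f g a c (I + J).
Proof.
move=> ab bc [G1 [F1 [H1 <-]]] [G2 [F2 [H2 <-]]].
pose glue (u v : R -> R) t := if t <= b then u t else u b + (v t - v b).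
exists (glue G1 G2), (glue F1 F2); split; last first.
  rewrite /glue ab; case: leP => [cb|_]; last by ring.
  have -> : c = b by apply/eqP; rewrite eq_le cb bc.
  by ring.
move=> s t x w as' st tc fx; rewrite /glue.
have [tb|bt] := leP t b.
  by rewrite (le_trans st tb); apply: H1.
have [sb|bs] := leP s b; last first.
  have := H2 s t x w (ltW bs) st tc fx.
  by congr (`|_| <= _); ring.
have A1 : `|F1 b - F1 s - x * (g b - g s)| <= w * (G1 b - G1 s).
  by apply: H1 => // r /andP[sr rb]; apply: fx; rewrite sr (le_trans rb (ltW bt)).
have A2 : `|F2 t - F2 b - x * (g t - g b)| <= w * (G2 t - G2 b).
  apply: H2 => //; first exact: ltW.
  by move=> r /andP[br rt]; apply: fx; rewrite rt (le_trans sb br).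
have := le_trans (ler_normD _ _) (lerD A1 A2).
by congr (`|_| <= _); ring.
Qed.

Lemma rs_integral_reflect f g m a b I :
  rs_integral (fun t => f (m - t)) (fun t => g (m - t)) a b I ->
  rs_integral f g (m - b) (m - a) (- I).
Proof.
move=> [G [F [H <-]]]; exists (fun t => - G (m - t)), (fun t => F (m - t)).
split; last by rewrite !subKr opprB.
move=> s t x w bs st ta fx.
have := H (m - t) (m - s) x w.
rewrite !subKr -normrN => /(_ _ _ _ _).
have -> : - (F (m - s) - F (m - t) - x * (g s - g t)) =
  F (m - t) - F (m - s) - x * (g t - g s) by ring.
have -> : - G (m - t) - - G (m - s) = G (m - s) - G (m - t) by ring.
apply; [lra..|].
by move=> r tr; apply: fx; lra.
Qed.

Lemma rs_integralD f g h a b I J : rs_integral f g a b I -> rs_integral f h a b J ->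
  rs_integral f (fun t => g t + h t) a b (I + J).
Proof.
move=> [G1 [F1 [H1 <-]]] [G2 [F2 [H2 <-]]].
exists (fun t => G1 t + G2 t), (fun t => F1 t + F2 t); split; last by ring.
move=> s t x w as' st tb fx.
have := le_trans (ler_normD _ _) (lerD (H1 _ _ _ _ as' st tb fx) (H2 _ _ _ _ as' st tb fx)).
by congr (`|_| <= _); ring.
Qed.

Lemma rs_integralN f g a b I : rs_integral f g a b I ->
  rs_integral f (fun t => - g t) a b (- I).
Proof.
move=> [G [F [H <-]]]; exists G, (fun t => - F t); split; last by ring.
move=> s t x w as' st tb fx; rewrite -normrN.
by have := H _ _ _ _ as' st tb fx; congr (`|_| <= _); ring.
Qed.

Lemma rs_integral_cst f g a b (z : R) : (forall t, a <= t <= b -> g t = z) ->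
  rs_integral f g a b 0.
Proof.
move=> gz; exists (cst 0), (cst 0); split; last by rewrite subrr.
move=> s t x w as' st tb _; rewrite !gz ?as' ?tb ?(le_trans as' st) ?(le_trans st tb)//.
by rewrite !subrr !mulr0 subr0 normr0.
Qed.

(** By the mean value theorem, since (f - x) phi stays between - w phi and w phi. *)
Lemma rs_integral_deriv f g (phi : R -> R) F a b :
  {within `[a, b], continuous g} -> {within `[a, b], continuous F} ->
  (forall x, a < x < b -> is_derive x 1 g (phi x)) ->
  (forall x, a < x < b -> is_derive x 1 F (f x * phi x)) ->
  (forall x, a < x < b -> 0 <= phi x) ->
  rs_integral f g a b (F b - F a).
Proof.
move=> cg cF dg dF phi0; exists g, F; split=> // s t x w as' st tb fx.
have cgs : {within `[s, t], continuous g} by exact: within_itvW cg.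
have cFs : {within `[s, t], continuous F} by exact: within_itvW cF.
have key (e : R) : e = 1 \/ e = -1 ->
    w * g s + e * (F s - x * g s) <= w * g t + e * (F t - x * g t).
  move=> e1; apply: (@deriv_ge0_le R (fun r => w * g r + e * (F r - x * g r))
    (fun r => w * phi r + e * (f r * phi r - x * phi r))) => //.
  - apply: within_itvD; first exact: within_itvZ.
    by apply: within_itvZ; apply: within_itvB => //; exact: within_itvZ.
  - move=> r str; have dgr : is_derive r 1 g (phi r) by apply: dg; lra.
    have dFr : is_derive r 1 F (f r * phi r) by apply: dF; lra.
    exact: is_deriv_add (is_deriv_scale _ dgr)
      (is_deriv_scale _ (is_deriv_sub dFr (is_deriv_scale _ dgr))).
  - move=> r str.
    have -> : w * phi r + e * (f r * phi r - x * phi r) = (w + e * (f r - x)) * phi r.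
      by ring.
    apply: mulr_ge0; last by apply: phi0; lra.
    have := fx r; rewrite ler_norml => /(_ _)/andP[|]; first by lra.
    by case: e1 => ->; lra.
have := key 1 (or_introl erefl); have := key (-1) (or_intror erefl).
by rewrite ler_norml; lra.
Qed.

(** A local modulus of continuity at each point becomes a uniform one by compactness
of the segment, in the form of near-coverings. *)
Lemma within_itv_unif f a b : {within `[a, b], continuous f} ->
  forall e, 0 < e -> exists2 del, 0 < del &
    forall x y, a <= x <= b -> a <= y <= b -> `|x - y| < del -> `|f x - f y| < e.
Proof.
move=> /within_itvP cf e e0.
have := @segment_compact R a b.
move/compact_near_coveringP/near_covering_withinP.
move=> /(_ R (0^'+) (fun del x => forall y, a <= y <= b -> `|x - y| < del ->
  `|f x - f y| < e) _).
have H x : `[a, b]%classic x -> \forall x' \near x & del \near 0^'+,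
    `[a, b]%classic x' -> forall y, a <= y <= b -> `|x' - y| < del -> `|f x' - f y| < e.
  rewrite /= in_itv/= => xab.
  have e20 : 0 < e / 2 by rewrite divr_gt0.
  have [d d0 D] := cf x xab _ e20.
  have d20 : 0 < d / 2 by rewrite divr_gt0.
  exists (ball x (d / 2), [set r | r < d / 2]).
    split; first by apply/nbhs_ballP; exists (d / 2).
    exact: nbhs_right_lt.
  move=> [x' del]/= [xx' deld]; rewrite in_itv/= => x'ab y yab x'y.
  have {}xx' : `|x - x'| < d / 2 := xx'.
  have A : `|f x - f x'| < e / 2 by apply: D => //; lra.
  have B : `|f x - f y| < e / 2.
    apply: D => //.
    by have := ler_distD x' x y; lra.
  have := ler_distD (f x) (f x') (f y); rewrite (distrC (f x') (f x)); lra.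
move=> /(_ H) near0.
have [del del0 Hd] : exists2 del, 0 < del & forall x, a <= x <= b ->
    forall y, a <= y <= b -> `|x - y| < del -> `|f x - f y| < e.
  have : \forall del \near 0^'+, 0 < del /\ (`[a, b]%classic `<=`
      (fun x => forall y, a <= y <= b -> `|x - y| < del -> `|f x - f y| < e)).
    by apply: filterI; [exact: nbhs_right_gt|exact: near0].
  move=> /filter_ex[del [del0 Hd]]; exists del => //.
by exists del => // x y xab yab; exact: Hd.
Qed.

Lemma partition_itv a b n (t : nat -> R) : t 0%N = a -> t n = b ->
  (forall k, (k < n)%N -> t k <= t k.+1) -> forall k, (k <= n)%N -> a <= t k <= b.
Proof.
move=> t0 tn tS.
have tle j k : (j + k <= n)%N -> t k <= t (j + k)%N.
  elim: j => // j IH jkn; rewrite addSn.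
  exact: le_trans (IH (ltnW jkn)) (tS _ jkn).
move=> k kn; rewrite -t0 -tn -{1}(subnK kn) tle ?subnK// andbT.
by have := tle k 0%N; rewrite addn0; exact.
Qed.

(** On each cell of a fine partition f is within eps of its value at the tag, so
the errors add up to at most eps (G b - G a). *)
Lemma rs_integral_sums f g a b I : {within `[a, b], continuous f} ->
  rs_integral f g a b I -> forall e, 0 < e -> exists2 del, 0 < del &
    forall (n : nat) (t c : nat -> R), t 0%N = a -> t n = b ->
      (forall k, (k < n)%N -> t k <= c k <= t k.+1 /\ t k.+1 - t k < del) ->
      `|\sum_(k < n) f (c k) * (g (t k.+1) - g (t k)) - I| < e.
Proof.
move=> cf [G [F [H FI]]] e e0.
pose K := `|G b - G a| + 1.
have K0 : 0 < K by rewrite ltr_wpDl.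
have [del d0 D] := within_itv_unif cf (divr_gt0 e0 K0).
exists del => // n t c t0 tn tc.
have tS k : (k < n)%N -> t k <= t k.+1.
  by move=> /tc[/andP[tc1 tc2] _]; exact: le_trans tc1 tc2.
have tab := partition_itv t0 tn tS.
have -> : I = \sum_(k < n) (F (t k.+1) - F (t k)).
  by rewrite -(big_mkord xpredT (fun k => F (t k.+1) - F (t k))) telescope_sumr// t0 tn.
rewrite -sumrB; apply: (le_lt_trans (ler_norm_sum _ _ _)).
apply: (@le_lt_trans _ _ (\sum_(k < n) e / K * (G (t k.+1) - G (t k)))).
  apply: ler_sum => k _.
  have [/andP[tc1 tc2] tdel] := tc k (ltn_ord k).
  have /andP[ta _] := tab _ (ltnW (ltn_ord k)); have /andP[_ tb] := tab _ (ltn_ord k).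
  rewrite distrC; apply: H => //; first exact: tS.
  move=> r rt; apply/ltW; apply: D; [lra..|].
  by rewrite ltr_norml; lra.
rewrite -mulr_sumr -(big_mkord xpredT (fun k => G (t k.+1) - G (t k))).
rewrite telescope_sumr// t0 tn mulrAC ltr_pdivrMr// ltr_pM2l//.
by rewrite (le_lt_trans (ler_norm _))// /K ltrDl.
Qed.

Lemma dotE (v w : 'rV[R]_3) : dot v w = v 0 0 * w 0 0 + v 0 1 * w 0 1 + v 0 2 * w 0 2.
Proof.
by rewrite /dot !big_ord_recl big_ord0 addr0 addrA; congr (_ + _ * _ + _ * _);
  congr (_ 0 _); apply/val_inj.
Qed.

Lemma rs_integral_stieltjes (f g : R -> 'rV[R]_3) a b I0 I1 I2 :
  (forall i, {within `[a, b], continuous (fun t => f t 0 i)}) ->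
  rs_integral (fun t => f t 0 0) (fun t => g t 0 0) a b I0 ->
  rs_integral (fun t => f t 0 1) (fun t => g t 0 1) a b I1 ->
  rs_integral (fun t => f t 0 2) (fun t => g t 0 2) a b I2 ->
  is_stieltjes f g a b (I0 + I1 + I2).
Proof.
move=> cf r0 r1 r2 e e0; have e30 : 0 < e / 3 by rewrite divr_gt0.
have [d0 d00 D0] := rs_integral_sums (cf 0) r0 e30.
have [d1 d10 D1] := rs_integral_sums (cf 1) r1 e30.
have [d2 d20 D2] := rs_integral_sums (cf 2) r2 e30.
exists (Num.min d0 (Num.min d1 d2)); first by rewrite !lt_min d00 d10.
move=> n t c t0 tn tc.
have {}tc k : (k < n)%N -> [/\ t k <= c k <= t k.+1, t k.+1 - t k < d0,
    t k.+1 - t k < d1 & t k.+1 - t k < d2].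
  by move=> /tc[? ]; rewrite !lt_min => /and3P[].
have {D0} := D0 n t c t0 tn (fun k kn => let: And4 h1 h2 _ _ := tc k kn in conj h1 h2).
have {D1} := D1 n t c t0 tn (fun k kn => let: And4 h1 _ h2 _ := tc k kn in conj h1 h2).
have {D2} := D2 n t c t0 tn (fun k kn => let: And4 h1 _ _ h2 := tc k kn in conj h1 h2).
under [in X in _ -> _ -> _ -> X]eq_bigr do rewrite dotE !mxE.
rewrite !big_split/= !ltr_norml; lra.
Qed.

(** Two limits are compared on one uniform partition finer than both moduli. *)
Lemma is_stieltjes_unique (f g : R -> 'rV[R]_3) a b I J : a <= b ->
  is_stieltjes f g a b I -> is_stieltjes f g a b J -> I = J.
Proof.
move=> ab HI HJ; apply/eqP/negPn/negP => IJ.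
have e0 : 0 < `|I - J| / 2 by rewrite divr_gt0// normr_gt0 subr_eq0.
have [d1 d10 D1] := HI _ e0; have [d2 d20 D2] := HJ _ e0.
pose d := Num.min d1 d2.
have d0 : 0 < d by rewrite lt_min d10.
pose n := (Num.truncn ((b - a) / d)).+1.
pose t (k : nat) : R := a + k%:R * ((b - a) / n%:R).
have n0 : n%:R != 0 :> R by rewrite pnatr_eq0.
have tS k : t k.+1 - t k = (b - a) / n%:R by rewrite /t -natr1; ring.
have st : 0 <= (b - a) / n%:R by rewrite divr_ge0// subr_ge0.
have sd : (b - a) / n%:R < d.
  rewrite ltr_pdivrMr ?ltr0n// -ltr_pdivrMl// mulrC; exact: truncnS_gt.
have t0 : t 0%N = a by rewrite /t mul0r addr0.
have tn : t n = b by rewrite /t mulrC divfK// subrKC.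
have mesh k : (k < n)%N -> t k <= t k <= t k.+1 /\ t k.+1 - t k < d.
  by move=> _; rewrite tS lexx -subr_ge0 tS.
have mesh1 k : (k < n)%N -> t k <= t k <= t k.+1 /\ t k.+1 - t k < d1.
  by move=> /mesh[? h]; split=> //; apply: lt_le_trans h _; rewrite ge_min lexx.
have mesh2 k : (k < n)%N -> t k <= t k <= t k.+1 /\ t k.+1 - t k < d2.
  by move=> /mesh[? h]; split=> //; apply: lt_le_trans h _; rewrite ge_min lexx orbT.
have := D1 n t t t0 tn mesh1; have := D2 n t t t0 tn mesh2.
set S := \sum_(k < n) _ => SJ SI; have := ler_distD S I J.
by rewrite (distrC I S); lra.
Qed.

Lemma stieltjesE (f g : R -> 'rV[R]_3) a b I : a <= b ->
  is_stieltjes f g a b I -> stieltjes f g a b = I.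
Proof.
by move=> ab HI; apply: xget_unique => // J HJ; apply: is_stieltjes_unique ab HJ HI.
Qed.

Lemma bounded_variation_dominated f G a b :
  (forall x y, a <= x -> x <= y -> y <= b -> `|f y - f x| <= G y - G x) ->
  bounded_variation a b f.
Proof.
move=> fG; exists (G b - G a) => _ [s abs <-].
rewrite -(@nondecreasing_variation R a b G s) //; last first.
  move=> x y; rewrite !in_itv/= => /andP[ax _] /andP[_ yb] xy.
  by rewrite -subr_ge0; apply: le_trans (fG _ _ ax xy yb).
rewrite /variation !big_nat; apply: ler_sum => k /andP[_ ks] /=.
apply: le_trans (ler_norm _); apply: fG.
- by apply: (@itv_partition_nth_ge _ _ _ _ _ k _ abs); rewrite ltnS ltnW.
- have [+ _] := abs => /(pathP b) /(_ k ks)/ltW.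
  by case: (k) ks => //.
- exact: (@itv_partition_nth_le _ _ _ _ _ k.+1 _ abs).
Qed.

End StieltjesPrimitive.

(** * Integrals against the coordinates of a turning unit vector *)

Section TurningIntegrals.
Context {R : realType}.
Implicit Types (a b s t x y I J k u : R) (f g h F : R -> R).

(** Here f is bounded, so f phi is dominated by a multiple of phi. *)
Lemma weighted_primitive f g (phi : R -> R) a b : a < b ->
  {within `[a, b], continuous f} -> {within `[a, b], continuous g} ->
  (forall x, a < x < b -> is_derive x 1 g (phi x)) ->
  (forall x, a < x < b -> {for x, continuous phi}) ->
  (forall x, a < x < b -> 0 <= phi x) ->
  exists F, [/\ {within `[a, b], continuous F},
    (forall x, a < x < b -> is_derive x 1 F (f x * phi x)) &
    rs_integral f g a b (F b - F a)].
Proof.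
move=> ab cf cg dg cphi phi0.
have cfn : {within `[a, b], continuous (fun x => `|f x|)}.
  by move=> x; apply: continuous_cvg; [exact: norm_continuous|exact: cf].
have [c _ fc] := EVT_max (ltW ab) cfn.
have [||cF dF] := @dominated_primitive R (fun x => f x * phi x) phi g `|f c| a b ab cg dg cphi.
- move=> x xab; apply: cvgM; last exact: cphi.
  by apply: (within_continuous_continuous ab cf); rewrite in_itv.
- move=> x xab; rewrite normrM (ger0_norm (phi0 x xab)) ler_wpM2r ?phi0//.
  by apply: fc; rewrite in_itv/=; lra.
- eexists; split; [exact: cF|exact: dF|exact: rs_integral_deriv cg cF dg dF phi0].
Qed.

(** The slope of a unit vector whose second coordinate is u. *)
Definition sigma u : R := u / Num.sqrt (1 - u ^+ 2).

Lemma cos_gt0 u : -1 < u < 1 -> 0 < Num.sqrt (1 - u ^+ 2).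
Proof. by move=> u1; rewrite sqrtr_gt0; nra. Qed.

Lemma sigma_ge0 u : 0 <= u -> 0 <= sigma u.
Proof. by move=> u0; rewrite divr_ge0// sqrtr_ge0. Qed.

Lemma sub1sqr_deriv u : is_derive u 1 (fun t : R => 1 - t ^+ 2) (- (2 * u)).
Proof.
have := is_deriv_sub (is_deriv_cst u 1) (is_deriv_mul (is_deriv_id u) (is_deriv_id u)).
move=> H; apply: (is_derive_eq (f := fun t => 1 - t ^+ 2)) => //; ring.
Qed.

Lemma cos_deriv u : -1 < u < 1 ->
  is_derive u 1 (fun t : R => Num.sqrt (1 - t ^+ 2)) (- sigma u).
Proof.
move=> u1; have u2 : 0 < 1 - u ^+ 2 by nra.
apply: (is_derive_eq (is_deriv_sqrt (f := fun t => 1 - t ^+ 2) u2 (sub1sqr_deriv u))).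
by rewrite /sigma invfM; field; rewrite gt_eqF// cos_gt0.
Qed.

Lemma sigma_continuous u : -1 < u < 1 -> {for u, continuous sigma}.
Proof.
move=> u1; apply: cvgM; first exact: cvg_id.
apply: cvgV; first by rewrite gt_eqF// cos_gt0.
exact: (is_deriv_continuous (cos_deriv u1)).
Qed.

Lemma cos_continuous : continuous (fun t : R => Num.sqrt (1 - t ^+ 2)).
Proof.
move=> x; apply: continuous_cvg; first exact: sqrt_continuous.
by apply: cvgB; [exact: cvg_cst|exact: exprn_continuous].
Qed.

(** With clamp k t, the coordinates of a unit tangent that turns for |t| <= k and
is constant outside.  For k = 1 the square root vanishes outside, at vertical
tangents. *)
Definition ccos k t : R := Num.sqrt (1 - clamp k t ^+ 2).

Lemma clampN k t : 0 <= k -> clamp k (- t) = - clamp k t.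
Proof.
move=> k0; have [tk|kt] := leP k t.
  by rewrite (clamp_ge k0 tk) clamp_le// lerN2.
have [tk|kt'] := leP t (- k).
  by rewrite (clamp_le k0 tk) clamp_ge ?opprK// lerNr.
by rewrite !clamp_id //; lra.
Qed.

Lemma ccosN k t : 0 <= k -> ccos k (- t) = ccos k t.
Proof. by move=> k0; rewrite /ccos clampN// sqrrN. Qed.

Lemma ccos_continuous k : continuous (ccos k).
Proof.
move=> x; have := @cos_continuous (clamp k x).
by apply: continuous_comp; exact: clamp_continuous.
Qed.

Lemma within_itv_opp f k : {within `[- k, k], continuous f} ->
  {within `[0, k], continuous (fun t => f (0 - t))}.
Proof.
apply: (within_itv_comp (c := - k) (d := k) (h := fun t => 0 - t)); first by move=> x ?; lra.
by apply: within_itvB; [exact: within_itv_cst|exact: within_itv_id].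
Qed.

(** The integral over the turning part is folded onto [0, k]; outside, g is constant
and contributes nothing. *)
Lemma rs_integral_halves f g h a b k I J : 0 <= k -> a <= - k -> k <= b ->
  (forall t, 0 <= t <= k -> g t = h t) ->
  (forall t, k <= t <= b -> g t = g k) ->
  (forall t, a <= t <= - k -> g t = g (- k)) ->
  rs_integral f h 0 k I ->
  rs_integral (fun t => f (0 - t)) (fun t => g (0 - t)) 0 k J ->
  rs_integral f g a b (I - J).
Proof.
move=> k0 ak kb gh gk gNk HI HJ.
have P1 := rs_integral_cst f gNk.
have P2 := rs_integral_reflect HJ; rewrite subr0 sub0r in P2.
have P3 : rs_integral f g 0 k I by apply: rs_integral_eq HI => // t /gh.
have P4 := rs_integral_cst f gk.
have -> : I - J = 0 + (- J + (I + 0)) by ring.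
apply: rs_integral_cat P1 _ => //; first by lra.
apply: rs_integral_cat P2 _ => //; [lra..|].
by apply: rs_integral_cat P3 P4.
Qed.

Lemma rs_integral_clamp f k a b : 0 < k -> a <= - k -> k <= b ->
  {within `[a, b], continuous f} ->
  exists E : R -> R, [/\ {within `[0, k], continuous E},
    (forall u, 0 < u < k -> is_derive u 1 E (f u + f (- u))) &
    rs_integral f (clamp k) a b (E k - E 0)].
Proof.
move=> k0 ak kb cf.
have cfk : {within `[- k, k], continuous f} by exact: within_itvW cf.
have cf1 : {within `[0, k], continuous f} by apply: within_itvW cfk; lra.
have cf2 := within_itv_opp cfk.
have did x : 0 < x < k -> is_derive x 1 (fun t : R => t) 1 by move=> _; exact: is_deriv_id.
have cid x : 0 < x < k -> {for x, continuous (fun=> 1 : R)} by move=> _; exact: cvg_cst.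
have [E1 [cE1 dE1 r1]] := weighted_primitive k0 cf1 (@within_itv_id R 0 k) did cid
  (fun _ _ => ler01).
have [E2 [cE2 dE2 r2]] := weighted_primitive k0 cf2 (@within_itv_id R 0 k) did cid
  (fun _ _ => ler01).
exists (fun t => E1 t + E2 t); split; first exact: within_itvD.
- move=> u uk; apply: (is_derive_eq (is_deriv_add (dE1 u uk) (dE2 u uk))).
  by rewrite !mulr1 sub0r.
have -> : E1 k + E2 k - (E1 0 + E2 0) = (E1 k - E1 0) - - (E2 k - E2 0) by ring.
apply: rs_integral_halves (ltW k0) ak kb _ _ _ r1 _.
- by move=> t ?; rewrite clamp_id//; lra.
- by move=> t /andP[kt _]; rewrite !clamp_ge// ltW.
- by move=> t /andP[_ tk]; rewrite !clamp_le// ltW.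
apply: rs_integral_eq (rs_integralN r2) => // t tk.
by rewrite sub0r clamp_id //; lra.
Qed.

Lemma rs_integral_ccos f k a b : 0 < k <= 1 -> a <= - k -> k <= b ->
  {within `[a, b], continuous f} ->
  exists S : R -> R, [/\ {within `[0, k], continuous S},
    (forall u, 0 < u < k -> is_derive u 1 S (sigma u * (f u - f (- u)))) &
    rs_integral f (ccos k) a b (- (S k - S 0))].
Proof.
move=> /andP[k0 k1] ak kb cf.
have cfk : {within `[- k, k], continuous f} by exact: within_itvW cf.
have cf1 : {within `[0, k], continuous f} by apply: within_itvW cfk; lra.
have cf2 := within_itv_opp cfk.
have cC : {within `[0, k], continuous (fun t : R => - Num.sqrt (1 - t ^+ 2))}.
  by apply: within_itvN; apply: within_itv_cont; exact: cos_continuous.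
have dC x : 0 < x < k -> is_derive x 1 (fun t : R => - Num.sqrt (1 - t ^+ 2)) (sigma x).
  move=> xk; rewrite -[sigma x]opprK; apply: is_deriv_opp; apply: cos_deriv; lra.
have cs x : 0 < x < k -> {for x, continuous sigma}.
  by move=> xk; apply: sigma_continuous; lra.
have s0 x : 0 < x < k -> 0 <= sigma x by move=> /andP[/ltW + _]; exact: sigma_ge0.
have [S1 [cS1 dS1 r1]] := weighted_primitive k0 cf1 cC dC cs s0.
have [S2 [cS2 dS2 r2]] := weighted_primitive k0 cf2 cC dC cs s0.
exists (fun t => S1 t - S2 t); split; first exact: within_itvB.
- move=> u uk; apply: (is_derive_eq (is_deriv_sub (dS1 u uk) (dS2 u uk))).
  by rewrite sub0r; ring.
have -> : - (S1 k - S2 k - (S1 0 - S2 0)) = - (S1 k - S1 0) - - (S2 k - S2 0) by ring.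
apply: rs_integral_halves (ltW k0) ak kb _ _ _ (rs_integralN r1) _.
- by move=> t ?; rewrite /ccos clamp_id ?opprK//; lra.
- by move=> t /andP[kt _]; rewrite /ccos !clamp_ge// ltW.
- by move=> t /andP[_ tk]; rewrite /ccos !clamp_le// ltW.
apply: rs_integral_eq (rs_integralN r2) => // t tk.
by rewrite sub0r ccosN ?(ltW k0)// /ccos clamp_id ?opprK//; lra.
Qed.

(** A form of bounded variation that needs no interval, and is visibly stable under
differences and reflections. *)
Definition variation_majorized f :=
  exists G : R -> R, forall x y, x <= y -> `|f y - f x| <= G y - G x.

Lemma variation_majorized_bv f a b : variation_majorized f -> bounded_variation a b f.
Proof. by move=> [G fG]; apply: (@bounded_variation_dominated _ _ G) => x y _ xy _; exact: fG. Qed.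

Lemma variation_majorized_homo f : {homo f : x y / x <= y} -> variation_majorized f.
Proof. by move=> hf; exists f => x y xy; rewrite ger0_norm// subr_ge0 hf. Qed.

Lemma variation_majorizedB f g : variation_majorized f -> variation_majorized g ->
  variation_majorized (fun t => f t - g t).
Proof.
move=> [F fF] [G gG]; exists (fun t => F t + G t) => x y xy.
have := ler_normB (f y - f x) (g y - g x); have := fF x y xy; have := gG x y xy.
by rewrite (_ : f y - f x - (g y - g x) = f y - g y - (f x - g x)); [lra|ring].
Qed.

Lemma variation_majorized_reflect f m : variation_majorized f ->
  variation_majorized (fun t => f (m - t)).
Proof.
move=> [F fF]; exists (fun t => - F (m - t)) => x y xy.
rewrite distrC opprK [leRHS]addrC; apply: fF; lra.
Qed.

(** The function increases up to 0 and decreases after, so it is a difference of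
two monotone functions. *)
Lemma ccos_majorized k : 0 <= k <= 1 -> variation_majorized (ccos k).
Proof.
move=> /andP[k0 k1].
have m u v : 0 <= u -> u <= v -> ccos k v <= ccos k u.
  move=> u0 uv; apply: ler_wsqrtr.
  have := clamp_homo k uv; have := clamp_homo k u0; rewrite (@clamp_id _ k 0); last by lra.
  by nra.
have -> : ccos k = (fun t => ccos k (Num.min t 0) - (1 - ccos k (Num.max t 0))).
  apply/funext => t.
  have c0 : ccos k 0 = 1 by rewrite /ccos clamp_id ?expr0n ?subr0 ?sqrtr1//; lra.
  by case: (leP t 0) => t0; rewrite c0; ring.
apply: variation_majorizedB; apply: variation_majorized_homo => x y xy.
  rewrite -(ccosN (Num.min x 0))// -(ccosN (Num.min y 0))//.
  apply: m; first by rewrite oppr_ge0 ge_min lexx orbT.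
  by rewrite lerN2 le_min2.
rewrite lerD2l lerN2; apply: m; first by rewrite le_max lexx orbT.
by rewrite le_max2.
Qed.

Lemma clamp_majorized k : variation_majorized (clamp k).
Proof. by apply: variation_majorized_homo => x y; exact: clamp_homo. Qed.

Lemma cst_majorized k : variation_majorized (fun=> k).
Proof. exact: variation_majorized_homo. Qed.

End TurningIntegrals.

(** * The profile X of a clasp arc *)

Section ClaspProfile.
Context {R : realType}.
Variable tau : R.
Hypothesis tau01 : 0 < tau <= 1.
Implicit Types (u v x y : R).
Local Notation X := (claspX tau).
Local Notation Z := (claspZ tau).
Local Notation h := (clasp_height tau).

Definition clasp_num x : R := x * x * (1 - (tau - x) * (tau - x)).
Definition clasp_den x : R := 1 - (x * (tau - x)) * (x * (tau - x)).
(** The vertical coordinate of the strut that joins the point of parameter x on one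
arc to the points of parameter tau - x on the clasped arc. *)
Definition clasp_gap x : R :=
  Num.sqrt ((1 - x * x) * (1 - (tau - x) * (tau - x)) / clasp_den x).
Local Notation Y := clasp_gap.

(** By x (tau - x) <= tau^2 / 4 <= 1/4. *)
Lemma clasp_den_bound x : 0 <= x <= tau -> 15 / 16 <= clasp_den x <= 1.
Proof.
move=> /andP[x0 xt]; have [t0 t1] := andP tau01; rewrite /clasp_den.
have p0 : 0 <= x * (tau - x) by apply: mulr_ge0; lra.
have p1 : x * (tau - x) <= 1 / 4.
  have tt : tau * tau <= 1 by nra.
  have := sqr_ge0 (x - (tau - x)); rewrite expr2; nra.
by set p := x * (tau - x) in p0 p1 *; apply/andP; split; nra.
Qed.

Lemma clasp_den_gt0 x : 0 <= x <= tau -> 0 < clasp_den x.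
Proof. by move=> /clasp_den_bound; lra. Qed.

Lemma claspX_sqrt x : 0 <= x -> X x = Num.sqrt (clasp_num x / clasp_den x).
Proof.
move=> x0; rewrite /claspX x0 /claspX_pos /clasp_num /clasp_den.
by congr (Num.sqrt (_ / _)); ring.
Qed.

Lemma claspX0 : X 0 = 0.
Proof. by rewrite claspX_sqrt// /clasp_num !mul0r sqrtr0. Qed.

Lemma claspX_tau : X tau = tau.
Proof.
have tauH := tau01.
rewrite claspX_sqrt; last by lra.
rewrite /clasp_num /clasp_den subrr !mulr0 subr0 divr1 mulr1 -expr2 sqrtr_sqr.
by rewrite ger0_norm//; lra.
Qed.

Lemma claspXN u : X (- u) = - X u.
Proof.
have [->|u0] := eqVneq u 0; first by rewrite oppr0 claspX0 oppr0.
rewrite /claspX oppr_ge0; case: ltgtP u0 => // u0 _; last by rewrite opprK.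
by rewrite opprK.
Qed.

Lemma clasp_num_ge0 x : 0 <= x <= tau -> 0 <= clasp_num x.
Proof.
have tauH := tau01.
move=> xt; rewrite /clasp_num; apply: mulr_ge0; first by apply: mulr_ge0; lra.
have /andP[] : 0 <= tau - x <= 1 by lra.
by set y := tau - x => y0 y1; nra.
Qed.

Lemma claspX_sqr x : 0 <= x <= tau -> X x * X x = clasp_num x / clasp_den x.
Proof.
have tauH := tau01.
move=> xt; rewrite claspX_sqrt; last by lra.
rewrite -expr2 sqr_sqrtr// divr_ge0 ?clasp_num_ge0//.
by apply/ltW/clasp_den_gt0.
Qed.

Lemma claspX_gt0 x : 0 < x < tau -> 0 < X x.
Proof.
have tauH := tau01.
move=> xt; rewrite claspX_sqrt; last by lra.
rewrite sqrtr_gt0 divr_gt0 ?clasp_den_gt0//; last by lra.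
rewrite /clasp_num; apply: mulr_gt0; first by apply: mulr_gt0; lra.
have /andP[] : 0 < tau - x < 1 by lra.
by set y := tau - x => y0 y1; nra.
Qed.

(** The strut has length 1: its horizontal coordinates are X x and X (tau - x). *)
Lemma clasp_gap_sqr x : 0 <= x <= tau ->
  X x * X x + X (tau - x) * X (tau - x) + Y x * Y x = 1.
Proof.
have tauH := tau01.
move=> xt; have xt' : 0 <= tau - x <= tau by lra.
have d0 := clasp_den_gt0 xt.
have dE : clasp_den (tau - x) = clasp_den x by rewrite /clasp_den; ring.
rewrite !claspX_sqr// -[Y x * _]expr2 sqr_sqrtr; last first.
  apply: divr_ge0; last exact: ltW.
  have /andP[x0 x1] : 0 <= x <= 1 by lra.
  have /andP[] : 0 <= tau - x <= 1 by lra.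
  by set y := tau - x => y0 y1; apply: mulr_ge0; nra.
rewrite dE /clasp_num (_ : tau - (tau - x) = x); last by ring.
rewrite -!mulrDl; apply/eqP; rewrite -subr_eq0; apply/eqP.
rewrite -[X in _ - X](divff (lt0r_neq0 d0)) -mulrBl.
apply/eqP; rewrite mulf_eq0; apply/orP; left; apply/eqP.
by rewrite /clasp_den; ring.
Qed.

(** The strut balances the curvature force: X / Y is the slope sigma. *)
Lemma claspX_cos x : 0 <= x <= tau -> X x * Num.sqrt (1 - x ^+ 2) = x * Y x.
Proof.
have tauH := tau01.
move=> xt; have d0 := clasp_den_gt0 xt.
rewrite claspX_sqrt; last by lra.
rewrite -sqrtrM ?divr_ge0 ?clasp_num_ge0 ?(ltW d0)//.
have -> : x * Y x = Num.sqrt (x ^+ 2) * Y x by rewrite sqrtr_sqr ger0_norm//; lra.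
rewrite -sqrtrM ?sqr_ge0//; congr Num.sqrt.
by rewrite /clasp_num; field; rewrite gt_eqF.
Qed.

Lemma clasp_gap_ge0 x : 0 <= Y x.
Proof. exact: sqrtr_ge0. Qed.

Lemma clasp_gap0 : Y 0 = Num.sqrt (1 - tau ^+ 2).
Proof.
by rewrite /clasp_gap /clasp_den !mul0r !subr0 mul1r invr1 mulr1 expr2.
Qed.

Lemma clasp_gap_gt0 x : 0 < x < tau -> 0 < Y x.
Proof.
have tauH := tau01.
move=> xt; rewrite sqrtr_gt0 divr_gt0 ?clasp_den_gt0//; last by lra.
have /andP[x0 x1] : 0 < x < 1 by lra.
have /andP[] : 0 < tau - x < 1 by lra.
by set y := tau - x => y0 y1; apply: mulr_gt0; nra.
Qed.

Lemma claspX_sigma x : 0 < x < tau -> X x = sigma x * Y x.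
Proof.
have tauH := tau01.
move=> xt; have c0 : 0 < Num.sqrt (1 - x ^+ 2) by apply: cos_gt0; lra.
apply: (mulIf (lt0r_neq0 c0)); rewrite claspX_cos; last by lra.
by rewrite /sigma; field; rewrite gt_eqF.
Qed.

Lemma clasp_reflect_deriv x : is_derive x 1 (fun t : R => tau - t) (- 1).
Proof.
rewrite -[X in is_derive _ _ _ X](add0r (- 1)).
exact: is_deriv_sub (is_deriv_cst _ _) (is_deriv_id _).
Qed.

Lemma clasp_num_deriv x : is_derive x 1 clasp_num
  (2 * x * (1 - (tau - x) * (tau - x)) + 2 * (x * x) * (tau - x)).
Proof.
have dy := clasp_reflect_deriv x; have dx := is_deriv_id x.
have H := is_deriv_mul (is_deriv_mul dx dx)
  (is_deriv_sub (is_deriv_cst x 1) (is_deriv_mul dy dy)).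
by apply: (is_derive_eq H); ring.
Qed.

Lemma clasp_den_deriv x : is_derive x 1 clasp_den
  (2 * (x * (tau - x)) * (x - (tau - x))).
Proof.
have dy := clasp_reflect_deriv x; have dx := is_deriv_id x.
have dp := is_deriv_mul dx dy.
have H := is_deriv_sub (is_deriv_cst x 1) (is_deriv_mul dp dp).
by apply: (is_derive_eq H); ring.
Qed.

Definition clasp_slope_num x : R :=
  (1 - (tau - x) * (tau - x) + x * (tau - x)) * clasp_den x
  - x * x * (tau - x) * (1 - (tau - x) * (tau - x)) * (x - (tau - x)).

(** The derivative of X, obtained from that of X^2 = clasp_num / clasp_den after
removing a common factor 2. *)
Definition clasp_slope x : R :=
  x * clasp_slope_num x / (clasp_den x * clasp_den x * X x).

Lemma claspX_deriv x : 0 < x < tau -> is_derive x 1 X (clasp_slope x).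
Proof.
have tauH := tau01.
move=> xt; have xt' : 0 <= x <= tau by lra.
have d0 := clasp_den_gt0 xt'; have X0 := claspX_gt0 xt.
have XE := claspX_sqrt (ltW (andP xt).1).
have Q0 : 0 < clasp_num x / clasp_den x by rewrite -sqrtr_gt0 -XE.
have dinv : is_derive x 1 (fun t => (clasp_den t)^-1)
    (- (2 * (x * (tau - x)) * (x - (tau - x))) / (clasp_den x * clasp_den x)).
  apply: (is_derive_eq (is_deriveV (lt0r_neq0 d0) (clasp_den_deriv x))).
  by rewrite -[LHS]/(_ * _); field; rewrite gt_eqF.
have H := is_deriv_sqrt (f := fun t => clasp_num t / clasp_den t) Q0
  (is_deriv_mul (clasp_num_deriv x) dinv).
apply: (@is_deriv_near R _ X 0 tau x _ xt) (is_derive_eq H _).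
  by move=> t tt; rewrite claspX_sqrt//; lra.
rewrite -XE /clasp_slope /clasp_slope_num /clasp_num.
by field; rewrite !gt_eqF.
Qed.

(** With y = tau - x, the negative contribution is absorbed by the product
x y (1 - x^2 y^2), because 1 - x^2 y^2 >= x^2 (1 - y^2). *)
Lemma clasp_slope_num_gt0 x : 0 < x < tau -> 0 < clasp_slope_num x.
Proof.
have tauH := tau01.
move=> xt; have xt' : 0 <= x <= tau by lra.
have D1 := clasp_den_bound xt'.
have /andP[x0 x1] : 0 < x < 1 by lra.
have /andP[y0 y1] : 0 < tau - x < 1 by lra.
have xy : x <= 1 - (tau - x) by lra.
rewrite /clasp_slope_num /clasp_den in D1 *; set y := tau - x in y0 y1 xy D1 *.
have P0 : 0 < 1 - y * y by nra.
have p0 : 0 <= x * y by nra.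
have -> : (1 - y * y + x * y) * (1 - x * y * (x * y)) - x * x * y * (1 - y * y) * (x - y)
  = (1 - y * y) * (1 - x * y * (x * y)) + x * y * (1 - x * x) + x * y * (x * y) * (1 - y * y) by ring.
apply: ltr_pwDl; last by apply: mulr_ge0; nra.
by apply: ltr_pwDl; [apply: mulr_gt0; lra|apply: mulr_ge0 => //; nra].
Qed.

Lemma clasp_slope_gt0 x : 0 < x < tau -> 0 < clasp_slope x.
Proof.
have tauH := tau01.
move=> xt; have d0 : 0 < clasp_den x by apply: clasp_den_gt0; lra.
apply: divr_gt0; first by apply: mulr_gt0; [lra|exact: clasp_slope_num_gt0].
by apply: mulr_gt0; [exact: mulr_gt0|exact: claspX_gt0].
Qed.

(** With y = tau - x, the numerator clasp_slope_num is at most 2 (1 - y^2), because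
x <= 1 - y <= 1 - y^2 for tau <= 1, while X x >= x (1 - y^2); so the factor
1 - y^2, which may tend to 0, cancels. *)
Lemma clasp_slope_le4 x : 0 < x < tau -> clasp_slope x <= 4.
Proof.
have tauH := tau01.
move=> xt; have xt' : 0 <= x <= tau by lra.
have D1 := clasp_den_bound xt'; have X0 := claspX_gt0 xt.
have /andP[x0 x1] : 0 < x < 1 by lra.
have /andP[y0 y1] : 0 < tau - x < 1 by lra.
have xy : x <= 1 - (tau - x) by lra.
have [P0 P1] : 0 < 1 - (tau - x) * (tau - x) /\ 1 - (tau - x) * (tau - x) <= 1.
  by split; nra.
have [D0 D2] := andP D1.
have E2 : clasp_slope_num x <= 2 * (1 - (tau - x) * (tau - x)).
  rewrite /clasp_slope_num /clasp_den; set y := tau - x in y0 y1 xy P0 P1 *.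
  have -> : (1 - y * y + x * y) * (1 - x * y * (x * y)) - x * x * y * (1 - y * y) * (x - y)
    = 2 * (1 - y * y) - ((1 - y * y - x) + x * (1 - y) + x * y * (x * y) * (x * y)
      + (1 - y * y) * (x * x * x * y)).
    by ring.
  have ? : 0 <= 1 - y * y - x by nra.
  have ? : 0 <= x * (1 - y) by nra.
  have ? : 0 <= x * y by nra.
  have ? : 0 <= x * y * (x * y) * (x * y) by apply: mulr_ge0 => //; apply: mulr_ge0.
  have ? : 0 <= (1 - y * y) * (x * x * x * y) by do ?apply: mulr_ge0; lra.
  lra.
have XP : x * (1 - (tau - x) * (tau - x)) <= X x.
  rewrite claspX_sqrt; last by lra.
  rewrite -[leLHS]ger0_norm; last by apply: mulr_ge0; lra.
  rewrite -sqrtr_sqr; apply: ler_wsqrtr.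
  rewrite ler_pdivlMr; last by lra.
  rewrite /clasp_num; set P := 1 - _ in P0 P1 *.
  have -> : (x * P) ^+ 2 = (x * x * P) * P by ring.
  have ? : 0 <= x * x * P by do ?apply: mulr_ge0; lra.
  rewrite -(mulrA (x * x * P)) ler_piMr//; nra.
have D3 : 1 / 2 <= clasp_den x * clasp_den x by nra.
rewrite ler_pdivrMr; last by apply: mulr_gt0 => //; lra.
have : x * clasp_slope_num x <= 2 * X x by nra.
by nra.
Qed.

Lemma clasp_slope_continuous x : 0 < x < tau -> {for x, continuous clasp_slope}.
Proof.
have tauH := tau01.
move=> xt; have d0 : 0 < clasp_den x by apply: clasp_den_gt0; lra.
have X0 := claspX_gt0 xt.
have cd : {for x, continuous clasp_den} := is_deriv_continuous (clasp_den_deriv x).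
have cy : {for x, continuous (fun t : R => tau - t)} := is_deriv_continuous (clasp_reflect_deriv x).
have cX : {for x, continuous X} := is_deriv_continuous (claspX_deriv xt).
have cid : {for x, continuous (fun t : R => t)} by exact: cvg_id.
have c1 : {for x, continuous (fun t : R => 1 - (tau - t) * (tau - t))}.
  by apply: cvgB; [exact: cvg_cst|apply: cvgM].
apply: cvgM.
  apply: cvgM; first exact: cid.
  apply: cvgB.
    by apply: cvgM => //; apply: cvgD => //; apply: cvgM.
  apply: cvgM; last exact: cvgB.
  by apply: cvgM => //; apply: cvgM => //; apply: cvgM.
apply: cvgV; first by rewrite !mulf_neq0 ?gt_eqF.
by apply: cvgM => //; apply: cvgM.
Qed.

End ClaspProfile.

(** * The height Z of a clasp arc and the distance between clasped arcs *)

Section ClaspHeight.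
Context {R : realType}.
Variable tau : R.
Hypothesis tau01 : 0 < tau <= 1.
Implicit Types (u v x y : R).
Local Notation X := (claspX tau).
Local Notation Z := (claspZ tau).
Local Notation h := (clasp_height tau).
Local Notation Y := (clasp_gap tau).
Local Notation dX := (clasp_slope tau).

Lemma claspX_within : {within `[0, tau], continuous X}.
Proof.
have tauH := tau01.
apply: (@within_itv_eq _ (fun x => Num.sqrt (clasp_num tau x / clasp_den tau x))).
  by move=> x /andP[x0 _]; rewrite claspX_sqrt.
apply: within_itv_sqrt; apply: within_itvM.
  by apply: within_itv_cont => x; exact: is_deriv_continuous (clasp_num_deriv _ _).
apply/subspace_continuousP => x /=; rewrite in_itv/= => xt.
apply: cvg_within_filter; apply: cvgV.
  by rewrite gt_eqF// clasp_den_gt0.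
exact: is_deriv_continuous (clasp_den_deriv _ _).
Qed.

Lemma claspZN u : Z (- u) = Z u.
Proof. by rewrite /claspZ normrN. Qed.

Lemma claspZ0 : Z 0 = 0.
Proof. by rewrite /claspZ normr0 set_itv1 Rintegral_set1. Qed.

Lemma derive1_claspX x : 0 < x < tau -> derive1 X x = dX x.
Proof.
by move=> xt; have H := claspX_deriv tau01 xt; rewrite derive1E derive_val.
Qed.

(** The integrand sigma X' is dominated by 4 sigma, the derivative of the continuous
function - 4 sqrt (1 - t^2), including at t = tau = 1. *)
Lemma claspZ_primitive : {within `[0, tau], continuous Z} /\
  forall x, 0 < x < tau -> is_derive x 1 Z (sigma x * dX x).
Proof.
have tauH := tau01.
pose f s := sigma s * derive1 X s.
have f_near x : 0 < x < tau -> \forall t \near x, sigma t * dX t = f t.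
  move=> xt; have : x \in `]0, tau[ by rewrite in_itv.
  move=> /near_in_itvoo; apply: filterS => t; rewrite in_itv/= => tt.
  by rewrite /f derive1_claspX.
have [||||||cF dF] := @dominated_primitive R f sigma
    (fun t => - Num.sqrt (1 - t ^+ 2)) 4 0 tau.
- lra.
- by apply: within_itvN; apply: within_itv_cont; exact: cos_continuous.
- move=> x xt; rewrite -[sigma x]opprK; apply: is_deriv_opp; apply: cos_deriv; lra.
- by move=> x xt; apply: sigma_continuous; lra.
- move=> x xt; have fx := f_near x xt.
  rewrite /prop_for /continuous_at -(nbhs_singleton fx).
  apply: (cvg_trans (near_eq_cvg fx)).
  apply: cvgM; last exact: clasp_slope_continuous.
  by apply: sigma_continuous; lra.
- move=> x xt; rewrite /f derive1_claspX// mulrC.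
  have s0 : 0 <= sigma x by apply: sigma_ge0; lra.
  have d0 := clasp_slope_gt0 tau01 xt.
  rewrite normrM (ger0_norm s0) (gtr0_norm d0) ler_wpM2r//.
  exact: clasp_slope_le4.
split.
  by apply: within_itv_eq cF => x /andP[x0 _]; rewrite /claspZ ger0_norm.
move=> x xt; rewrite -(derive1_claspX xt).
apply: (is_deriv_near xt) (dF x xt) => t /andP[/ltW t0 _].
by rewrite /claspZ ger0_norm.
Qed.

Lemma claspZ_within : {within `[0, tau], continuous Z}.
Proof. by case: claspZ_primitive. Qed.

Lemma claspZ_deriv x : 0 < x < tau -> is_derive x 1 Z (sigma x * dX x).
Proof. by case: claspZ_primitive => _; exact. Qed.

Lemma claspZ_homo x y : 0 <= x -> x <= y -> y <= tau -> Z x <= Z y.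
Proof.
have tauH := tau01.
move=> x0 xy yt.
have cZ : {within `[x, y], continuous Z} by apply: within_itvW claspZ_within.
apply: (deriv_ge0_le xy cZ (dF := fun x => sigma x * dX x)).
  by move=> t ?; apply: claspZ_deriv; lra.
move=> t ?; apply: mulr_ge0; first by apply: sigma_ge0; lra.
by apply/ltW/clasp_slope_gt0 => //; lra.
Qed.

Lemma claspZ_ge0 x : 0 <= x <= tau -> 0 <= Z x.
Proof. by move=> /andP[x0 xt]; rewrite -claspZ0; exact: claspZ_homo. Qed.

(** Differentiating X x ^ 2 + X (tau - x) ^ 2 + Y x ^ 2 = 1 and dividing by Y turns
X / Y into sigma, and shows that the left-hand side has derivative 0; its value
at x = 0 is the definition of h. *)
Lemma strut_height x : 0 <= x <= tau -> Z x + Z (tau - x) + Y x = h.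
Proof.
have tauH := tau01.
move=> xt.
pose H x := Z x + Z (tau - x) + Num.sqrt (1 - X x * X x - X (tau - x) * X (tau - x)).
have HE t : 0 <= t <= tau -> H t = Z t + Z (tau - t) + Y t.
  move=> tt; rewrite /H; congr (_ + _).
  have := clasp_gap_sqr tau01 tt => E.
  have -> : 1 - X t * X t - X (tau - t) * X (tau - t) = Y t ^+ 2 by rewrite -E; ring.
  by rewrite sqrtr_sqr ger0_norm// clasp_gap_ge0.
have hE : h = H 0.
  rewrite HE; last by lra.
  by rewrite claspZ0 subr0 clasp_gap0 add0r.
have refl (f : R -> R) : {within `[0, tau], continuous f} ->
    {within `[0, tau], continuous (fun t => f (tau - t))}.
  apply: (within_itv_comp (c := 0) (d := tau) (h := fun t => tau - t)); first by move=> ? ?; lra.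
  by apply: within_itvB; [exact: within_itv_cst|exact: within_itv_id].
have cH : {within `[0, tau], continuous H}.
  have cX := claspX_within; have cZ := claspZ_within.
  apply: within_itvD; first by apply: within_itvD => //; exact: refl.
  apply: within_itv_sqrt; apply: within_itvB; last by apply: within_itvM; exact: refl.
  by apply: within_itvB; [exact: within_itv_cst|exact: within_itvM].
have dH t : 0 < t < tau -> is_derive t 1 H 0.
  move=> tt; have tt' : 0 < tau - t < tau by lra.
  have t1 : 0 <= t <= tau by lra.
  have Y0 := clasp_gap_gt0 tau01 tt.
  have YE : 1 - X t * X t - X (tau - t) * X (tau - t) = Y t ^+ 2.
    by rewrite -(clasp_gap_sqr tau01 t1); ring.
  have d1 := claspX_deriv tau01 tt; have d2 := is_deriv_reflect (claspX_deriv tau01 tt').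
  have d3 := claspZ_deriv tt; have d4 := is_deriv_reflect (claspZ_deriv tt').
  have Q0 : 0 < 1 - X t * X t - X (tau - t) * X (tau - t) by rewrite YE exprn_gt0.
  have d5 := is_deriv_sqrt
    (f := fun t => 1 - X t * X t - X (tau - t) * X (tau - t)) Q0
    (is_deriv_sub (is_deriv_sub (is_deriv_cst t 1) (is_deriv_mul d1 d1)) (is_deriv_mul d2 d2)).
  apply: (is_derive_eq (is_deriv_add (is_deriv_add d3 d4) d5)).
  rewrite YE sqrtr_sqr (ger0_norm (ltW Y0)).
  have E2 : Y (tau - t) = Y t.
    rewrite /clasp_gap /clasp_den (_ : tau - (tau - t) = t); last by ring.
    by congr (Num.sqrt (_ / _)); ring.
  rewrite (claspX_sigma tau01 tt) (claspX_sigma tau01 tt') E2.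
  by field; rewrite gt_eqF.
rewrite -HE// hE; apply/esym.
have x0 : 0 <= x by lra.
apply: (deriv_eq0_cst x0); first by apply: within_itvW cH; lra.
by move=> t ?; apply: dH; lra.
Qed.

Lemma claspZ_le_height x : 0 <= x <= tau -> Z x <= h.
Proof.
have tauH := tau01.
move=> xt; rewrite -(strut_height xt) -addrA lerDl addr_ge0 ?clasp_gap_ge0//.
by apply: claspZ_ge0; lra.
Qed.

(** Since Z is increasing, replacing Z (tau - y) by Z x in strut_height makes an
error whose sign tells on which side of the strut y lies. *)
Lemma height_gap x y : 0 <= x <= tau -> 0 <= y <= tau ->
  (y <= tau - x -> Y y <= h - Z x - Z y) /\
  (tau - x <= y -> h - Z x - Z y <= Y y).
Proof.
have tauH := tau01.
move=> xt yt; rewrite -(strut_height yt); split=> xy.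
  have : Z x <= Z (tau - y) by apply: claspZ_homo; lra.
  by lra.
have : Z (tau - y) <= Z x by apply: claspZ_homo; lra.
by lra.
Qed.

(** In v, half the derivative of the squared distance is X' v times sigma v times
the difference compared in height_gap.  So the distance decreases up to
v = tau - u, where it is 1, and increases afterwards. *)
Lemma clasp_distance u v : 0 <= u <= tau -> 0 <= v <= tau ->
  1 <= X u * X u + X v * X v + (h - Z u - Z v) * (h - Z u - Z v).
Proof.
have tauH := tau01.
move=> ut vt.
pose F v := X u * X u + X v * X v + (h - Z u - Z v) * (h - Z u - Z v).
have F1 : F (tau - u) = 1.
  rewrite /F -(clasp_gap_sqr tau01 ut) -(strut_height ut); ring.
have cF : {within `[0, tau], continuous F}.
  have cX := claspX_within; have cZ := claspZ_within.
  have c1 : {within `[0, tau], continuous (fun t => h - Z u - Z t)}.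
    by apply: within_itvB => //; exact: within_itv_cst.
  apply: within_itvD; last exact: within_itvM.
  by apply: within_itvD; [exact: within_itv_cst|exact: within_itvM].
pose dF t := 2 * dX t * (X t - (h - Z u - Z t) * sigma t).
have DF t : 0 < t < tau -> is_derive t 1 F (dF t).
  move=> tt; have d1 := claspX_deriv tau01 tt.
  have d2 := is_deriv_sub (is_deriv_cst t (h - Z u)) (claspZ_deriv tt).
  apply: (is_derive_eq (is_deriv_add
    (is_deriv_add (is_deriv_cst t (X u * X u)) (is_deriv_mul d1 d1)) (is_deriv_mul d2 d2))).
  by rewrite /dF; ring.
have sgn t : 0 < t < tau -> X t - (h - Z u - Z t) * sigma t = (Y t - (h - Z u - Z t)) * sigma t.
  by move=> tt; rewrite (claspX_sigma tau01 tt); ring.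
rewrite -[X in X <= _]F1 -/(F v).
have [vu|uv] := leP v (tau - u).
  rewrite -lerN2; apply: (@deriv_ge0_le _ (fun t => - F t) (fun t => - dF t) v (tau - u) vu).
  - by apply: within_itvN; apply: within_itvW cF; lra.
  - by move=> t ?; apply: is_deriv_opp; apply: DF; lra.
  move=> t tv; have tt : 0 < t < tau by lra.
  rewrite /dF sgn// oppr_ge0; apply: mulr_ge0_le0.
    by rewrite mulr_ge0// ltW// clasp_slope_gt0.
  apply: mulr_le0_ge0; last by apply: sigma_ge0; lra.
  by rewrite subr_le0; have [+ _] := height_gap ut (y := t) ltac:(lra); apply; lra.
apply: (@deriv_ge0_le _ F dF); first exact: ltW.
- by apply: within_itvW cF; lra.
- by move=> t ?; apply: DF; lra.
move=> t tv; have tt : 0 < t < tau by lra.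
rewrite /dF sgn//; apply: mulr_ge0.
  by rewrite mulr_ge0// ltW// clasp_slope_gt0.
apply: mulr_ge0; last by apply: sigma_ge0; lra.
by rewrite subr_ge0; have [_ +] := height_gap ut (y := t) ltac:(lra); apply; lra.
Qed.

End ClaspHeight.

(** * Vectors and limits of directions *)

Section Space.
Context {R : realType}.
Local Notation V := 'rV[R]_3.
Implicit Types (v w : V) (k : R).

Lemma vec3x (x y z : R) : vec3 x y z 0 0 = x. Proof. by rewrite mxE. Qed.
Lemma vec3y (x y z : R) : vec3 x y z 0 1 = y. Proof. by rewrite mxE. Qed.
Lemma vec3z (x y z : R) : vec3 x y z 0 2 = z. Proof. by rewrite mxE. Qed.
Definition vec3E := (vec3x, vec3y, vec3z).

Lemma ord3P (P : 'I_3 -> Prop) : P 0 -> P 1 -> P 2 -> forall i, P i.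
Proof.
move=> P0 P1 P2 [[|[|[|//]]] ip].
- by rewrite (_ : Ordinal ip = 0)//; apply/val_inj.
- by rewrite (_ : Ordinal ip = 1)//; apply/val_inj.
- by rewrite (_ : Ordinal ip = 2)//; apply/val_inj.
Qed.

Lemma vec_eq v w : v 0 0 = w 0 0 -> v 0 1 = w 0 1 -> v 0 2 = w 0 2 -> v = w.
Proof.
by move=> h0 h1 h2; apply/rowP => i; move: i; apply: ord3P.
Qed.

Lemma dotC v w : dot v w = dot w v.
Proof. by rewrite !dotE; ring. Qed.

Lemma dotDl v v' w : dot (v + v') w = dot v w + dot v' w.
Proof. by rewrite !dotE !mxE; ring. Qed.

Lemma dotZl k v w : dot (k *: v) w = k * dot v w.
Proof. by rewrite !dotE !mxE; ring. Qed.

Lemma dotNl v w : dot (- v) w = - dot v w.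
Proof. by rewrite !dotE !mxE; ring. Qed.

Lemma dotDr v w w' : dot v (w + w') = dot v w + dot v w'.
Proof. by rewrite !dotE !mxE; ring. Qed.

Lemma dotBr v w w' : dot v (w - w') = dot v w - dot v w'.
Proof. by rewrite !dotE !mxE; ring. Qed.

Lemma dot_delta i w : dot (delta_mx 0 i) w = w 0 i.
Proof.
by move: i; apply: ord3P; rewrite dotE !mxE/=; ring.
Qed.

Lemma dotvv_ge0 v : 0 <= dot v v.
Proof. by apply: sumr_ge0 => i _; rewrite -expr2 sqr_ge0. Qed.

Lemma enorm_ge1 v : 1 <= dot v v -> 1 <= enorm v.
Proof. by move=> v1; rewrite -sqrtr1; exact: ler_wsqrtr. Qed.

Lemma enorm_eq1 v : dot v v = 1 -> enorm v = 1.
Proof. by move=> v1; rewrite /enorm v1 sqrtr1. Qed.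

Lemma cvg_vec (U : Type) (F : set_system U) (FF : Filter F) (f : U -> V) v :
  (forall i, f x 0 i @[x --> F] --> v 0 i) -> f @ F --> v.
Proof.
move=> fv; apply/cvg_ballP => e e0.
have : \forall x \near F, forall i, ball (v 0 i) e (f x 0 i).
  by apply: filter_forall => i; move/cvg_ballP : (fv i); exact.
by apply: filterS => x H; split=> // i j; rewrite ord1; exact: H.
Qed.

(** Directions converge to the unit vector v as soon as D eventually lies in every
open half-space that contains v: the half-spaces bounded by planes nearly
parallel to v squeeze the ratios of the coordinates of D to its component
along v. *)
Lemma cvg_direction (U : Type) (F : set_system U) (FF : ProperFilter F) (D : U -> V) v :
  dot v v = 1 ->
  (forall w, 0 < dot w v -> \forall x \near F, 0 < dot w (D x)) ->
  (enorm (D x))^-1 *: D x @[x --> F] --> v.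
Proof.
move=> v1 Dw; pose a x := dot v (D x).
have a0 : \forall x \near F, 0 < a x by apply: Dw; rewrite v1.
have q i : D x 0 i / a x @[x --> F] --> v 0 i.
  apply/cvgrPdist_lt => e e0.
  (* Half-spaces tilted by e from the plane through v, towards and away from the
     i-th axis; delta_mx 0 i is made orthogonal to v. *)
  pose w (s : R) := e *: v + s *: (delta_mx 0 i - v 0 i *: v).
  have wE s u : dot (w s) u = e * dot v u + s * (u 0 i - v 0 i * dot v u).
    by rewrite /w dotDl !dotZl dotDl dot_delta dotNl dotZl.
  have w0 s : 0 < dot (w s) v by rewrite wE v1 !mulr1 subrr mulr0 addr0.
  apply: filterS (filterI a0 (filterI (Dw _ (w0 1)) (Dw _ (w0 (-1))))).
  move=> x [ax []]; rewrite !wE -/(a x) => h1 h2.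
  rewrite -(ltr_pM2r ax) -[X in _ * X](gtr0_norm ax) -normrM mulrBl divfK ?gt_eqF//.
  by rewrite ltr_norml; lra.
pose n x := Num.sqrt (D x 0 0 / a x * (D x 0 0 / a x) + D x 0 1 / a x * (D x 0 1 / a x) +
  D x 0 2 / a x * (D x 0 2 / a x)).
have n1 : n x @[x --> F] --> (1 : R).
  rewrite -sqrtr1 -v1 dotE; apply: continuous_cvg; first exact: sqrt_continuous.
  by apply: cvgD; [apply: cvgD|]; apply: cvgM; exact: q.
apply: cvg_vec => i; rewrite -[v 0 i]divr1.
have : D x 0 i / a x / n x @[x --> F] --> v 0 i / 1.
  by apply: cvgM => //; apply: cvgV => //; exact: oner_neq0.
apply: cvg_trans; apply: near_eq_cvg; move: a0; apply: filterS => x ax.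
have -> : n x = enorm (D x) / a x.
  rewrite -[a x in RHS](gtr0_norm ax) -sqrtr_sqr /enorm dotE /n.
  rewrite -sqrtrV ?sqr_ge0// -sqrtrM; last by rewrite -dotE dotvv_ge0.
  by congr Num.sqrt; field; rewrite gt_eqF.
rewrite !mxE invfM invrK mulrCA mulrA -mulrA.
have [->|e0] := eqVneq (enorm (D x)) 0; first by rewrite invr0; ring.
by field; rewrite e0 gt_eqF.
Qed.

End Space.

(** * Unit tangents of piecewise smooth curves *)

Section Tangents.
Context {R : realType}.
Local Notation V := 'rV[R]_3.
Implicit Types (t s r : R) (T : R -> V) (c : curve (R := R)).

Lemma at_right_itv t (P : R -> Prop) : (\forall r \near t^'+, P r) ->
  exists2 d, 0 < d & forall r, t < r < t + d -> P r.
Proof.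
rewrite near_withinE => /nbhs_ballP[d /= d0 H]; exists d => // r /andP[tr rd].
by apply: H => //=; rewrite /ball/= ltr_distlC; lra.
Qed.

Lemma at_left_itv t (P : R -> Prop) : (\forall r \near t^'-, P r) ->
  exists2 d, 0 < d & forall r, t - d < r < t -> P r.
Proof.
rewrite near_withinE => /nbhs_ballP[d /= d0 H]; exists d => // r /andP[tr rd].
by apply: H => //=; rewrite /ball/= ltr_distlC; lra.
Qed.

Lemma at_right_notin t (S : seq R) : \forall r \near t^'+, r \notin S.
Proof.
elim: S => [|x S IH]; first by apply: nearW => r; rewrite in_nil.
have : \forall r \near t^'+, r != x.
  have [tx|xt] := ltP t x.
    by have := nbhs_right_lt tx; apply: filterS => r; move=> /lt_eqF ->.
  have := nbhs_right_gt t; apply: filterS => r tr.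
  by rewrite gt_eqF// (le_lt_trans xt).
by apply: filterS2 IH => r rS rx; rewrite in_cons negb_or rx.
Qed.

Lemma at_left_notin t (S : seq R) : \forall r \near t^'-, r \notin S.
Proof.
elim: S => [|x S IH]; first by apply: nearW => r; rewrite in_nil.
have : \forall r \near t^'-, r != x.
  have [xt|tx] := ltP x t.
    by have := nbhs_left_gt xt; apply: filterS => r xr; rewrite gt_eqF.
  have := nbhs_left_lt t; apply: filterS => r rt.
  by rewrite lt_eqF// (lt_le_trans rt).
by apply: filterS2 IH => r rS rx; rewrite in_cons negb_or rx.
Qed.

(** The velocity of p at r is a positive multiple of T r.  The speed is left free:
it tends to 0 or to infinity at some junctions of the curves below. *)
Definition moves_along (p : R -> V) T r :=
  exists2 l, 0 < l & forall i, is_derive r 1 (fun t => p t 0 i) (l * T r 0 i).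

(** The mean value theorem for r |-> w . p r, whose derivative is a positive
multiple of w . T. *)
Lemma moves_along_dot (p : R -> V) T s t (w : V) : s < t ->
  (forall i, {within `[s, t], continuous (fun r => p r 0 i)}) ->
  (forall r, s < r < t -> moves_along p T r) ->
  (forall r, s < r < t -> 0 < dot w (T r)) -> 0 < dot w (p t - p s).
Proof.
move=> st cp pT wT.
pose F r := w 0 0 * p r 0 0 + w 0 1 * p r 0 1 + w 0 2 * p r 0 2.
have cF : {within `[s, t], continuous F}.
  by apply: within_itvD; [apply: within_itvD|]; apply: within_itvZ; exact: cp.
have dF r : s < r < t -> exists2 l, 0 < l & is_derive r 1 F (l * dot w (T r)).
  move=> /pT[l l0 H]; exists l => //.
  apply: (is_derive_eq (is_deriv_add (is_deriv_add (is_deriv_scale (w 0 0) (H 0))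
    (is_deriv_scale (w 0 1) (H 1))) (is_deriv_scale (w 0 2) (H 2)))).
  by rewrite dotE; ring.
have dF' r : r \in `]s, t[ -> is_derive r 1 F ('D_1 F r).
  by rewrite in_itv/= => /dF[l _ H]; apply: derivableP; exact: ex_derive.
have [r rst E] := MVT st dF' cF.
have -> : dot w (p t - p s) = F t - F s by rewrite dotBr !dotE.
move: rst; rewrite in_itv/= E => rst; have [l l0 H] := dF r rst.
by rewrite derive_val mulr_gt0 ?subr_gt0// mulr_gt0// wT.
Qed.

(** The exceptional set S absorbs the junctions of a piecewise smooth curve, where
only the direction T, not the velocity, is required to be continuous. *)
Definition tangent_field c T := [/\ lo c < hi c,
  forall i, {within `[lo c, hi c], continuous (fun t => pos c t 0 i)},
  forall i, continuous (fun t => T t 0 i),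
  forall t, dot (T t) (T t) = 1 &
  exists S : seq R, forall r, lo c < r < hi c -> r \notin S -> moves_along (pos c) T r].

Lemma dot_continuous T (w : V) : (forall i, continuous (fun t => T t 0 i)) ->
  continuous (fun t => dot w (T t)).
Proof.
move=> cT; rewrite (_ : (fun t => _) = (fun t => w 0 0 * T t 0 0 + w 0 1 * T t 0 1 + w 0 2 * T t 0 2)).
  move=> x; apply: cvgD; [apply: cvgD|]; (apply: cvgM; [exact: cvg_cst|exact: cT]).
by apply/funext => t; rewrite dotE.
Qed.

Lemma rtangent_cvg c T t : tangent_field c T -> lo c <= t < hi c ->
  secant c t s @[s --> t^'+] --> T t.
Proof.
move=> [lh cp cT T1 [S H]] /andP[lt th].
apply: cvg_direction => // w wt.
have wT : \forall r \near t^'+, 0 < dot w (T r).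
  have := cvg_at_right_filter (@dot_continuous T w cT t).
  by move/cvgr_gt; apply.
have [d d0 D] := at_right_itv (filterI wT (filterI (at_right_notin t S) (nbhs_right_lt th))).
have : \forall s \near t^'+, t < s < t + d.
  near=> s; apply/andP; split; first by near: s; exact: nbhs_right_gt.
  by near: s; apply: nbhs_right_lt; lra.
apply: filterS => s ts; have [_ [_ sh]] := D s ts.
apply: (@moves_along_dot _ T); first by lra.
- by move=> i; apply: within_itvW (cp i); lra.
- move=> r rs; have [_ [rS _]] := D r ltac:(lra); apply: H => //; lra.
- by move=> r rs; have [] := D r ltac:(lra).
Unshelve. all: by end_near. Qed.

Lemma ltangent_cvg c T : tangent_field c T ->
  secant c s (hi c) @[s --> (hi c)^'-] --> T (hi c).
Proof.
move=> [lh cp cT T1 [S H]]; set t := hi c in lh *.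
apply: cvg_direction => // w wt.
have wT : \forall r \near t^'-, 0 < dot w (T r).
  have := cvg_at_left_filter (@dot_continuous T w cT t).
  by move/cvgr_gt; apply.
have [d d0 D] := at_left_itv (filterI wT (filterI (at_left_notin t S) (nbhs_left_gt lh))).
have : \forall s \near t^'-, t - d < s < t.
  near=> s; apply/andP; split; first by near: s; apply: nbhs_left_gt; lra.
  by near: s; exact: nbhs_left_lt.
apply: filterS => s ts; have [_ [_ sh]] := D s ts.
apply: (@moves_along_dot _ T); first by lra.
- by move=> i; apply: within_itvW (cp i); rewrite /t; lra.
- move=> r rs; have [_ [rS _]] := D r ltac:(lra); apply: H => //; rewrite -/t; lra.
- by move=> r rs; have [] := D r ltac:(lra).
Unshelve. all: by end_near. Qed.

Lemma unit_tangentE (K : component R) T : tangent_field (curve_of K) T ->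
  (if K is Loop c then T (lo c) = T (hi c) else True) ->
  forall t, lo (curve_of K) <= t <= hi (curve_of K) -> unit_tangent K t = T t.
Proof.
move=> TK loop t /andP[lt th].
have rE s : lo (curve_of K) <= s < hi (curve_of K) -> rtangent (curve_of K) s = T s.
  by move=> sK; apply: cvg_lim; [exact: norm_hausdorff|exact: rtangent_cvg].
have lE : ltangent (curve_of K) (hi (curve_of K)) = T (hi (curve_of K)).
  by apply: cvg_lim; [exact: norm_hausdorff|exact: ltangent_cvg].
have [lh _ _ _ _] := TK.
case: K TK loop lt th rE lE lh => [c A B|c] /= TK loop lt th rE lE lh;
  case: ltP => [th'|ht]; rewrite ?rE ?lt//.
- by have -> : t = hi c by apply/eqP; rewrite eq_le th ht.
- by have -> : t = hi c by apply/eqP; rewrite eq_le th ht.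
- by rewrite lexx.
Qed.

Lemma tangent_field_wf (K : component R) T : tangent_field (curve_of K) T ->
  (if K is Loop c then T (lo c) = T (hi c) else True) ->
  (forall i, bounded_variation (lo (curve_of K)) (hi (curve_of K)) (fun t => T t 0 i)) ->
  let c := curve_of K in
  [/\ lo c < hi c,
      {within dom K, continuous (pos c)},
      forall t, lo c <= t < hi c -> cvg (secant c t s @[s --> t^'+]),
      cvg (secant c s (hi c) @[s --> (hi c)^'-]) &
      forall i, bounded_variation (lo c) (hi c)
                  (fun t => unit_tangent K t 0 i)].
Proof.
move=> TK loop bvT c; have UE := unit_tangentE TK loop.
have [lh cp _ _ _] := TK; split=> //.
- by move=> t; apply: cvg_vec => i; exact: cp.
- by move=> t tc; apply/cvg_ex; eexists; exact: rtangent_cvg TK tc.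
- by apply/cvg_ex; eexists; exact: ltangent_cvg TK.
- move=> i; have [M HM] := bvT i; exists M => _ [s abs <-].
  apply: HM; exists s => //; rewrite /variation !big_nat; apply: eq_bigr => k /andP[_ ks] /=.
  have itv j : (j < (size s).+1)%N ->
      lo (curve_of K) <= nth (hi c) (lo c :: s) j <= hi (curve_of K).
    by move=> js; rewrite (itv_partition_nth_ge js abs) (itv_partition_nth_le js abs).
  by have := itv k.+1 ks; have := itv k (ltnW ks) => h1 h2; rewrite !UE.
Qed.

End Tangents.

(** * Mirror images *)

Section Mirror.
Context {R : realType}.
Local Notation V := 'rV[R]_3.
Implicit Types (v w : V).

Lemma moves_along_vec3 (p T : R -> V) (x y z : R -> R) (l a b c m M r : R) : 0 < l ->
  m < r < M -> (forall t, m < t < M -> p t = vec3 (x t) (y t) (z t)) ->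
  T r = vec3 a b c -> is_derive r 1 x (l * a) -> is_derive r 1 y (l * b) ->
  is_derive r 1 z (l * c) -> moves_along p T r.
Proof.
move=> l0 mrM pE TE dx dy dz; exists l => //; apply: ord3P; rewrite TE vec3E.
- by apply: (is_deriv_near mrM) dx => t /pE ->; rewrite vec3E.
- by apply: (is_deriv_near mrM) dy => t /pE ->; rewrite vec3E.
- by apply: (is_deriv_near mrM) dz => t /pE ->; rewrite vec3E.
Qed.

Lemma dot_mirror v w : dot (mirror v) w = dot v (mirror w).
Proof. by rewrite !dotE !vec3E; ring. Qed.

Lemma mirrorK : involutive (@mirror R).
Proof. by move=> v; apply: vec_eq; rewrite !vec3E ?opprK. Qed.

Lemma tangent_field_mirror (c : curve) (T : R -> V) : tangent_field c T ->
  tangent_field (Curve (lo c) (hi c) (mirror \o pos c)) (mirror \o T).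
Proof.
move=> [lh cp cT T1 [S H]]; split=> //=.
- apply: ord3P.
  + by apply: within_itv_eq (cp 0) => t _; rewrite vec3E.
  + by apply: within_itv_eq (cp 1) => t _; rewrite vec3E.
  + by apply: within_itv_eq (within_itvN (cp 2)) => t _; rewrite vec3E.
- apply: ord3P.
  + by under eq_fun do rewrite vec3E; exact: cT.
  + by under eq_fun do rewrite vec3E; exact: cT.
  + by under eq_fun do rewrite vec3E; move=> t; apply: cvgN; exact: cT.
- by move=> t; rewrite dot_mirror mirrorK.
exists S => r rc rS; have [l l0 D] := H r rc rS.
have rr : r - 1 < r < r + 1 by lra.
have dz : is_derive r 1 (fun t => - pos c t 0 2) (l * - T r 0 2).
  by rewrite mulrN; apply: is_deriv_opp; exact: D.
exact: (moves_along_vec3 (p := mirror \o pos c) (T := mirror \o T)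
  (x := fun t => pos c t 0 0) (y := fun t => pos c t 0 1) (z := fun t => - pos c t 0 2)
  l0 rr (fun t _ => erefl) erefl (D 0) (D 1) dz).
Qed.

End Mirror.

(** * The upper profiles of gamma and alpha *)

Section Profile.
Context {R : realType}.
Variable tau : R.
Hypothesis tau01 : 0 < tau <= 1.
Local Notation X := (claspX tau).
Local Notation Z := (claspZ tau).
Local Notation h := (clasp_height tau).
Implicit Types (r t u : R).

Lemma within_itv_sym (f : R -> R) k : 0 <= k -> {within `[0, k], continuous f} ->
  {within `[- k, 0], continuous f} -> {within `[- k, k], continuous f}.
Proof. by move=> k0 c1 c2; apply: within_itv_cat c2 c1 => //; rewrite oppr_le0. Qed.

Lemma within_itv_flip (f : R -> R) k : {within `[0, k], continuous f} ->
  {within `[- k, 0], continuous (fun t => f (- t))}.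
Proof.
apply: (within_itv_comp (h := fun t => - t)); first by move=> x ?; lra.
by apply: within_itvN; exact: within_itv_id.
Qed.

Lemma claspX_within_sym : {within `[- tau, tau], continuous X}.
Proof.
have tauH := tau01.
apply: within_itv_sym; [lra|exact: claspX_within|].
apply: within_itv_eq (within_itvN (within_itv_flip (claspX_within tau01))) => t _ /=.
by rewrite claspXN opprK.
Qed.

Lemma claspZ_within_sym : {within `[- tau, tau], continuous Z}.
Proof.
have tauH := tau01.
apply: within_itv_sym; [lra|exact: claspZ_within|].
apply: within_itv_eq (within_itv_flip (claspZ_within tau01)) => t _ /=.
exact: claspZN.
Qed.

(** Along an arc that is symmetric about its tip the velocity is a positive multiple
of (sqrt (1 - r^2), r), on both sides of the tip. *)
Lemma profile_deriv r : r != 0 -> - tau < r < tau -> exists l, [/\ 0 < l,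
  is_derive r 1 X (l * Num.sqrt (1 - r ^+ 2)) & is_derive r 1 Z (l * r)].
Proof.
have tauH := tau01.
have dpos u : 0 < u < tau -> exists l, [/\ 0 < l,
    is_derive u 1 X (l * Num.sqrt (1 - u ^+ 2)) & is_derive u 1 Z (l * u)].
  move=> ut; have c0 : 0 < Num.sqrt (1 - u ^+ 2) by apply: cos_gt0; lra.
  exists (clasp_slope tau u / Num.sqrt (1 - u ^+ 2)); split.
  - by rewrite divr_gt0// clasp_slope_gt0.
  - by rewrite divfK ?gt_eqF//; exact: claspX_deriv.
  - have -> : clasp_slope tau u / Num.sqrt (1 - u ^+ 2) * u = sigma u * clasp_slope tau u.
      by rewrite /sigma; ring.
    exact: claspZ_deriv.
rewrite neq_lt => /orP[rn|rp] rt; last by apply: dpos; lra.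
have [|l [l0 dX dZ]] := dpos (- r); first by lra.
have rt' : - tau < r < 0 by lra.
rewrite -(sub0r r) in dX dZ; exists l; split=> //.
  have := is_deriv_opp (is_deriv_reflect dX); rewrite opprK sub0r sqrrN.
  by apply: (is_deriv_near rt') => t _; rewrite sub0r claspXN opprK.
have := is_deriv_reflect dZ; rewrite sub0r mulrN opprK.
by apply: (is_deriv_near rt') => t _; rewrite sub0r claspZN.
Qed.

(** The horizontal coordinate of the upper part of alpha; its vertical coordinate
is d / 2 + alphaz. *)
Definition alphax u := if `|u| <= tau then X u else u.
Definition alphaz u := if `|u| <= tau then h - Z u else Num.sqrt (1 - u ^+ 2).

Lemma clasp_height_tau : h - Z tau = Num.sqrt (1 - tau ^+ 2).
Proof. by rewrite /clasp_height; ring. Qed.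

Lemma alphaxN u : alphax (- u) = - alphax u.
Proof. by rewrite /alphax normrN claspXN; case: ifP. Qed.

Lemma alphazN u : alphaz (- u) = alphaz u.
Proof. by rewrite /alphaz normrN claspZN sqrrN. Qed.

Lemma alphax_clasp u : - tau <= u <= tau -> alphax u = X u.
Proof. by rewrite /alphax ler_norml => ->. Qed.

Lemma alphaz_clasp u : - tau <= u <= tau -> alphaz u = h - Z u.
Proof. by rewrite /alphaz ler_norml => ->. Qed.

Lemma alphax_arc u : tau <= u -> alphax u = u.
Proof.
have tauH := tau01.
move=> tu; rewrite /alphax ger0_norm; last by lra.
case: leP => // ut; have -> : u = tau by lra.
exact: claspX_tau.
Qed.

Lemma alphaz_arc u : tau <= u -> alphaz u = Num.sqrt (1 - u ^+ 2).
Proof.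
have tauH := tau01.
move=> tu; rewrite /alphaz ger0_norm; last by lra.
case: leP => // ut; have -> : u = tau by lra.
exact: clasp_height_tau.
Qed.

Lemma alphax1 : alphax 1 = 1.
Proof. by rewrite alphax_arc//; case/andP: tau01. Qed.

Lemma alphaz1 : alphaz 1 = 0.
Proof. by rewrite alphaz_arc ?expr1n ?subrr ?sqrtr0//; case/andP: tau01. Qed.

Lemma alphax_within : {within `[- 1, 1], continuous alphax}.
Proof.
have tauH := tau01.
have c1 : {within `[0, 1], continuous alphax}.
  apply: (@within_itv_cat _ _ 0 tau 1); [lra|lra| |].
    apply: within_itv_eq (claspX_within tau01) => t ?; rewrite alphax_clasp//; lra.
  by apply: within_itv_eq (@within_itv_id R tau 1) => t /andP[? _]; rewrite alphax_arc.
apply: within_itv_sym => //.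
apply: within_itv_eq (within_itvN (within_itv_flip c1)) => t _ /=.
by rewrite alphaxN opprK.
Qed.

Lemma alphaz_within : {within `[- 1, 1], continuous alphaz}.
Proof.
have tauH := tau01.
have c1 : {within `[0, 1], continuous alphaz}.
  apply: (@within_itv_cat _ _ 0 tau 1); [lra|lra| |].
    apply: (@within_itv_eq _ (fun t => h - Z t)).
      by move=> t ?; rewrite alphaz_clasp//; lra.
    by apply: within_itvB; [exact: within_itv_cst|exact: claspZ_within].
  apply: within_itv_eq (within_itv_cont (b := 1) (a := tau) (@cos_continuous R)).
  by move=> t /andP[? _]; rewrite alphaz_arc.
apply: within_itv_sym => //.
apply: within_itv_eq (within_itv_flip c1) => t _ /=.
by rewrite alphazN.
Qed.

Lemma alpha_profile_deriv r : -1 < r < 1 -> r != 0 -> r != tau -> r != - tau ->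
  exists l, [/\ 0 < l,
  is_derive r 1 alphax (l * Num.sqrt (1 - r ^+ 2)) & is_derive r 1 alphaz (l * - r)].
Proof.
have tauH := tau01.
move=> r1 r0 rt rNt; have c0 := cos_gt0 r1.
have [rle|rgt] := leP `|r| tau.
  have rtt : - tau < r < tau.
    move: rle; rewrite ler_norml => /andP[r1' r2'].
    by rewrite !lt_neqAle r1' r2' rt eq_sym rNt.
  have [l [l0 dX dZ]] := profile_deriv r0 rtt; exists l; split=> //.
    apply: (is_deriv_near rtt) dX => t /andP[? ?]; rewrite alphax_clasp//; lra.
  have := is_deriv_sub (is_deriv_cst r h) dZ; rewrite sub0r -mulrN.
  by apply: (is_deriv_near rtt) => t /andP[? ?]; rewrite alphaz_clasp//; lra.
have [m [M [mrM arc]]] : exists m M, m < r < M /\ forall t, m < t < M -> tau < `|t|.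
  move: rgt; rewrite ltNge ler_norml negb_and -!ltNge => /orP[rl|rl].
    by exists (-1), (- tau); split=> [|t ?]; [lra|rewrite ltr_normr; apply/orP; right; lra].
  by exists tau, 1; split=> [|t ?]; [lra|rewrite ltr_normr; apply/orP; left; lra].
exists (Num.sqrt (1 - r ^+ 2))^-1; split; first by rewrite invr_gt0.
  rewrite mulVf ?gt_eqF//; apply: (is_deriv_near mrM) (is_deriv_id r) => t /arc.
  by rewrite /alphax ltNge => /negbTE ->.
have := cos_deriv r1; have -> : - sigma r = (Num.sqrt (1 - r ^+ 2))^-1 * - r.
  by rewrite /sigma; ring.
apply: (is_deriv_near mrM) => t /arc.
by rewrite /alphaz ltNge => /negbTE ->.
Qed.

End Profile.

(** * The arc gamma *)

Section Components.
Context {R : realType}.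
Variables (tau d c : R).
Hypothesis tau01 : 0 < tau <= 1.
Hypothesis d1 : 1 <= d.
Local Notation V := 'rV[R]_3.
Local Notation X := (claspX tau).
Local Notation Z := (claspZ tau).
Local Notation h := (clasp_height tau).
Implicit Types (r t u : R).

Lemma alpha_topE u : alpha_top tau d u = vec3 (alphax tau u) 0 (d / 2 + alphaz tau u).
Proof.
by rewrite /alpha_top /alphax /alphaz; case: ifP => _ //; rewrite -!addrA.
Qed.

(** One formula for the three pieces, from which continuity is read off. *)
Lemma gammaE t : gamma_pos tau d t = vec3 0
  (X (clamp tau t) + Num.sqrt (1 - tau ^+ 2) * (t - clamp tau t))
  (d / 2 + Z (clamp tau t) + tau * `|t - clamp tau t|).
Proof.
have tauH := tau01.
rewrite /gamma_pos; case: ltP => [tN|Nt].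
  rewrite clamp_le ?(ltW tN)//; last by lra.
  rewrite ltr0_norm; last by lra.
  by apply: vec_eq; rewrite !(vec3E, mxE)/=; ring.
case: leP => [tt|tt].
  by rewrite clamp_id ?Nt// subrr normr0 !mulr0 !addr0.
rewrite clamp_ge ?(ltW tt)//; last by lra.
rewrite gtr0_norm ?subr_gt0//.
by apply: vec_eq; rewrite !(vec3E, mxE)/=; ring.
Qed.

(** The length of each straight segment of beta and gamma, which may be 0. *)
Definition straight_length : R :=
  c - (Num.sqrt (1 - tau ^+ 2) * tau + tau * (d / 2 + Z tau)).
Local Notation e := straight_length.

Lemma gamma_hiE : gamma_hi tau d c = tau + e.
Proof.
rewrite /gamma_hi /gamma_curved claspX_tau// dotE !vec3E /straight_length; ring.
Qed.

Lemma gamma_loE : gamma_lo tau d c = - (tau + e).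
Proof.
rewrite /gamma_lo /gamma_curved claspXN claspZN claspX_tau// dotE !vec3E /straight_length.
by ring.
Qed.

Definition gamma_tangent t : V := vec3 0 (ccos tau t) (clamp tau t).

Lemma ccos_sqr k t : 0 <= k <= 1 -> ccos k t * ccos k t = 1 - clamp k t * clamp k t.
Proof.
move=> /andP[k0 k1]; rewrite -expr2 sqr_sqrtr ?expr2//.
by have /andP[? ?] := clamp_itv t k0; nra.
Qed.

Lemma gamma_moves r : r \notin [:: - tau; 0; tau] ->
  moves_along (gamma_pos tau d) gamma_tangent r.
Proof.
have tauH := tau01.
rewrite !inE !negb_or => /and3P[rNt r0 rt].
have [rlt|rge] := ltP r (- tau).
  have rm : r - 1 < r < - tau by lra.
  apply: (moves_along_vec3 (x := fun=> 0)
    (y := fun t => X (- tau) + (- tau - t) * - Num.sqrt (1 - tau ^+ 2))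
    (z := fun t => d / 2 + Z (- tau) + (- tau - t) * tau)
    (l := 1) (a := 0) (b := Num.sqrt (1 - tau ^+ 2)) (c := - tau) ltr01 rm).
  - move=> t /andP[_ tN]; rewrite /gamma_pos tN.
    by apply: vec_eq; rewrite !(vec3E, mxE)/=; ring.
  - by rewrite /gamma_tangent /ccos clamp_le ?(ltW rlt)// ?sqrrN//; lra.
  - by rewrite mulr0; exact: is_deriv_cst.
  - apply: (is_derive_eq (is_deriv_add (is_deriv_cst r (X (- tau)))
      (is_deriv_mul (is_deriv_sub (is_deriv_cst r (- tau)) (is_deriv_id r))
      (is_deriv_cst r (- Num.sqrt (1 - tau ^+ 2)))))).
    by ring.
  - apply: (is_derive_eq (is_deriv_add (is_deriv_cst r (d / 2 + Z (- tau)))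
      (is_deriv_mul (is_deriv_sub (is_deriv_cst r (- tau)) (is_deriv_id r))
      (is_deriv_cst r tau)))).
    by ring.
have [rgt|rle] := ltP tau r.
  have rm : tau < r < r + 1 by lra.
  apply: (moves_along_vec3 (x := fun=> 0)
    (y := fun t => X tau + (t - tau) * Num.sqrt (1 - tau ^+ 2))
    (z := fun t => d / 2 + Z tau + (t - tau) * tau)
    (l := 1) (a := 0) (b := Num.sqrt (1 - tau ^+ 2)) (c := tau) ltr01 rm).
  - move=> t /andP[tt _]; rewrite /gamma_pos ltNge (_ : - tau <= t)/=; last by lra.
    rewrite leNgt tt/=.
    by apply: vec_eq; rewrite !(vec3E, mxE)/=; ring.
  - by rewrite /gamma_tangent /ccos clamp_ge ?(ltW rgt)//; lra.
  - by rewrite mulr0; exact: is_deriv_cst.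
  - apply: (is_derive_eq (is_deriv_add (is_deriv_cst r (X tau))
      (is_deriv_mul (is_deriv_sub (is_deriv_id r) (is_deriv_cst r tau))
      (is_deriv_cst r (Num.sqrt (1 - tau ^+ 2)))))).
    by ring.
  - apply: (is_derive_eq (is_deriv_add (is_deriv_cst r (d / 2 + Z tau))
      (is_deriv_mul (is_deriv_sub (is_deriv_id r) (is_deriv_cst r tau))
      (is_deriv_cst r tau)))).
    by ring.
have rtt : - tau < r < tau by rewrite !lt_neqAle rge rle rt eq_sym rNt.
have [l [l0 dX dZ]] := profile_deriv tau01 r0 rtt.
apply: (moves_along_vec3 (x := fun=> 0) (y := X) (z := fun t => d / 2 + Z t)
    (l := l) (a := 0) (b := Num.sqrt (1 - r ^+ 2)) (c := r) l0 rtt) => //.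
- move=> t /andP[Nt tt]; rewrite /gamma_pos ltNge (ltW Nt)/= (ltW tt).
  by [].
- by rewrite /gamma_tangent /ccos clamp_id//; lra.
- by rewrite mulr0; exact: is_deriv_cst.
- by have := is_deriv_add (is_deriv_cst r (d / 2)) dZ; rewrite add0r.
Qed.

Lemma gamma_frame : 0 <= e ->
  tangent_field (Curve (gamma_lo tau d c) (gamma_hi tau d c) (gamma_pos tau d)) gamma_tangent.
Proof.
have tauH := tau01.
move=> e0.
have ck : continuous (clamp tau) by exact: clamp_continuous.
have cX : continuous (X \o clamp tau).
  by apply: continuous_clamp; [lra|exact: claspX_within_sym].
have cZ : continuous (Z \o clamp tau).
  by apply: continuous_clamp; [lra|exact: claspZ_within_sym].
have cd : continuous (fun t => t - clamp tau t).
  by move=> t; apply: cvgB; [exact: cvg_id|exact: ck].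
split=> /=.
- by rewrite gamma_loE gamma_hiE; lra.
- move=> i; apply: within_itv_cont; move: i; apply: ord3P.
  + by under eq_fun do rewrite gammaE vec3E; exact: cst_continuous.
  + under eq_fun do rewrite gammaE vec3E; move=> t; apply: cvgD; first exact: cX.
    by apply: cvgM; [exact: cvg_cst|exact: cd].
  + under eq_fun do rewrite gammaE vec3E; move=> t; apply: cvgD.
      by apply: cvgD; [exact: cvg_cst|exact: cZ].
    by apply: cvgM; [exact: cvg_cst|apply: cvg_norm; exact: cd].
- apply: ord3P.
  + by under eq_fun do rewrite vec3E; exact: cst_continuous.
  + by under eq_fun do rewrite vec3E; exact: ccos_continuous.
  + by under eq_fun do rewrite vec3E; exact: ck.
- move=> t; rewrite dotE !vec3E ccos_sqr; last by lra.
  by ring.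
- by exists [:: - tau; 0; tau] => r _; exact: gamma_moves.
Qed.

End Components.

(** * The closed curve alpha *)

Section AlphaFrame.
Context {R : realType}.
Variables (tau d c : R).
Hypothesis tau01 : 0 < tau <= 1.
Hypothesis d1 : 1 <= d.
Local Notation V := 'rV[R]_3.
Local Notation X := (claspX tau).
Local Notation Z := (claspZ tau).
Local Notation h := (clasp_height tau).
Implicit Types (r t u : R).

(** On [-1, 3 + d] this exchanges the parameters of points of alpha that are mirror
images of each other. *)
Definition alpha_flip t : R := 2 + d - t.
Local Notation rho := alpha_flip.

Definition alpha_tangent t : V :=
  vec3 (ccos 1 t - ccos 1 (rho t)) 0 (1 - clamp 1 t - clamp 1 (rho t)).

Lemma ccos1_ge t : 1 <= t -> ccos 1 t = 0 :> R.
Proof. by move=> t1; rewrite /ccos clamp_ge// expr1n subrr sqrtr0. Qed.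

Lemma ccos1_le t : t <= -1 -> ccos 1 t = 0 :> R.
Proof. by move=> t1; rewrite -[t]opprK ccosN// ccos1_ge// lerNr. Qed.

Lemma ccos1_id t : -1 <= t <= 1 -> ccos 1 t = Num.sqrt (1 - t ^+ 2) :> R.
Proof. by move=> t1; rewrite /ccos clamp_id. Qed.

(** One formula for the four pieces, from which continuity is read off: each clamp
moves only along one piece, and is constant on the others. *)
Lemma alphaE t : -1 <= t <= 3 + 2 * d -> alpha_pos tau d t = vec3
  (alphax tau (clamp 1 t) + alphax tau (clamp 1 (rho t)) - 1) 0
  (alphaz tau (clamp 1 t) - alphaz tau (clamp 1 (rho t))
   - clamp (d / 2) (t - 1 - d / 2) + (d / 2 + clamp (d / 2) (t - 3 - d - d / 2))).
Proof.
have dH := d1.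
move=> /andP[t1 t2]; rewrite /alpha_pos /alpha_flip.
have x1 := alphax1 tau01; have z1 := alphaz1 tau01.
have [t3|t3] := leP t 1.
  rewrite alpha_topE (@clamp_id _ 1 t) ?t1// (@clamp_ge _ 1 (2 + d - t)); [|lra..].
  rewrite !(@clamp_le _ (d / 2)); [|lra..].
  by rewrite x1 z1; apply: vec_eq; rewrite !vec3E; ring.
rewrite (@clamp_ge _ 1 t)// ?(ltW t3)//.
have [t4|t4] := leP t (1 + d).
  rewrite (@clamp_ge _ 1 (2 + d - t)); [|lra..].
  rewrite (@clamp_le _ (d / 2) (t - 3 - d - d / 2)); [|lra..].
  rewrite (@clamp_id _ (d / 2)); last by lra.
  by rewrite x1 z1; apply: vec_eq; rewrite !vec3E; ring.
rewrite (@clamp_ge _ (d / 2)); [|lra..].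
have [t5|t5] := leP t (3 + d).
  rewrite (@clamp_id _ 1); last by lra.
  rewrite (@clamp_le _ (d / 2) (t - 3 - d - d / 2)); [|lra..].
  by rewrite x1 z1 alpha_topE; apply: vec_eq; rewrite !vec3E; ring.
rewrite (@clamp_le _ 1); [|lra..].
rewrite (@clamp_id _ (d / 2)); last by lra.
rewrite alphaxN alphazN x1 z1; apply: vec_eq; rewrite !vec3E; ring.
Qed.

(** The junctions of the pieces, and the tips of the clasp arcs, where the velocity
may vanish. *)
Definition alpha_breaks : seq R := [:: - tau; 0; tau; 1; 1 + d; rho tau; rho 0; rho (- tau); 3 + d].

Lemma alpha_flip_eq r u : (rho r == u) = (r == rho u).
Proof. by rewrite /alpha_flip; apply/eqP/eqP => E; lra. Qed.

Lemma alpha_moves r : -1 < r < 3 + 2 * d -> r \notin alpha_breaks ->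
  moves_along (alpha_pos tau d) alpha_tangent r.
Proof.
have tauH := tau01; have dH := d1.
move=> r12; rewrite !inE !negb_or.
move=> /and5P[n1 n2 n3 n4] /and5P[n5 n6 n7 n8 n9].
rewrite -alpha_flip_eq in n6; rewrite -alpha_flip_eq in n7; rewrite -alpha_flip_eq in n8.
have [r1|r1] := ltP r 1.
  have rI : -1 < r < 1 by lra.
  have [l [l0 dX dZ]] := alpha_profile_deriv tau01 rI n2 n3 n1.
  apply: (moves_along_vec3 (x := alphax tau) (y := fun=> 0)
    (z := fun t => d / 2 + alphaz tau t)
    (l := l) (a := Num.sqrt (1 - r ^+ 2)) (b := 0) (c := - r) l0 rI) => //.
  - by move=> t /andP[? t1]; rewrite /alpha_pos (ltW t1) alpha_topE.
  - rewrite /alpha_tangent (@ccos1_ge (rho r)) ?(@clamp_ge _ 1 (rho r))//; [|rewrite /alpha_flip; lra..].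
    rewrite ccos1_id ?clamp_id; [|lra..].
    by congr vec3; ring.
  - by rewrite mulr0; exact: is_deriv_cst.
  - by have := is_deriv_add (is_deriv_cst r (d / 2)) dZ; rewrite add0r.
have {}r1 : 1 < r by rewrite lt_neqAle eq_sym n4.
have [r2|r2] := ltP r (1 + d).
  have rI : 1 < r < 1 + d by lra.
  apply: (moves_along_vec3 (x := fun=> 1) (y := fun=> 0)
    (z := fun t => d / 2 - (t - 1))
    (l := 1) (a := 0) (b := 0) (c := - 1) ltr01 rI) => //.
  - by move=> t /andP[t1 t2]; rewrite /alpha_pos leNgt t1/= (ltW t2).
  - rewrite /alpha_tangent !ccos1_ge ?clamp_ge//; [|rewrite /alpha_flip; lra..].
    by congr vec3; ring.
  - by rewrite mulr0; exact: is_deriv_cst.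
  - by rewrite mulr0; exact: is_deriv_cst.
  - apply: (is_derive_eq (is_deriv_sub (is_deriv_cst r (d / 2))
      (is_deriv_sub (is_deriv_id r) (is_deriv_cst r 1)))); ring.
have {}r2 : 1 + d < r by rewrite lt_neqAle eq_sym n5.
have [r3|r3] := ltP r (3 + d).
  have uI : -1 < rho r < 1 by rewrite /alpha_flip; lra.
  have rI : 1 + d < r < 3 + d by lra.
  have [l [l0 dX dZ]] := alpha_profile_deriv tau01 uI n7 n6 n8.
  apply: (moves_along_vec3 (x := fun t => alphax tau (rho t)) (y := fun=> 0)
    (z := fun t => - (d / 2 + alphaz tau (rho t)))
    (l := l) (a := - Num.sqrt (1 - (rho r) ^+ 2)) (b := 0) (c := - rho r) l0 rI) => //.
  - move=> t /andP[t1 t2]; rewrite /alpha_pos.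
    rewrite leNgt (_ : 1 < t)/=; last by lra.
    rewrite leNgt t1/= (ltW t2) alpha_topE.
    by apply: vec_eq; rewrite !vec3E.
  - rewrite /alpha_tangent (@ccos1_ge r) ?(@clamp_ge _ 1 r)//; [|lra..].
    rewrite ccos1_id ?(@clamp_id _ 1 (rho r)); [|lra..].
    by congr vec3; ring.
  - by rewrite mulrN; exact: is_deriv_reflect.
  - by rewrite mulr0; exact: is_deriv_cst.
  - have := is_deriv_opp (is_deriv_add (is_deriv_cst r (d / 2)) (is_deriv_reflect dZ)).
    by rewrite add0r opprK.
have {}r3 : 3 + d < r by rewrite lt_neqAle eq_sym n9.
have rI : 3 + d < r < r + 1 by lra.
apply: (moves_along_vec3 (x := fun=> -1) (y := fun=> 0)
    (z := fun t => - (d / 2) + (t - (3 + d)))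
    (l := 1) (a := 0) (b := 0) (c := 1) ltr01 rI) => //.
- move=> t /andP[t1 t2]; rewrite /alpha_pos.
  have ta : 1 < t by lra.
  have tb : 1 + d < t by lra.
  by rewrite !leNgt ta tb t1.
- rewrite /alpha_tangent (@ccos1_ge r) ?(@ccos1_le (rho r)); [|rewrite ?/alpha_flip; lra..].
  rewrite (@clamp_ge _ 1 r) ?(@clamp_le _ 1 (rho r)); [|rewrite ?/alpha_flip; lra..].
  by congr vec3; ring.
- by rewrite mulr0; exact: is_deriv_cst.
- by rewrite mulr0; exact: is_deriv_cst.
- apply: (is_derive_eq (is_deriv_add (is_deriv_cst r (- (d / 2)))
      (is_deriv_sub (is_deriv_id r) (is_deriv_cst r (3 + d))))); ring.
Qed.

Lemma alpha_flip_continuous : continuous rho.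
Proof. by move=> t; apply: cvgB; [exact: cvg_cst|exact: cvg_id]. Qed.

Lemma continuous_flip (f : R -> R) : continuous f -> continuous (fun t => f (rho t)).
Proof.
move=> cf t; apply: (@continuous_comp _ _ _ rho f); first exact: alpha_flip_continuous.
exact: cf.
Qed.

Lemma alpha_frame :
  tangent_field (Curve (-1) (3 + 2 * d) (alpha_pos tau d)) alpha_tangent.
Proof.
have tauH := tau01; have dH := d1.
have cx : continuous (alphax tau \o clamp 1) by apply: continuous_clamp => //; exact: alphax_within.
have cz : continuous (alphaz tau \o clamp 1) by apply: continuous_clamp => //; exact: alphaz_within.
have ck (k a : R) : continuous (fun t => clamp k (t - a)).
  move=> t; apply: (@continuous_comp _ _ _ (fun t => t - a) (clamp k)); last exact: clamp_continuous.
  by apply: cvgB; [exact: cvg_id|exact: cvg_cst].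
split=> /=.
- by lra.
- apply: ord3P.
  + apply: (@within_itv_eq _ (fun t => (alphax tau \o clamp 1) t + (alphax tau \o clamp 1) (rho t) - 1)).
      by move=> t /alphaE ->; rewrite vec3E.
    apply: within_itvB; last exact: within_itv_cst.
    by apply: within_itvD; apply: within_itv_cont => //; exact: continuous_flip.
  + apply: (@within_itv_eq _ (fun=> 0)); last exact: within_itv_cst.
    by move=> t /alphaE ->; rewrite vec3E.
  + apply: (@within_itv_eq _ (fun t => (alphaz tau \o clamp 1) t - (alphaz tau \o clamp 1) (rho t)
      - clamp (d / 2) (t - (1 + d / 2)) + (d / 2 + clamp (d / 2) (t - (3 + d + d / 2))))).
      move=> t /alphaE ->; rewrite vec3E /=; congr (_ - clamp _ _ + (_ + clamp _ _)); ring.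
    apply: within_itvD; last first.
      by apply: within_itvD; [exact: within_itv_cst|apply: within_itv_cont; exact: ck].
    apply: within_itvB; last by apply: within_itv_cont; exact: ck.
    by apply: within_itvB; apply: within_itv_cont => //; exact: continuous_flip.
- apply: ord3P.
  + under eq_fun do rewrite vec3E.
    by move=> t; apply: cvgB; [exact: ccos_continuous|apply: continuous_flip; exact: ccos_continuous].
  + by under eq_fun do rewrite vec3E; exact: cst_continuous.
  + under eq_fun do rewrite vec3E; move=> t; apply: cvgB.
      by apply: cvgB; [exact: cvg_cst|exact: clamp_continuous].
    by apply: continuous_flip; exact: clamp_continuous.
- move=> t; rewrite dotE !vec3E.
  have [t1|t1] := leP t 1.
    rewrite (@ccos1_ge (rho t)) ?(@clamp_ge _ 1 (rho t))//; [|rewrite /alpha_flip; lra..].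
    have E : ccos 1 t * ccos 1 t = 1 - clamp 1 t * clamp 1 t by apply: ccos_sqr; lra.
    by rewrite subr0 E; ring.
  rewrite (@ccos1_ge t) ?(@clamp_ge _ 1 t) ?(ltW t1)//.
  have E : ccos 1 (rho t) * ccos 1 (rho t) = 1 - clamp 1 (rho t) * clamp 1 (rho t).
    by apply: ccos_sqr; lra.
  by rewrite sub0r mulrNN E; ring.
- by exists alpha_breaks; exact: alpha_moves.
Qed.

Lemma alpha_tangent_closed : alpha_tangent (-1) = alpha_tangent (3 + 2 * d).
Proof.
have dH := d1.
rewrite /alpha_tangent /alpha_flip.
rewrite (@ccos1_le (-1))// (@ccos1_ge (2 + d - -1)) ?(@ccos1_ge (3 + 2 * d)); [|lra..].
rewrite (@ccos1_le (2 + d - (3 + 2 * d))); last by lra.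
rewrite (@clamp_le _ 1 (-1))// ?(@clamp_ge _ 1 (2 + d - -1)) ?(@clamp_ge _ 1 (3 + 2 * d)); [|lra..].
rewrite (@clamp_le _ 1 (2 + d - (3 + 2 * d))); [|lra..].
by congr vec3; ring.
Qed.

Lemma alpha_closed : alpha_pos tau d (-1) = alpha_pos tau d (3 + 2 * d).
Proof.
have dH := d1.
rewrite !alphaE; [|lra..].
rewrite /alpha_flip (@clamp_le _ 1 (-1))// (@clamp_ge _ 1 (2 + d - -1)) ?(@clamp_ge _ 1 (3 + 2 * d)); [|lra..].
rewrite (@clamp_le _ 1 (2 + d - (3 + 2 * d))); [|lra..].
rewrite (@clamp_le _ (d / 2) (-1 - 1 - d / 2)) ?(@clamp_le _ (d / 2) (-1 - 3 - d - d / 2)); [|lra..].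
rewrite (@clamp_ge _ (d / 2) (3 + 2 * d - 1 - d / 2)) ?(@clamp_ge _ (d / 2) (3 + 2 * d - 3 - d - d / 2)); [|lra..].
rewrite !alphaxN !alphazN; apply: vec_eq; rewrite !vec3E; ring.
Qed.

Lemma alpha_component_wf : component_wf (alpha tau d).
Proof.
split; last exact: alpha_closed.
apply: (tangent_field_wf (K := alpha tau d) alpha_frame); first exact: alpha_tangent_closed.
apply: ord3P => /=; under eq_fun do rewrite vec3E; apply: variation_majorized_bv.
- apply: variation_majorizedB; first by apply: ccos_majorized; lra.
  by apply: variation_majorized_reflect; apply: ccos_majorized; lra.
- exact: cst_majorized.
- apply: variation_majorizedB; first apply: variation_majorizedB.
  + exact: cst_majorized.
  + exact: clamp_majorized.
  + by apply: variation_majorized_reflect; exact: clamp_majorized.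
Qed.

End AlphaFrame.

(** * Constraint planes and walls *)

Section Link.
Context {R : realType}.
Local Notation V := 'rV[R]_3.

Lemma plane_affine (c : R) (m : V) : dot m m = 1 -> affine_subspace (plane c m).
Proof.
move=> m1; exists (c *: m), (kermx m^T).
have mulE (v : V) : (v *m m^T == 0) = (dot m v == 0).
  have -> : v *m m^T = (dot m v)%:M.
    apply/matrixP => i j; rewrite !ord1 !mxE mulr1n /dot.
    by apply: eq_bigr => k _; rewrite !mxE mulrC.
  by apply/eqP/eqP => [/matrixP/(_ 0 0)|->]; rewrite ?mxE ?mulr1n//; apply/matrixP=> i j; rewrite !mxE mul0rn.
apply/seteqP; split=> q /=; rewrite /plane /= sub_kermx mulE dotBr [dot m (c *: m)]dotC dotZl m1 mulr1.
  by move=> ->; rewrite subrr.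
by rewrite subr_eq0 => /eqP.
Qed.

Lemma plane_tangent (c : R) (m x w : V) : plane c m x -> tangent_to (plane c m) x w ->
  dot m w = 0.
Proof.
rewrite /tangent_to /plane /= dotDr => -> /eqP.
by rewrite -subr_eq0 addrAC subrr add0r => /eqP.
Qed.

Lemma wall_differentiable (c : R) (m p : V) : differentiable (fun q => c - dot m q) p.
Proof.
apply: differentiableB; first exact: differentiable_cst.
rewrite (_ : dot m = (fun q : V => m 0 0 * q 0 0) + (fun q => m 0 1 * q 0 1) +
  (fun q => m 0 2 * q 0 2)); last by apply/funext => q; rewrite dotE.
have dc i : differentiable (fun q : V => m 0 i * q 0 i) p.
  by apply: differentiableM; [exact: differentiable_cst|exact: differentiable_coord].
by apply: differentiableD; [apply: differentiableD|].
Qed.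

Lemma wall_grad (c : R) (m p : V) : grad (fun q => c - dot m q) p = - m.
Proof.
apply/rowP => i; rewrite !mxE.
apply: derive_val; apply: DeriveDef; first exact/diff_derivable/wall_differentiable.
rewrite /derive; apply: cvg_lim; first exact: Rhausdorff.
apply: cvg_near_cst; near=> k.
have k0 : k != 0 by near: k; exact: nbhs_dnbhs_neq.
rewrite /= dotDr [dot m (k *: _)]dotC dotZl dot_delta.
rewrite -[_ *: _]/(_ * _).
have -> : c - (k * m 0 i + dot m p) - (c - dot m p) = - (k * m 0 i) by ring.
by field.
Unshelve. all: by end_near. Qed.

Lemma wall_wf (c : R) (m : V) : dot m m = 1 -> obstacle_wf (fun q => c - dot m q).
Proof.
move=> m1; split.
- by move=> p; exact: wall_differentiable.
- by rewrite (_ : grad _ = cst (- m)); [exact: cst_continuous|apply/funext => p; exact: wall_grad].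
- move=> p _; rewrite wall_grad oppr_eq0; apply/eqP => m0.
  by move: m1; rewrite m0 dotE !mxE; lra.
Qed.

End Link.

(** * Distances between the components *)

Section Distances.
Context {R : realType}.
Variables (tau d c : R).
Hypothesis tau01 : 0 < tau <= 1.
Hypothesis d1 : 1 <= d.
Local Notation V := 'rV[R]_3.
Local Notation X := (claspX tau).
Local Notation Z := (claspZ tau).
Local Notation h := (clasp_height tau).
Local Notation q := (Num.sqrt (1 - tau ^+ 2)).
Local Notation rho := (alpha_flip d).
Implicit Types (r s t u : R) (v w : V).

Lemma cos_tau_sqr : q * q = 1 - tau * tau.
Proof.
have [t0 t1] := andP tau01.
by rewrite -expr2 sqr_sqrtr ?expr2//; nra.
Qed.

Lemma alphaz_bounds u : 0 <= u <= 1 -> 0 <= alphaz tau u <= h.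
Proof.
have tauH := tau01; have q0 : 0 <= q by exact: sqrtr_ge0.
move=> u01; have [ut|tu] := leP u tau.
  rewrite alphaz_clasp; last by lra.
  have : Z u <= h by apply: claspZ_le_height => //; lra.
  have : 0 <= Z u by apply: claspZ_ge0 => //; lra.
  by lra.
rewrite alphaz_arc ?(ltW tu)// sqrtr_ge0/=.
have : 0 <= Z tau by apply: claspZ_ge0 => //; lra.
have : Num.sqrt (1 - u ^+ 2) <= q.
  by apply: ler_wsqrtr; have [t0 _] := andP tauH; rewrite lerD2l lerN2 lerXn2r ?nnegrE; lra.
by rewrite /clasp_height; lra.
Qed.

(** On a circular arc of alpha the squared distance is 1 + X^2 + Z^2 - 2 b Z, where
b is the height above the tip of gamma; this decreases with b, so it is least
at the end of the clasp arc, where clasp_distance applies. *)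
Lemma clasp_alpha_distance k u : 0 <= k <= tau -> 0 <= u <= 1 ->
  1 <= alphax tau u * alphax tau u + X k * X k + (Z k - alphaz tau u) * (Z k - alphaz tau u).
Proof.
have tauH := tau01.
move=> kt u01; have [ut|tu] := leP u tau.
  rewrite alphax_clasp ?alphaz_clasp; [|lra..].
  have := clasp_distance tau01 kt (v := u).
  have -> : (Z k - (h - Z u)) * (Z k - (h - Z u)) = (h - Z k - Z u) * (h - Z k - Z u) by ring.
  by rewrite [X k * X k + _]addrC; apply; lra.
rewrite alphax_arc ?alphaz_arc ?(ltW tu)//.
have Z0 := claspZ_ge0 tau01 kt.
have u2 : Num.sqrt (1 - u ^+ 2) * Num.sqrt (1 - u ^+ 2) = 1 - u * u.
  by have [u0 u1] := andP u01; rewrite -expr2 sqr_sqrtr ?expr2//; nra.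
have bq : Num.sqrt (1 - u ^+ 2) <= q.
  by apply: ler_wsqrtr; have [t0 _] := andP tauH; rewrite lerD2l lerN2 lerXn2r ?nnegrE; lra.
have := clasp_distance tau01 kt (v := tau); have q2 := cos_tau_sqr.
rewrite claspX_tau//.
have -> : h - Z k - Z tau = q - Z k by rewrite /clasp_height; ring.
set b := Num.sqrt _ in u2 bq *; set s := q in q2 bq *.
move=> /(_ ltac:(lra)) H.
have : b * Z k <= s * Z k by rewrite ler_wpM2r.
by nra.
Qed.

(** Moving out along a straight segment by e adds e^2 plus twice e times the
component of the strut along the segment, and this component is nonnegative
because alpha stays below height h. *)
Lemma gamma_alpha_distance k e u : 0 <= k <= tau -> 0 <= e -> (0 < e -> k = tau) ->
  0 <= u <= 1 -> 1 <= alphax tau u * alphax tau u + (X k + q * e) * (X k + q * e) +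
    (Z k + tau * e - alphaz tau u) * (Z k + tau * e - alphaz tau u).
Proof.
have tauH := tau01.
move=> kt e0 ek u01; have H := clasp_alpha_distance kt u01.
have [e00|e00] := eqVneq e 0; first by rewrite e00 !mulr0 !addr0.
have kE : k = tau by apply: ek; rewrite lt_neqAle eq_sym e00.
rewrite kE claspX_tau// in H *.
have [_ Bh] := andP (alphaz_bounds u01); rewrite /clasp_height in Bh.
have q2 := cos_tau_sqr.
set s := q in q2 Bh *; set B := alphaz tau u in H Bh *; set A := alphax tau u in H *.
have -> : A * A + (tau + s * e) * (tau + s * e) +
  (Z tau + tau * e - B) * (Z tau + tau * e - B) =
  (A * A + tau * tau + (Z tau - B) * (Z tau - B)) + 2 * (e * (tau * (Z tau + s - B)))
   + (s * s + tau * tau) * (e * e) by ring.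
have t1 : 0 <= e * (tau * (Z tau + s - B)) by do ?apply: mulr_ge0; lra.
have t2 : 0 <= (s * s + tau * tau) * (e * e) by rewrite q2 subrK mul1r mulr_ge0.
lra.
Qed.

Local Notation gam := (gamma_pos tau d).

Lemma gamma_alpha_top s u : -1 <= u <= 1 ->
  1 <= dot (gam s - alpha_top tau d u) (gam s - alpha_top tau d u).
Proof.
have tauH := tau01.
move=> u1; rewrite gammaE// alpha_topE dotE !mxE/= !sub0r.
rewrite !mulrNN !subr0.
set k := clamp tau s; set e := s - k.
have -> : d / 2 + Z k + tau * `|e| - (d / 2 + alphaz tau u) = Z k + tau * `|e| - alphaz tau u.
  by ring.
have Eu : alphax tau u * alphax tau u = alphax tau `|u| * alphax tau `|u| /\
    alphaz tau u = alphaz tau `|u|.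
  by have [u0|u0] := ger0P u; rewrite ?alphaxN ?alphazN ?mulrNN; split.
have [-> ->] := Eu.
have Ek : (X k + q * e) * (X k + q * e) = (X `|k| + q * `|e|) * (X `|k| + q * `|e|) /\ Z k = Z `|k|.
  have [s0|s0] := leP 0 s.
    have k0 : 0 <= k by rewrite -[0](@clamp_id _ tau 0); [exact: clamp_homo|lra].
    rewrite !ger0_norm//= subr_ge0.
    by have [st|/ltW st] := leP s tau; rewrite /k ?(clamp_ge _ st) ?clamp_id//; lra.
  have k0 : k <= 0 by rewrite -[0](@clamp_id _ tau 0); [apply: clamp_homo; exact: ltW|lra].
  rewrite !ler0_norm//= ?subr_le0; last first.
    by have [st|/ltW st] := leP (- tau) s; rewrite /k ?(clamp_le _ st) ?clamp_id//; lra.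
  by rewrite claspXN claspZN; split=> //; ring.
have [-> ->] := Ek.
apply: gamma_alpha_distance => //.
- by rewrite normr_ge0 ler_norml; apply: clamp_itv; lra.
- rewrite normr_gt0 subr_eq0 => sk.
  have [st|/ltW st] := leP s (- tau); first by rewrite /k clamp_le ?normrN ?gtr0_norm//; lra.
  have [ts|/ltW ts] := leP tau s; first by rewrite /k clamp_ge ?gtr0_norm//; lra.
  by move: sk; rewrite /k clamp_id ?st ?ts// eqxx.
- by rewrite normr_ge0 ler_norml.
Qed.

Lemma gamma_height s : d / 2 <= gam s 0 2.
Proof.
have tauH := tau01.
rewrite gammaE// vec3E -addrA lerDl addr_ge0//; last by rewrite mulr_ge0//; lra.
have : -tau <= clamp tau s <= tau by apply: clamp_itv; lra.
move: (clamp tau s) => k kt; have [k0|k0] := leP 0 k; first by apply: claspZ_ge0 => //; lra.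
by rewrite -claspZN; apply: claspZ_ge0 => //; lra.
Qed.

Lemma alpha_top_height u : -1 <= u <= 1 -> d / 2 <= alpha_top tau d u 0 2.
Proof.
move=> u1; rewrite alpha_topE vec3E lerDl.
have [u0|u0] := leP 0 u; first by have /andP[] := @alphaz_bounds u ltac:(lra).
by rewrite -alphazN; have /andP[] := @alphaz_bounds (- u) ltac:(lra).
Qed.

(** Both points lie above the plane z = 0, so reflecting one of them increases the
distance. *)
Lemma gamma_mirror_alpha_top s u : -1 <= u <= 1 ->
  1 <= dot (gam s - mirror (alpha_top tau d u)) (gam s - mirror (alpha_top tau d u)).
Proof.
have dH := d1.
move=> u1; apply: le_trans (gamma_alpha_top s u1) _.
have g0 := gamma_height s; have a0 := alpha_top_height u1.
move: (gam s) (alpha_top tau d u) g0 a0 => g a g0 a0.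
rewrite !dotE !mxE/= !lerD2l.
set x := g 0 2 in g0 *; set y := a 0 2 in a0 *; nra.
Qed.

Lemma gamma_vertical s v : v 0 0 = 1 \/ v 0 0 = -1 -> 1 <= dot (gam s - v) (gam s - v).
Proof.
move=> v1; rewrite dotE.
have -> : (gam s - v) 0 0 = - v 0 0 by rewrite gammaE// !mxE sub0r.
have -> : - v 0 0 * - v 0 0 = 1 by case: v1 => ->; ring.
by rewrite -addrA lerDl -!expr2 addr_ge0// sqr_ge0.
Qed.

Lemma alpha_cases t : -1 <= t <= 3 + 2 * d ->
  [\/ exists2 u, -1 <= u <= 1 & alpha_pos tau d t = alpha_top tau d u,
      exists2 u, -1 <= u <= 1 & alpha_pos tau d t = mirror (alpha_top tau d u) |
      alpha_pos tau d t 0 0 = 1 \/ alpha_pos tau d t 0 0 = -1].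
Proof.
move=> t12; rewrite /alpha_pos.
case: leP => [t1|t1]; first by constructor 1; exists t => //; lra.
case: leP => [t2|t2]; first by constructor 3; left; rewrite vec3E.
case: leP => [t3|t3]; first by constructor 2; exists (2 + d - t) => //; lra.
by constructor 3; right; rewrite vec3E.
Qed.

Lemma gamma_alpha_far s t : -1 <= t <= 3 + 2 * d ->
  1 <= dot (gam s - alpha_pos tau d t) (gam s - alpha_pos tau d t).
Proof.
move=> /alpha_cases[[u u1 ->]|[u u1 ->]|v1].
- exact: gamma_alpha_top.
- exact: gamma_mirror_alpha_top.
- exact: gamma_vertical.
Qed.

Lemma dot_mirror_sub v w : dot (mirror v - w) (mirror v - w) = dot (v - mirror w) (v - mirror w).
Proof. by rewrite !dotE !mxE/=; ring. Qed.

Lemma beta_alpha_far s t : -1 <= t <= 3 + 2 * d ->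
  1 <= dot (mirror (gam s) - alpha_pos tau d t) (mirror (gam s) - alpha_pos tau d t).
Proof.
move=> /alpha_cases[[u u1 ->]|[u u1 ->]|v1]; rewrite dot_mirror_sub.
- exact: gamma_mirror_alpha_top.
- by rewrite mirrorK; exact: gamma_alpha_top.
- by apply: gamma_vertical; rewrite vec3E.
Qed.

Lemma gamma_beta_far s t : 1 <= dot (gam s - mirror (gam t)) (gam s - mirror (gam t)).
Proof.
have dH := d1.
have g1 := gamma_height s; have g2 := gamma_height t.
move: (gam s) (gam t) g1 g2 => g g' g1 g2.
rewrite dotE !mxE/=; set x := g 0 2 in g1 *; set y := g' 0 2 in g2 *.
have : 1 <= (x - - y) * (x - - y) by nra.
by have := sqr_ge0 (g 0 0 - g' 0 0); have := sqr_ge0 (g 0 1 - g' 0 1); rewrite !expr2; lra.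
Qed.

End Distances.

(** * The chained clasp as a generalized link, and its struts *)

Section ChainedLink.
Context {R : realType}.
Variables (tau d c : R).
Hypothesis tau01 : 0 < tau <= 1.
Hypothesis d1 : 1 <= d.
Local Notation V := 'rV[R]_3.
Local Notation X := (claspX tau).
Local Notation Z := (claspZ tau).
Local Notation h := (clasp_height tau).
Local Notation L := (chained_clasp tau d c).
Local Notation rho := (alpha_flip d).
Implicit Types (r s t u : R).

(** At the top point of alpha the wall function is exactly the length of the
straight segments. *)
Lemma straight_length_ge0 : avoids_obstacles L -> 0 <= straight_length tau d c.
Proof.
have tauH := tau01; have dH := d1.
move=> /(_ (0 : 'I_3) 0); rewrite /dom /at_par /= in_itv/= => H.
have := H ltac:(lra) (0 : 'I_4); rewrite /= /alpha_pos ler01.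
rewrite /alpha_top normr0 (_ : 0 <= tau); last by lra.
rewrite dotE !vec3E claspX0 claspZ0 /straight_length /clasp_height /=.
by congr (_ <= _); ring.
Qed.

Lemma m_unit (s : R) (b : bool) : (s == 1) || (s == -1) ->
  dot (vec3 0 (s * Num.sqrt (1 - tau ^+ 2)) ((-1) ^+ b * tau))
      (vec3 0 (s * Num.sqrt (1 - tau ^+ 2)) ((-1) ^+ b * tau)) = 1.
Proof.
move=> s1; rewrite dotE !vec3E.
have s2 : s * s = 1 by case/orP: s1 => /eqP ->; ring.
have q2 := cos_tau_sqr tau01.
have -> : s * Num.sqrt (1 - tau ^+ 2) * (s * Num.sqrt (1 - tau ^+ 2)) =
  (s * s) * (Num.sqrt (1 - tau ^+ 2) * Num.sqrt (1 - tau ^+ 2)) by ring.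
by rewrite s2 q2; case: b; rewrite ?expr1 ?expr0; ring.
Qed.

Lemma m_plus_unit : dot (m_plus tau) (m_plus tau) = 1.
Proof. by have := @m_unit 1 false; rewrite eqxx !mul1r; exact. Qed.
Lemma m_minus_unit : dot (m_minus tau) (m_minus tau) = 1.
Proof. by have := @m_unit (-1) false; rewrite eqxx orbT mulN1r mul1r; exact. Qed.
Lemma m'_plus_unit : dot (m'_plus tau) (m'_plus tau) = 1.
Proof. by have := @m_unit 1 true; rewrite eqxx mul1r mulN1r; exact. Qed.
Lemma m'_minus_unit : dot (m'_minus tau) (m'_minus tau) = 1.
Proof. by have := @m_unit (-1) true; rewrite eqxx orbT !mulN1r; exact. Qed.

Local Notation q := (Num.sqrt (1 - tau ^+ 2)).
Local Notation e := (straight_length tau d c).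

Lemma gamma_end : 0 <= e -> gamma_pos tau d (tau + e) =
  vec3 0 (tau + q * e) (d / 2 + Z tau + tau * e).
Proof.
have tauH := tau01.
move=> e0; rewrite gammaE// clamp_ge; [|lra..].
by rewrite (_ : tau + e - tau = e) ?ger0_norm ?claspX_tau//; ring.
Qed.

Lemma gamma_start : 0 <= e -> gamma_pos tau d (- (tau + e)) =
  vec3 0 (- (tau + q * e)) (d / 2 + Z tau + tau * e).
Proof.
have tauH := tau01.
move=> e0; rewrite gammaE// clamp_le; [|lra..].
rewrite (_ : - (tau + e) - - tau = - e); last by ring.
rewrite normrN ger0_norm// claspXN claspZN claspX_tau//.
by congr vec3; ring.
Qed.

Lemma straight_lengthE : q * (tau + q * e) + tau * (d / 2 + Z tau + tau * e) = c.
Proof.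
have -> : q * (tau + q * e) + tau * (d / 2 + Z tau + tau * e) =
  q * tau + tau * (d / 2 + Z tau) + (q * q + tau * tau) * e by ring.
by rewrite cos_tau_sqr// /straight_length; ring.
Qed.

Lemma gamma_component_wf : 0 <= e -> component_wf (gamma tau d c).
Proof.
have tauH := tau01.
move=> e0; have eE := straight_lengthE; split.
  apply: (tangent_field_wf (K := gamma tau d c) (gamma_frame tau01 e0)) => //.
  apply: ord3P => /=; under eq_fun do rewrite vec3E; apply: variation_majorized_bv.
  - exact: cst_majorized.
  - by apply: ccos_majorized; lra.
  - exact: clamp_majorized.
split=> /=; rewrite ?gamma_loE// ?gamma_hiE// /plane /=.
- exact/plane_affine/m_minus_unit.
- exact/plane_affine/m_plus_unit.
- by rewrite gamma_start// dotE !vec3E -[RHS]eE; ring.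
- by rewrite gamma_end// dotE !vec3E -[RHS]eE; ring.
Qed.

Lemma beta_component_wf : 0 <= e -> component_wf (beta tau d c).
Proof.
have tauH := tau01.
move=> e0; have eE := straight_lengthE; split.
  apply: (tangent_field_wf (K := beta tau d c) (tangent_field_mirror (gamma_frame tau01 e0))) => //.
  apply: ord3P => /=; under eq_fun do rewrite !vec3E; apply: variation_majorized_bv.
  - exact: cst_majorized.
  - by apply: ccos_majorized; lra.
  - rewrite (_ : (fun x => _) = (fun x => 0 - clamp tau x)); last first.
      by apply/funext => x; rewrite sub0r.
    by apply: variation_majorizedB; [exact: cst_majorized|exact: clamp_majorized].
split=> /=; rewrite ?gamma_loE// ?gamma_hiE// /plane /=.
- exact/plane_affine/m'_minus_unit.
- exact/plane_affine/m'_plus_unit.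
- by rewrite gamma_start// dotE !vec3E -[RHS]eE; ring.
- by rewrite gamma_end// dotE !vec3E -[RHS]eE; ring.
Qed.

Lemma dot_sub_sym (v w : V) : dot (v - w) (v - w) = dot (w - v) (w - v).
Proof. by rewrite !dotE !mxE; ring. Qed.

(** Everything is reduced by the mirror symmetry to the distance from gamma to the
upper part of alpha; the vertical segments of alpha are at distance at least 1
from the plane x_1 = 0, and beta and gamma are separated by the slab of width
d between their tips. *)
Lemma components_far (i j : 'I_(ncomp L)) s t : i != j ->
  dom (Defs.comp i) s -> dom (Defs.comp j) t ->
  1 <= dot (at_par (Defs.comp i) s - at_par (Defs.comp j) t) (at_par (Defs.comp i) s - at_par (Defs.comp j) t).
Proof.
move: i j; apply: ord3P; apply: ord3P; rewrite ?eqxx// => _; rewrite /dom /= !in_itv/= => sd td;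
  rewrite /at_par /=.
- by rewrite dot_sub_sym; exact: beta_alpha_far.
- by rewrite dot_sub_sym; exact: gamma_alpha_far.
- exact: beta_alpha_far.
- by rewrite dot_sub_sym; exact: gamma_beta_far.
- exact: gamma_alpha_far.
- exact: gamma_beta_far.
Qed.

Lemma chained_clasp_link : avoids_obstacles L -> generalized_link L.
Proof.
move=> hc; have e0 := straight_length_ge0 hc; split=> //.
- apply: ord3P; [exact: alpha_component_wf|exact: beta_component_wf|exact: gamma_component_wf].
- move=> i j ij s t si tj; apply/eqP => E.
  have := components_far ij si tj; rewrite E subrr dotE !mxE; lra.
- move=> j; apply: wall_wf; case: j => [[|[|[|[|//]]]] jp] /=.
  + exact: m_plus_unit.
  + exact: m_minus_unit.
  + exact: m'_plus_unit.
  + exact: m'_minus_unit.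
Qed.

(** The third coordinate is strut_height; its size is the same seen from either end. *)
Lemma clasp_strut s t : `|s| + `|t| = tau ->
  gamma_pos tau d s - alpha_top tau d t = vec3 (- X t) (X s) (- clasp_gap tau `|s|).
Proof.
have tauH := tau01.
move=> st; have s0 := normr_ge0 s; have t0 := normr_ge0 t.
have sI : - tau <= s <= tau by rewrite -ler_norml; lra.
have tI : - tau <= t <= tau by rewrite -ler_norml; lra.
have ZE u : Z `|u| = Z u by have [|] := ger0P u; rewrite ?claspZN.
have tE : tau - `|s| = `|t| by lra.
have := strut_height tau01 (x := `|s|) ltac:(lra); rewrite tE (ZE s) (ZE t).
move=> hE; rewrite gammaE// alpha_topE alphax_clasp// alphaz_clasp// clamp_id// subrr normr0.
by apply: vec_eq; rewrite !mxE/= -?hE; ring.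
Qed.

Lemma clasp_strut_unit s t : `|s| + `|t| = tau ->
  dot (vec3 (- X t) (X s) (- clasp_gap tau `|s|)) (vec3 (- X t) (X s) (- clasp_gap tau `|s|)) = 1.
Proof.
have tauH := tau01.
move=> st; have s0 := normr_ge0 s; have t0 := normr_ge0 t.
have XE u : X u * X u = X `|u| * X `|u| by have [|] := ger0P u; rewrite ?claspXN ?mulrNN.
rewrite dotE !vec3E !mulrNN (XE t) (XE s) -[RHS](clasp_gap_sqr tau01 (x := `|s|)); last by lra.
by rewrite (_ : tau - `|s| = `|t|); [ring|lra].
Qed.

(** The circular arcs of alpha are centred at the tip of gamma. *)
Lemma tip_strut t : tau <= `|t| <= 1 ->
  gamma_pos tau d 0 - alpha_top tau d t = vec3 (- t) 0 (- Num.sqrt (1 - t ^+ 2)).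
Proof.
have tauH := tau01.
move=> t1; rewrite gammaE// alpha_topE clamp_id ?subrr ?normr0; last by lra.
have [tt1 _] := andP t1.
move: tt1; rewrite ler_normr => tt1.
have -> : alphax tau t = t.
  case/orP: tt1 => ?; first exact: alphax_arc.
  by apply: oppr_inj; rewrite -alphaxN alphax_arc.
have -> : alphaz tau t = Num.sqrt (1 - t ^+ 2).
  by case/orP: tt1 => ?; [|rewrite -alphazN -(sqrrN t)]; rewrite alphaz_arc.
by rewrite claspX0 claspZ0; apply: vec_eq; rewrite !mxE/=; ring.
Qed.

Lemma tip_strut_unit t : `|t| <= 1 ->
  dot (vec3 (- t) 0 (- Num.sqrt (1 - t ^+ 2))) (vec3 (- t) 0 (- Num.sqrt (1 - t ^+ 2))) = 1.
Proof.
rewrite ler_norml => /andP[t1 t2].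
rewrite dotE !vec3E !mulrNN -[Num.sqrt _ * _]expr2 sqr_sqrtr; first by ring.
by nra.
Qed.

Lemma alpha_pos_top t : -1 <= t <= 1 -> alpha_pos tau d t = alpha_top tau d t.
Proof. by move=> /andP[_ t1]; rewrite /alpha_pos t1. Qed.

Lemma alpha_pos_bottom t : -1 <= t <= 1 -> alpha_pos tau d (rho t) = mirror (alpha_top tau d t).
Proof.
have dH := d1.
move=> t1; rewrite /alpha_pos /alpha_flip; case: leP => [?|_]; first by exfalso; lra.
case: leP => [t2|_].
  have -> : t = 1 by lra.
  rewrite alpha_topE alphax1// alphaz1//; apply: vec_eq; rewrite !vec3E; lra.
by case: leP => [_|?]; [congr (mirror (alpha_top _ _ _)); ring|exfalso; lra].
Qed.

Lemma GThi_chained : 0 <= e -> GThi L = 1%:E.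
Proof.
have tauH := tau01; have dH := d1.
move=> e0; apply/eqP; rewrite eq_le; apply/andP; split.
  apply: ereal_inf_lbound; exists (2 : 'I_3), (0 : 'I_3), 0, tau.
  have st : `|0 : R| + `|tau| = tau by rewrite normr0 add0r ger0_norm//; lra.
  split=> //.
  - by rewrite /dom /= in_itv/= gamma_loE// gamma_hiE//; lra.
  - by rewrite /dom /= in_itv/=; lra.
  - rewrite /at_par /= alpha_pos_top; last by lra.
    by rewrite clasp_strut// enorm_eq1// clasp_strut_unit.
apply: le_ereal_inf_tmp => _ [i [j [s [t [ij si tj ->]]]]].
by rewrite lee_fin; apply: enorm_ge1; exact: components_far.
Qed.

End ChainedLink.

(** * Balance of forces at one clasp *)

Section Balance.
Context {R : realType}.
Variables (tau : R).
Hypothesis tau01 : 0 < tau <= 1.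
Local Notation V := 'rV[R]_3.
Local Notation X := (claspX tau).
Local Notation Y := (clasp_gap tau).
Implicit Types (s t u : R) (G A : R -> V) (S E : R -> R).

(** The integral of f against dsqrt (1 - t^2) over [- k, k], folded onto [0, k]
and with the sign changed. *)
Definition cos_primitive (k : R) (f : R -> R) S := {within `[0, k], continuous S} /\
  forall u, 0 < u < k -> is_derive u 1 S (sigma u * (f u - f (- u))).

(** The integral of f against dt over [- k, k], folded onto [0, k]. *)
Definition sin_primitive (k : R) (f : R -> R) E := {within `[0, k], continuous E} /\
  forall u, 0 < u < k -> is_derive u 1 E (f u + f (- u)).

Lemma clasp_gap_sym u : Y (tau - u) = Y u.
Proof.
rewrite /clasp_gap /clasp_den (_ : tau - (tau - u) = u); last by ring.
by congr (Num.sqrt (_ / _)); ring.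
Qed.

(** The coordinates X u, X (tau - u), Y u of the strut are at most 1 and their
squares add up to 1, so their sum is at least 1. *)
Lemma clasp_weight u : 0 < u < tau -> 1 <= Y u * (sigma u + sigma (tau - u) + 1).
Proof.
have tauH := tau01.
move=> ut; have ut' : 0 < tau - u < tau by lra.
have -> : Y u * (sigma u + sigma (tau - u) + 1) = X u + X (tau - u) + Y u.
  by rewrite !claspX_sigma// clasp_gap_sym; ring.
have := clasp_gap_sqr tau01 (x := u) ltac:(lra).
have := claspX_gt0 tau01 ut; have := claspX_gt0 tau01 ut'; have := clasp_gap_gt0 tau01 ut.
move: (X u) (X (tau - u)) (Y u) => a b y y0 b0 a0 E.
have a1 : a <= 1 by nra.
have b1 : b <= 1 by nra.
have y1 : y <= 1 by nra.
have : a * a <= a by nra.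
have : b * b <= b by nra.
have : y * y <= y by nra.
by lra.
Qed.

Lemma neg_cos_deriv u : -1 < u < 1 ->
  is_derive u 1 (fun t : R => - Num.sqrt (1 - t ^+ 2)) (sigma u).
Proof. by move=> u1; rewrite -[sigma u]opprK; apply: is_deriv_opp; exact: cos_deriv. Qed.

Lemma cos_le1 u : 0 <= Num.sqrt (1 - u ^+ 2) <= 1.
Proof.
rewrite sqrtr_ge0/= -[leRHS]sqrtr1; apply: ler_wsqrtr.
by rewrite lerBlDr lerDl sqr_ge0.
Qed.

(** At parameter u, the four struts with |s| = u and |t| = tau - u add up to the
curvature force of gamma at +u and -u and that of alpha at +(tau - u) and
-(tau - u), times 2 Y u: the terms in G 0 0 and A 0 1 cancel by symmetry.
Hence F has a nonnegative derivative, the term in eps being provided by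
clasp_weight. *)
Lemma clasp_pair_balance G A Sg Eg Sa Ea (eps : R) : 0 <= eps ->
  (forall s t, `|s| + `|t| = tau ->
    - eps <= dot (G s - A t) (vec3 (- X t) (X s) (- Y `|s|))) ->
  cos_primitive tau (fun t => G t 0 1) Sg -> sin_primitive tau (fun t => G t 0 2) Eg ->
  cos_primitive 1 (fun t => A t 0 0) Sa -> sin_primitive 1 (fun t => A t 0 2) Ea ->
  - (6 * eps) <= Sg tau - Sg 0 - (Eg tau - Eg 0) + (Sa tau - Sa 0) + (Ea tau - Ea 0).
Proof.
have tauH := tau01.
move=> e0 H [cSg dSg] [cEg dEg] [cSa dSa] [cEa dEa].
pose C u : R := - Num.sqrt (1 - u ^+ 2).
pose F u := Sg u - Eg u - (Sa (tau - u) + Ea (tau - u)) + 2 * eps * (C u - C (tau - u) + u).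
pose dF u := sigma u * (G u 0 1 - G (- u) 0 1) - (G u 0 2 + G (- u) 0 2)
  - (- (sigma (tau - u) * (A (tau - u) 0 0 - A (- (tau - u)) 0 0))
     + - (A (tau - u) 0 2 + A (- (tau - u)) 0 2))
  + 2 * eps * (sigma u - - sigma (tau - u) + 1).
have refl (f : R -> R) : {within `[0, 1], continuous f} ->
    {within `[0, tau], continuous (fun t => f (tau - t))}.
  apply: (within_itv_comp (c := 0) (d := 1) (h := fun t => tau - t)); first by move=> ? ?; lra.
  by apply: within_itvB; [exact: within_itv_cst|exact: within_itv_id].
have cC (k : R) : {within `[0, k], continuous C}.
  by apply: within_itvN; apply: within_itv_cont; exact: cos_continuous.
have cF : {within `[0, tau], continuous F}.
  apply: within_itvD.
    by apply: within_itvB; [exact: within_itvB|apply: within_itvD; exact: refl].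
  apply: within_itvZ; apply: within_itvD; last exact: within_itv_id.
  by apply: within_itvB; [exact: cC|apply: refl; exact: cC].
have : F 0 <= F tau.
  apply: (deriv_ge0_le (dF := dF)) => //; first by lra.
    move=> u ut; have ut' : 0 < tau - u < 1 by lra.
    have c1 : is_derive u 1 C (sigma u) by apply: neg_cos_deriv; lra.
    have c2 : is_derive (tau - u) 1 C (sigma (tau - u)) by apply: neg_cos_deriv; lra.
    exact: is_deriv_add (is_deriv_sub (is_deriv_sub (dSg u ut) (dEg u ut))
      (is_deriv_add (is_deriv_reflect (dSa _ ut')) (is_deriv_reflect (dEa _ ut'))))
      (is_deriv_scale _ (is_deriv_add (is_deriv_sub c1 (is_deriv_reflect c2)) (is_deriv_id u))).
  move=> u ut; set v := tau - u.
  have ut' : 0 < v < tau by rewrite /v; lra.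
  have Y0 := clasp_gap_gt0 tau01 ut.
  have nu : `|u| = u by rewrite gtr0_norm//; lra.
  have nv : `|v| = v by rewrite gtr0_norm//; lra.
  have uv : u + v = tau by rewrite /v; ring.
  (* The four struts at u, with both signs on each side. *)
  have H1 := H u v ltac:(by rewrite nu nv).
  have H2 := H (- u) v ltac:(by rewrite normrN nu nv).
  have H3 := H u (- v) ltac:(by rewrite normrN nu nv).
  have H4 := H (- u) (- v) ltac:(by rewrite !normrN nu nv).
  rewrite -(pmulr_rge0 _ Y0).
  have W := clasp_weight ut.
  have {}W : 2 * eps <= 2 * eps * (Y u * (sigma u + sigma v + 1)).
    by rewrite ler_peMr// mulr_ge0.
  move: H1 H2 H3 H4; rewrite !normrN nu !claspXN !dotE !vec3E !mxE.
  rewrite !claspX_sigma// clasp_gap_sym /dF -/v.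
  have -> : Y u * (sigma u * (G u 0 1 - G (- u) 0 1) - (G u 0 2 + G (- u) 0 2) -
     (- (sigma v * (A v 0 0 - A (- v) 0 0)) + - (A v 0 2 + A (- v) 0 2)) +
     2 * eps * (sigma u - - sigma v + 1)) =
     sigma u * Y u * (G u 0 1 - G (- u) 0 1) - Y u * (G u 0 2 + G (- u) 0 2)
     + sigma v * Y u * (A v 0 0 - A (- v) 0 0) + Y u * (A v 0 2 + A (- v) 0 2)
     + 2 * eps * (Y u * (sigma u + sigma v + 1)) by ring.
  set w := 2 * eps * (Y u * _) in W *.
  by move: (sigma u * Y u) (sigma v * Y u) => a b; lra.
rewrite /F subrr subr0 /C !expr0n/= subr0 sqrtr1.
have [q0 q1] := andP (cos_le1 tau).
set q := Num.sqrt _ in q0 q1 *.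
have : 2 * eps * (- q - -1 + tau - (-1 - - q)) <= 6 * eps.
  have -> : 6 * eps = 2 * eps * 3 by ring.
  by apply: ler_wpM2l; lra.
by lra.
Qed.

(** Two symmetric radii of the circular arcs add up to the curvature force of
alpha, times sqrt (1 - u^2), and to a vertical force on the tip G 0. *)
Lemma tip_arc_balance G A Sa Ea (eps : R) : 0 <= eps ->
  (forall t, tau <= `|t| <= 1 ->
    - eps <= dot (G 0 - A t) (vec3 (- t) 0 (- Num.sqrt (1 - t ^+ 2)))) ->
  cos_primitive 1 (fun t => A t 0 0) Sa -> sin_primitive 1 (fun t => A t 0 2) Ea ->
  2 * (1 - tau) * G 0 0 2 - 4 * eps <= Sa 1 - Sa tau + (Ea 1 - Ea tau).
Proof.
have tauH := tau01.
move=> e0 H [cSa dSa] [cEa dEa]; set z := G 0 0 2.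
pose C u : R := - Num.sqrt (1 - u ^+ 2).
pose F u := Sa u + Ea u - 2 * z * u + 2 * eps * (C u + u).
pose dF u := sigma u * (A u 0 0 - A (- u) 0 0) + (A u 0 2 + A (- u) 0 2)
  - 2 * z * 1 + 2 * eps * (sigma u + 1).
have cF : {within `[tau, 1], continuous F}.
  apply: (@within_itvW _ _ 0 1); [lra|lra|].
  apply: within_itvD.
    by apply: within_itvB; [exact: within_itvD|apply: within_itvZ; exact: within_itv_id].
  apply: within_itvZ; apply: within_itvD; last exact: within_itv_id.
  by apply: within_itvN; apply: within_itv_cont; exact: cos_continuous.
have : F tau <= F 1.
  apply: (deriv_ge0_le (dF := dF)) => //; first by lra.
    move=> u ut; have ut' : 0 < u < 1 by lra.
    have c1 : is_derive u 1 C (sigma u) by apply: neg_cos_deriv; lra.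
    exact: is_deriv_add (is_deriv_sub (is_deriv_add (dSa u ut') (dEa u ut'))
      (is_deriv_scale _ (is_deriv_id u))) (is_deriv_scale _ (is_deriv_add c1 (is_deriv_id u))).
  move=> u ut.
  have c0 : 0 < Num.sqrt (1 - u ^+ 2) by apply: cos_gt0; lra.
  have nu : `|u| = u by rewrite gtr0_norm//; lra.
  have H1 := H u ltac:(rewrite nu; lra); have H2 := H (- u) ltac:(rewrite normrN nu; lra).
  rewrite -(pmulr_rge0 _ c0).
  have sE : Num.sqrt (1 - u ^+ 2) * sigma u = u by rewrite /sigma; field; rewrite gt_eqF.
  have u2 : Num.sqrt (1 - u ^+ 2) * Num.sqrt (1 - u ^+ 2) = 1 - u * u.
    by have [? ?] := andP ut; rewrite -expr2 sqr_sqrtr ?expr2//; nra.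
  have [_ c1] := andP (cos_le1 u).
  move: H1 H2; rewrite sqrrN !dotE !vec3E !mxE.
  rewrite /dF; set q := Num.sqrt _ in c0 c1 u2 sE *; set sg := sigma u in sE *.
  have -> : q * (sg * (A u 0 0 - A (- u) 0 0) + (A u 0 2 + A (- u) 0 2) - 2 * z * 1 +
    2 * eps * (sg + 1)) = (q * sg) * (A u 0 0 - A (- u) 0 0) + q * (A u 0 2 + A (- u) 0 2)
    - 2 * (q * z) + 2 * eps * (q * sg + q) by ring.
  rewrite sE -/z.
  have W : 2 * eps <= 2 * eps * (u + q).
    by rewrite ler_peMr ?mulr_ge0//; have [? ?] := andP ut; nra.
  by lra.
rewrite /F /C !expr1n subrr sqrtr0.
have [q0 q1] := andP (cos_le1 tau).
set q := Num.sqrt _ in q0 q1 *.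
have : 2 * eps * (- 0 + 1 - (- q + tau)) <= 4 * eps.
  have -> : 4 * eps = 2 * eps * 2 by ring.
  by apply: ler_wpM2l; lra.
by lra.
Qed.

Lemma clasp_balance G A Sg Eg Sa Ea (eps : R) : 0 <= eps ->
  (forall s t, `|s| + `|t| = tau ->
    - eps <= dot (G s - A t) (vec3 (- X t) (X s) (- Y `|s|))) ->
  (forall t, tau <= `|t| <= 1 ->
    - eps <= dot (G 0 - A t) (vec3 (- t) 0 (- Num.sqrt (1 - t ^+ 2)))) ->
  cos_primitive tau (fun t => G t 0 1) Sg -> sin_primitive tau (fun t => G t 0 2) Eg ->
  cos_primitive 1 (fun t => A t 0 0) Sa -> sin_primitive 1 (fun t => A t 0 2) Ea ->
  2 * (1 - tau) * G 0 0 2 - 10 * eps <=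
  Sg tau - Sg 0 - (Eg tau - Eg 0) + (Sa 1 - Sa 0) + (Ea 1 - Ea 0).
Proof.
move=> e0 H1 H2 pSg pEg pSa pEa.
have := clasp_pair_balance e0 H1 pSg pEg pSa pEa.
by have := tip_arc_balance e0 H2 pSa pEa; lra.
Qed.

End Balance.

(** * First variation of the length of each component *)

Section FirstVariation.
Context {R : realType}.
Variables (tau d c : R).
Hypothesis tau01 : 0 < tau <= 1.
Hypothesis d1 : 1 <= d.
Local Notation V := 'rV[R]_3.
Local Notation e := (straight_length tau d c).
Local Notation rho := (alpha_flip d).
Hypothesis e0 : 0 <= e.
Implicit Types (s t u : R) (f : R -> R) (xi : R -> V) (S E : R -> R).

Lemma rs_integral_sin f k a b : 0 < k -> a <= - k -> k <= b ->
  {within `[a, b], continuous f} ->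
  exists2 E, sin_primitive k f E & rs_integral f (clamp k) a b (E k - E 0).
Proof.
move=> k0 ak kb cf; have [E [cE dE rE]] := rs_integral_clamp k0 ak kb cf.
by exists E.
Qed.

Lemma rs_integral_cos f k a b : 0 < k <= 1 -> a <= - k -> k <= b ->
  {within `[a, b], continuous f} ->
  exists2 S, cos_primitive k f S & rs_integral f (ccos k) a b (- (S k - S 0)).
Proof.
move=> k0 ak kb cf; have [S [cS dS rS]] := rs_integral_ccos k0 ak kb cf.
by exists S.
Qed.

Lemma rs_integral_flip f (g : R -> R) I :
  rs_integral (fun t => f (rho t)) g (- (1 + d)) (3 + d) I ->
  rs_integral f (fun t => g (rho t)) (-1) (3 + 2 * d) (- I).
Proof.
move=> H; have := @rs_integral_reflect R f (fun t => g (rho t)) (2 + d) (- (1 + d)) (3 + d) I.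
have -> : 2 + d - (3 + d) = -1 by ring.
have -> : 2 + d - - (1 + d) = 3 + 2 * d by ring.
apply; apply: rs_integral_eq H => // t _.
by rewrite /alpha_flip subKr.
Qed.

Lemma within_coord xi a b i : {within `[a, b], continuous xi} ->
  {within `[a, b], continuous (fun t => xi t 0 i)}.
Proof.
move=> cx t; apply: (@continuous_cvg _ _ _ _ _ xi (fun v : V => v 0 i)).
- exact: nbhs_subspace_filter.
- exact: coord_continuous.
- exact: cx.
Qed.

Lemma stieltjes_tangent (K : component R) (T : R -> V) xi a b I0 I1 I2 :
  tangent_field (curve_of K) T ->
  (if K is Loop c then T (lo c) = T (hi c) else True) ->
  lo (curve_of K) = a -> hi (curve_of K) = b ->
  {within `[a, b], continuous xi} ->
  rs_integral (fun t => xi t 0 0) (fun t => T t 0 0) a b I0 ->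
  rs_integral (fun t => xi t 0 1) (fun t => T t 0 1) a b I1 ->
  rs_integral (fun t => xi t 0 2) (fun t => T t 0 2) a b I2 ->
  stieltjes xi (unit_tangent K) a b = I0 + I1 + I2.
Proof.
move=> TK loop aE bE cx r0 r1 r2; have UE := unit_tangentE TK loop.
rewrite aE bE in UE; have [lh _ _ _ _] := TK; rewrite aE bE in lh.
apply: stieltjesE; first exact: ltW.
apply: rs_integral_stieltjes; first by move=> i; exact: within_coord.
- by apply: rs_integral_eq r0 => // t /UE ->.
- by apply: rs_integral_eq r1 => // t /UE ->.
- by apply: rs_integral_eq r2 => // t /UE ->.
Qed.

Lemma gamma_tangent_ends : gamma_tangent tau (tau + e) = m_plus tau /\
  gamma_tangent tau (- (tau + e)) = - m_minus tau.
Proof.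
have tauH := tau01; have eH := e0.
rewrite /gamma_tangent /ccos; split.
  by rewrite clamp_ge //; lra.
rewrite clamp_le; [|lra..].
by apply: vec_eq; rewrite !(mxE, vec3E)/= ?sqrrN; ring.
Qed.

(** The boundary terms vanish, because at both ends the tangent is normal to the
constraint plane. *)
Lemma dlen_gamma xi : {within `[- (tau + e), tau + e], continuous xi} ->
  dot (m_minus tau) (xi (- (tau + e))) = 0 -> dot (m_plus tau) (xi (tau + e)) = 0 ->
  exists S E, [/\ cos_primitive tau (fun t => xi t 0 1) S,
    sin_primitive tau (fun t => xi t 0 2) E &
    dlen_comp (gamma tau d c) xi = S tau - S 0 - (E tau - E 0)].
Proof.
have tauH := tau01; have eH := e0.
move=> cx xlo xhi.
have [S pS rS] := rs_integral_cos (k := tau) tau01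
  (a := - (tau + e)) (b := tau + e) ltac:(lra) ltac:(lra) (within_coord (i := 1) cx).
have [E pE rE] := rs_integral_sin (k := tau) ltac:(lra)
  (a := - (tau + e)) (b := tau + e) ltac:(lra) ltac:(lra) (within_coord (i := 2) cx).
exists S, E; split=> //.
have fr := gamma_frame tau01 e0.
have UE := unit_tangentE (K := gamma tau d c) fr Logic.I.
rewrite /= gamma_loE// gamma_hiE// in UE.
have sE : stieltjes xi (unit_tangent (gamma tau d c)) (- (tau + e)) (tau + e) =
    0 + - (S tau - S 0) + (E tau - E 0).
  apply: (stieltjes_tangent (K := gamma tau d c) fr) => //=.
  - exact: gamma_loE.
  - exact: gamma_hiE.
  - by apply: (@rs_integral_cst _ _ _ _ _ 0) => t _; rewrite vec3E.
  - by apply: rs_integral_eq rS => // t _; rewrite vec3E.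
  - by apply: rs_integral_eq rE => // t _; rewrite vec3E.
have [hE lE] := gamma_tangent_ends.
rewrite /dlen_comp /= gamma_loE// gamma_hiE// sE !UE; [|lra..].
by rewrite hE lE xhi dotNl xlo; ring.
Qed.

(** The mirror image of dlen_gamma. *)
Lemma dlen_beta xi : {within `[- (tau + e), tau + e], continuous xi} ->
  dot (m'_minus tau) (xi (- (tau + e))) = 0 -> dot (m'_plus tau) (xi (tau + e)) = 0 ->
  exists S E, [/\ cos_primitive tau (fun t => mirror (xi t) 0 1) S,
    sin_primitive tau (fun t => mirror (xi t) 0 2) E &
    dlen_comp (beta tau d c) xi = S tau - S 0 - (E tau - E 0)].
Proof.
have tauH := tau01; have eH := e0.
move=> cx xlo xhi.
have [S pS rS] := rs_integral_cos (k := tau) tau01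
  (a := - (tau + e)) (b := tau + e) ltac:(lra) ltac:(lra) (within_coord (i := 1) cx).
have [E [cE dE] rE] := rs_integral_sin (k := tau) ltac:(lra)
  (a := - (tau + e)) (b := tau + e) ltac:(lra) ltac:(lra) (within_coord (i := 2) cx).
exists S, (fun t => - E t); split.
- by split=> [|u ut]; [case: pS|rewrite !vec3E; case: pS => _; exact].
- split=> [|u ut]; first exact: within_itvN.
  by rewrite !vec3E -opprD; apply: is_deriv_opp; exact: dE.
have fr := tangent_field_mirror (gamma_frame tau01 e0).
have UE := unit_tangentE (K := beta tau d c) fr Logic.I.
rewrite /= gamma_loE// gamma_hiE// in UE.
have sE : stieltjes xi (unit_tangent (beta tau d c)) (- (tau + e)) (tau + e) =
    0 + - (S tau - S 0) + - (E tau - E 0).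
  apply: (stieltjes_tangent (K := beta tau d c) fr) => //=.
  - exact: gamma_loE.
  - exact: gamma_hiE.
  - by apply: (@rs_integral_cst _ _ _ _ _ 0) => t _; rewrite !vec3E.
  - by apply: rs_integral_eq rS => // t _; rewrite !vec3E.
  - by apply: rs_integral_eq (rs_integralN rE) => // t _; rewrite !vec3E.
have [hE lE] := gamma_tangent_ends.
rewrite /dlen_comp /= gamma_loE// gamma_hiE// sE !UE; [|lra..].
rewrite /= hE lE.
have -> : mirror (m_plus tau) = m'_plus tau by apply: vec_eq; rewrite !vec3E.
have -> : mirror (- m_minus tau) = - m'_minus tau.
  by apply: vec_eq; rewrite !(mxE, vec3E)/= ?opprK.
by rewrite xhi dotNl xlo; ring.
Qed.

(** The primed terms are those of the lower half, seen in the mirror. *)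
Lemma dlen_alpha xi : {within `[-1, 3 + 2 * d], continuous xi} ->
  exists S S' E E', [/\
    cos_primitive 1 (fun t => xi t 0 0) S /\ sin_primitive 1 (fun t => xi t 0 2) E,
    cos_primitive 1 (fun t => mirror (xi (rho t)) 0 0) S' /\
    sin_primitive 1 (fun t => mirror (xi (rho t)) 0 2) E' &
    dlen_comp (alpha tau d) xi = (S 1 - S 0) + (E 1 - E 0) + ((S' 1 - S' 0) + (E' 1 - E' 0))].
Proof.
have dH := d1.
move=> cx.
have cf i : {within `[- (1 + d), 3 + d], continuous (fun t => xi (rho t) 0 i)}.
  apply: (within_itv_comp (c := -1) (d := 3 + 2 * d) (h := rho)) (within_coord (i := i) cx).
    by move=> t ?; rewrite /alpha_flip; lra.
  by apply: within_itv_cont; exact: alpha_flip_continuous.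
have [S pS rS] := rs_integral_cos (k := 1) ltac:(lra)
  (a := -1) (b := 3 + 2 * d) ltac:(lra) ltac:(lra) (within_coord (i := 0) cx).
have [E pE rE] := rs_integral_sin (k := 1) ltac:(lra)
  (a := -1) (b := 3 + 2 * d) ltac:(lra) ltac:(lra) (within_coord (i := 2) cx).
have [S' pS' rS'] := rs_integral_cos (k := 1) ltac:(lra)
  (a := - (1 + d)) (b := 3 + d) ltac:(lra) ltac:(lra) (cf 0).
have [E' [cE' dE'] rE'] := rs_integral_sin (k := 1) ltac:(lra)
  (a := - (1 + d)) (b := 3 + d) ltac:(lra) ltac:(lra) (cf 2).
exists S, S', E, (fun t => - E' t); split=> //.
  split; first by split=> [|u ut]; [case: pS'|rewrite !vec3E; case: pS' => _; exact].
  split=> [|u ut]; first exact: within_itvN.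
  by rewrite !vec3E -opprD; apply: is_deriv_opp; exact: dE'.
rewrite /dlen_comp /=.
have -> : stieltjes xi (unit_tangent (alpha tau d)) (-1) (3 + 2 * d) =
    (- (S 1 - S 0) + - (- - (S' 1 - S' 0))) + 0 + (0 + - (E 1 - E 0) + - - (E' 1 - E' 0)).
  apply: (stieltjes_tangent (K := alpha tau d) (alpha_frame tau01 d1)) => //=.
  - exact: alpha_tangent_closed.
  - apply: rs_integral_eq (rs_integralD rS (rs_integralN (rs_integral_flip rS'))) => // t _.
    by rewrite vec3E.
  - by apply: (@rs_integral_cst _ _ _ _ _ 0) => t _; rewrite !vec3E.
  - apply: rs_integral_eq (rs_integralD (rs_integralD
      (@rs_integral_cst R (fun t => xi t 0 2) (fun=> 1) (-1) (3 + 2 * d) 1 (fun _ _ => erefl)) (rs_integralN rE))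
      (rs_integralN (rs_integral_flip rE'))) => // t _.
    by rewrite vec3E.
by ring.
Qed.

End FirstVariation.

(** * Strong criticality *)

Section Criticality.
Context {R : realType}.
Variables (tau d c : R).
Hypothesis tau01 : 0 < tau <= 1.
Hypothesis d1 : 1 <= d.
Hypothesis tips : tau = 1 \/ d = 1.
Local Notation V := 'rV[R]_3.
Local Notation L := (chained_clasp tau d c).
Local Notation e := (straight_length tau d c).
Local Notation rho := (alpha_flip d).
Hypothesis e0 : 0 <= e.
Implicit Types (s t u : R).

Lemma sum_ord3 (F : 'I_3 -> R) : \sum_(i < 3) F i = F 0 + F 1 + F 2.
Proof.
rewrite !big_ord_recl big_ord0 addr0 addrA.
by congr (_ + F _ + F _); apply/val_inj.
Qed.

Lemma dlen_chained (xi : vectorfield L) : dlen xi =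
  dlen_comp (alpha tau d) (xi (0 : 'I_3)) + dlen_comp (beta tau d c) (xi (1 : 'I_3))
  + dlen_comp (gamma tau d c) (xi (2 : 'I_3)).
Proof. exact: (sum_ord3 (fun i => dlen_comp (@Defs.comp R L i) (xi i))). Qed.

Lemma strut_bound (eps : R) (xi : vectorfield L) (i j : 'I_(ncomp L)) s t (w : V) :
  (forall (i j : 'I_(ncomp L)) s t, gehring_strut i j s t ->
     let w := at_par (Defs.comp i) s - at_par (Defs.comp j) t in
     - eps < dot (xi i s - xi j t) ((enorm w)^-1 *: w)) ->
  i != j -> dom (Defs.comp i) s -> dom (Defs.comp j) t ->
  at_par (Defs.comp i) s - at_par (Defs.comp j) t = w -> dot w w = 1 ->
  - eps <= dot (xi i s - xi j t) w.
Proof.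
move=> H ij si tj wE w1.
have st : gehring_strut i j s t.
  by split=> //; rewrite wE enorm_eq1// GThi_chained.
have := H i j s t st; rewrite /= wE enorm_eq1// invr1 scale1r.
exact: ltW.
Qed.

Lemma mirrorB (v w : V) : mirror (v - w) = mirror v - mirror w.
Proof. by apply: vec_eq; rewrite !(vec3E, mxE)/=; ring. Qed.

Lemma within_chained (xi : vectorfield L) (i : 'I_(ncomp L)) a b :
  lo (curve_of (Defs.comp i)) = a -> hi (curve_of (Defs.comp i)) = b ->
  {within dom (Defs.comp i), continuous (xi i)} -> {within `[a, b], continuous (xi i)}.
Proof. by move=> <- <-. Qed.

Lemma dom_arc s : `|s| <= tau -> `[gamma_lo tau d c, gamma_hi tau d c]%classic s.
Proof.
have tauH := tau01; have eH := e0.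
by rewrite /= in_itv/= gamma_loE// gamma_hiE// ler_norml => ?; lra.
Qed.

Lemma dom_alpha_top t : `|t| <= 1 -> `[-1, 3 + 2 * d]%classic t.
Proof. by have dH := d1; rewrite /= in_itv/= ler_norml => ?; lra. Qed.

Lemma dom_alpha_bottom t : `|t| <= 1 -> `[-1, 3 + 2 * d]%classic (rho t).
Proof. by have dH := d1; rewrite /= in_itv/= /alpha_flip ler_norml => ?; lra. Qed.

(** The two clasps leave opposite vertical forces 2 (1 - tau) on the tips of beta
and gamma, which the strut between the tips takes up; for tau = 1 they vanish.
The 22 is 10 for each clasp and 2 for the tips. *)
Lemma dlen_balance (A B G : R -> V) (eps : R) : 0 <= eps ->
  {within `[-1, 3 + 2 * d], continuous A} ->
  {within `[- (tau + e), tau + e], continuous B} ->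
  {within `[- (tau + e), tau + e], continuous G} ->
  dot (m'_minus tau) (B (- (tau + e))) = 0 -> dot (m'_plus tau) (B (tau + e)) = 0 ->
  dot (m_minus tau) (G (- (tau + e))) = 0 -> dot (m_plus tau) (G (tau + e)) = 0 ->
  (forall s t, `|s| + `|t| = tau -> - eps <= dot (G s - A t)
     (vec3 (- claspX tau t) (claspX tau s) (- clasp_gap tau `|s|))) ->
  (forall t, tau <= `|t| <= 1 -> - eps <= dot (G 0 - A t)
     (vec3 (- t) 0 (- Num.sqrt (1 - t ^+ 2)))) ->
  (forall s t, `|s| + `|t| = tau -> - eps <= dot (mirror (B s) - mirror (A (rho t)))
     (vec3 (- claspX tau t) (claspX tau s) (- clasp_gap tau `|s|))) ->
  (forall t, tau <= `|t| <= 1 -> - eps <= dot (mirror (B 0) - mirror (A (rho t)))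
     (vec3 (- t) 0 (- Num.sqrt (1 - t ^+ 2)))) ->
  (d = 1 -> - eps <= dot (G 0 - B 0) (vec3 0 0 1)) ->
  - (22 * eps) <=
    dlen_comp (alpha tau d) A + dlen_comp (beta tau d c) B + dlen_comp (gamma tau d c) G.
Proof.
move=> eps0 cA cB cG blo bhi glo ghi top1 top2 bot1 bot2 tip.
have [Sg [Eg [pSg pEg ->]]] := dlen_gamma tau01 e0 cG glo ghi.
have [Sb [Eb [pSb pEb ->]]] := dlen_beta tau01 e0 cB blo bhi.
have [Sa [Sa' [Ea [Ea' [[pSa pEa] [pSa' pEa'] ->]]]]] := dlen_alpha tau01 d1 cA.
have := clasp_balance tau01 eps0 top1 top2 pSg pEg pSa pEa.
have := clasp_balance tau01 eps0 (G := mirror \o B) (A := fun t => mirror (A (rho t)))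
  bot1 bot2 pSb pEb pSa' pEa'.
rewrite /= vec3E.
have : - (2 * eps) <= 2 * (1 - tau) * (G 0 0 2 - B 0 0 2).
  have [tE|/tip] := tips; first by rewrite tE subrr mulr0 mul0r oppr_le0 mulr_ge0.
  rewrite dotE !vec3E !mxE !mulr0 !add0r mulr1.
  by have [t0 t1] := andP tau01; clear -eps0 t0 t1; nra.
by clear; lra.
Qed.

Lemma abs_bounds s t : `|s| + `|t| = tau -> `|s| <= tau /\ `|t| <= 1.
Proof.
have tauH := tau01.
by have := normr_ge0 s; have := normr_ge0 t; lra.
Qed.

Lemma norm0_le_tau : `|0 : R| <= tau.
Proof. by rewrite normr0; case/andP: tau01 => /ltW. Qed.

Lemma tips_strut : d = 1 -> gamma_pos tau d 0 - mirror (gamma_pos tau d 0) = vec3 0 0 1.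
Proof.
have tauH := tau01.
move=> dE; have -> : gamma_pos tau d 0 = vec3 0 0 (d / 2).
  rewrite gammaE// clamp_id; last by lra.
  by rewrite subrr normr0 claspX0 claspZ0; congr vec3; ring.
by rewrite dE; apply: vec_eq; rewrite !(vec3E, mxE)/=; lra.
Qed.

Lemma chained_clasp_critical : strongly_critical L.
Proof.
pose eps : R := 23^-1; exists eps; first by rewrite invr_gt0.
move=> xi cxi dl; rewrite leNgt; apply/negP; rewrite lt_min => /andP[Hg _].
have H (i j : 'I_(ncomp L)) s t : gehring_strut i j s t ->
     let w := at_par (Defs.comp i) s - at_par (Defs.comp j) t in
     - eps < dot (xi i s - xi j t) ((enorm w)^-1 *: w).
  move=> st /=; rewrite -lte_fin; apply: lt_le_trans Hg _.
  by apply: ereal_inf_lbound; exists i, j, s, t; split.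
have [ca _] := cxi (0 : 'I_3); have [cb [blo bhi]] := cxi (1 : 'I_3).
have [cg [glo ghi]] := cxi (2 : 'I_3).
have [_ [_ _ pblo pbhi]] := beta_component_wf tau01 e0.
have [_ [_ _ pglo pghi]] := gamma_component_wf tau01 e0.
have {}blo := plane_tangent pblo blo; have {}bhi := plane_tangent pbhi bhi.
have {}glo := plane_tangent pglo glo; have {}ghi := plane_tangent pghi ghi.
rewrite /= ?gamma_loE// ?gamma_hiE// in blo bhi glo ghi.
have {}ca : {within `[-1, 3 + 2 * d], continuous (xi (0 : 'I_3))} by exact: within_chained ca.
have {}cb : {within `[- (tau + e), tau + e], continuous (xi (1 : 'I_3))}.
  by apply: within_chained cb; [exact: gamma_loE|exact: gamma_hiE].
have {}cg : {within `[- (tau + e), tau + e], continuous (xi (2 : 'I_3))}.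
  by apply: within_chained cg; [exact: gamma_loE|exact: gamma_hiE].
suff : - (22 * eps) <= -1.
  by rewrite lerN2 /eps ler_pdivlMr ?ltr0n// mul1r ler_nat.
rewrite -[leRHS]dl dlen_chained; apply: dlen_balance => //.
- by rewrite invr_ge0.
- move=> s t st; have [s1 t1] := abs_bounds st.
  apply: (strut_bound H) => //; [exact: dom_arc|exact: dom_alpha_top| |exact: clasp_strut_unit].
  by rewrite /at_par /= alpha_pos_top ?clasp_strut// -ler_norml.
- move=> t /[dup] tt /andP[_ t1].
  apply: (strut_bound H) => //; [exact/dom_arc/norm0_le_tau|exact: dom_alpha_top| |exact: tip_strut_unit].
  by rewrite /at_par /= alpha_pos_top ?tip_strut// -ler_norml.
- move=> s t st; have [s1 t1] := abs_bounds st.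
  rewrite -mirrorB dot_mirror.
  apply: (strut_bound H) => //; [exact: dom_arc|exact: dom_alpha_bottom| |].
    by rewrite /at_par /= alpha_pos_bottom -?mirrorB ?clasp_strut// -ler_norml.
  by rewrite dot_mirror mirrorK; exact: clasp_strut_unit.
- move=> t /[dup] tt /andP[_ t1].
  rewrite -mirrorB dot_mirror.
  apply: (strut_bound H) => //; [exact/dom_arc/norm0_le_tau|exact: dom_alpha_bottom| |].
    by rewrite /at_par /= alpha_pos_bottom -?mirrorB ?tip_strut// -ler_norml.
  by rewrite dot_mirror mirrorK; exact: tip_strut_unit.
- move=> dE; apply: (strut_bound H) => //; [exact/dom_arc/norm0_le_tau|exact/dom_arc/norm0_le_tau| |].
    exact: tips_strut.
  by rewrite dotE !vec3E !mulr0 !add0r mulr1.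
Qed.

End Criticality.

Theorem theorem6p1 (R : realType) (tau d c : R)
    (htau : (0 < tau < 1 /\ d = 1) \/ (tau = 1 /\ 1 <= d))
    (hc : avoids_obstacles (chained_clasp tau d c)) :
  generalized_link (chained_clasp tau d c) /\
  strongly_critical (chained_clasp tau d c).
Proof.
have tau01 : 0 < tau <= 1 by case: htau => -[]; lra.
have d1 : 1 <= d by case: htau => -[]; lra.
have tips : tau = 1 \/ d = 1 by case: htau => -[? ?]; [right|left].
have e0 := straight_length_ge0 tau01 d1 hc.
split; first exact: chained_clasp_link.
exact: chained_clasp_critical.
Qed.
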